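(* Suppose $f\in\mathcal H_0$ satisfies $\mathcal P f=\lambda f$ for some $\lambda\in\mathbb C$, $\lambda\neq0$. Then $f$ is the (ordinary) Laplace transform of a function $\psi\in L_2(\hat m)$ which is self-reciprocal with respect to the Hankel transform of order $1$; namely, $f$ (extended analytically to the half-plane $\{\operatorname{Re}w>0\}$) and $\psi$ satisfy $$f(w)=\int_0^\infty e^{-tw}\,\psi(t)\,dt\qquad\text{for all } w \text{ with } \operatorname{Re}w>0,$$ and $$\psi(t)=\int_0^\infty J_1(2\sqrt{st})\,\sqrt{\frac ts}\;\psi(s)\,ds .$$
   Context: Let $m$ be the measure on $\mathbb R^+=(0,\infty)$ given by $dm(t)=\frac{t}{e^t-1}\,dt$, and let $\hat m$ be the measure on $\mathbb R^+$ given by $d\hat m(t)=\frac{e^{-t}(1-e^{-t})}{t\,\log 2}\,dt$. $L_2(m)$, $L_2(\hat m)$ are the complex Hilbert spaces of square-integrable functions. $\mathcal H_0$ is the Hilbert space of all functions of the form $$f(w)=(\mathcal B[\varphi])(w):=\frac1{w^2}\int_0^\infty e^{-t/w}\,e^t\,\varphi(t)\,dm(t),\qquad \varphi\in L_2(m),$$ which are holomorphic in the disk $\{w\in\mathbb C:\operatorname{Re}(1/w)>1/2\}=\{|w-1|<1\}$, with inner product $(\mathcal B[\varphi_1],\mathcal B[\varphi_2])=\int_0^\infty\overline{\varphi_1}\,\varphi_2\,dm$. $\mathcal P$ is the transfer operator of the Farey map, acting on $\mathcal H_0$ by $$(\mathcal P f)(w)=\Big(\frac1{w+1}\Big)^2\Big[f\Big(\frac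 w{w+1}\Big)+f\Big(\frac1{w+1}\Big)\Big].$$ $J_1$ is the Bessel function of the first kind of order $1$. The (version of the) Hankel transform of order $1$ used here is $(\mathcal J\psi)(t)=\int_0^\infty J_1(2\sqrt{st})\sqrt{t/s}\,\psi(s)\,ds$, the integral being understood as an improper integral (e.g. for $\psi\equiv1$ it converges only conditionally). *)

(* Defs.v *)
From HB Require Import structures.
From mathcomp Require Import all_boot all_order all_algebra.
From mathcomp Require Import complex.
From mathcomp Require Import all_classical all_reals all_analysis.
From mathcomp Require Import measurable_realfun.

Set Implicit Arguments.
Unset Strict Implicit.
Unset Printing Implicit Defensive.

Import Order.TTheory GRing.Theory Num.Theory.
Import numFieldNormedType.Exports.

Local Open Scope classical_set_scope.
Local Open Scope complex_scope.
Local Open Scope ring_scope.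

Definition Rpos {R : realType} : set R := `]0, +oo[%classic.

(* The measure [w t dt] on (0, +oo), as a measure on R that does not charge
   the complement of (0, +oo). *)
Definition density_measure {R : realType} (w : R -> R) (A : set R) : \bar R :=
  (\int[lebesgue_measure]_(t in A `&` Rpos) (w t)%:E)%E.

Section DensityMeasure.
Context {R : realType} (w : R -> R).
Hypothesis w_ge0 : forall t, 0 < t -> 0 <= w t.
Hypothesis w_continuous : forall t, 0 < t -> {for t, continuous w}.

Lemma density_measure0 : density_measure w set0 = 0%E.
Proof. by rewrite /density_measure set0I integral_set0. Qed.

Lemma density_measure_ge0 A : (0 <= density_measure w A)%E.
Proof.
apply: integral_ge0 => t [_]; rewrite /Rpos /= in_itv /= andbT => t0.
by rewrite lee_fin w_ge0.
Qed.

Lemma measurable_Rpos : measurable (@Rpos R).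
Proof. by rewrite /Rpos; exact: measurable_itv. Qed.

Lemma measurable_density : measurable_fun Rpos w.
Proof.
apply: open_continuous_measurable_fun; first by rewrite /Rpos.
move=> t; rewrite inE /Rpos /= in_itv /= andbT; exact: w_continuous.
Qed.

Lemma density_measure_sigma_additive : semi_sigma_additive (density_measure w).
Proof.
move=> F mF tF mUF; rewrite /density_measure; apply: cvg_toP.
  apply: ereal_nondecreasing_is_cvgn => m n mn.
  by apply: lee_sum_nneg_natr => // k _ _; exact: density_measure_ge0.
rewrite setI_bigcupl ge0_integral_bigcup//.
- by move=> k; apply: measurableI; [exact: mF|exact: measurable_Rpos].
- apply/measurable_EFinP; apply: (measurable_funS _ _ measurable_density).
    exact: measurable_Rpos.
  by move=> t [k _ []].
- move=> t [k _ [_]]; rewrite /Rpos /= in_itv /= andbT => t0.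
  by rewrite lee_fin w_ge0.
- exact: trivIset_setIr.
Qed.

End DensityMeasure.

Section MeasureM.
Context {R : realType}.

Definition m_density (t : R) : R := t / (expR t - 1).

Lemma m_density_ge0 t : 0 < t -> 0 <= m_density t.
Proof.
move=> t0; rewrite /m_density divr_ge0 ?(ltW t0)// subr_ge0.
by rewrite -expR0 ler_expR ltW.
Qed.

Lemma m_density_continuous t : 0 < t -> {for t, continuous m_density}.
Proof.
move=> t0; apply: cvgM; first exact: cvg_id.
apply: cvgV; first by rewrite subr_eq0 gt_eqF// -expR0 ltr_expR.
by apply: cvgB; [exact: continuous_expR|exact: cvg_cst].
Qed.

Definition m_measure : set (measurableTypeR R) -> \bar R :=
  density_measure m_density.

HB.instance Definition _ := isMeasure.Build _ _ _ m_measure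
  (density_measure0 m_density)
  (density_measure_ge0 m_density_ge0)
  (density_measure_sigma_additive m_density_ge0 m_density_continuous).

Definition mhat_density (t : R) : R :=
  (expR (- t) * (1 - expR (- t))) / (t * ln 2).

Lemma mhat_density_ge0 t : 0 < t -> 0 <= mhat_density t.
Proof.
move=> t0; apply: divr_ge0.
  by rewrite mulr_ge0 ?expR_ge0// subr_ge0 -expR0 ler_expR oppr_le0 ltW.
by rewrite mulr_ge0 ?(ltW t0)// ln_ge0// ler1n.
Qed.

Lemma mhat_density_continuous t : 0 < t -> {for t, continuous mhat_density}.
Proof.
move=> t0.
have cexpN : (fun x : R => expR (- x)) @ t --> expR (- t).
  by apply: (cvg_comp _ _ (cvgN cvg_id)); exact: continuous_expR.
apply: cvgM; last first.
  apply: cvgV; first by rewrite mulf_neq0 ?gt_eqF// ln_gt0// ltr1n.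
  by apply: cvgM; [exact: cvg_id|exact: cvg_cst].
by apply: cvgM => //; apply: cvgB => //; exact: cvg_cst.
Qed.

Definition mhat_measure : set (measurableTypeR R) -> \bar R :=
  density_measure mhat_density.

HB.instance Definition _ := isMeasure.Build _ _ _ mhat_measure
  (density_measure0 mhat_density)
  (density_measure_ge0 mhat_density_ge0)
  (density_measure_sigma_additive mhat_density_ge0 mhat_density_continuous).

End MeasureM.

Section ComplexAnalysis.
Context {R : realType}.

Definition cexp (z : R[i]) : R[i] :=
  (expR (complex.Re z))%:C * (cos (complex.Im z) +i* sin (complex.Im z)).

Definition cintegrable (mu : {measure set (measurableTypeR R) -> \bar R})
    (D : set R) (g : R -> R[i]) : Prop :=
  mu.-integrable D (fun t => (complex.Re (g t))%:E) /\
  mu.-integrable D (fun t => (complex.Im (g t))%:E).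

Definition cintegral (mu : {measure set (measurableTypeR R) -> \bar R})
    (D : set R) (g : R -> R[i]) : R[i] :=
  (\int[mu]_(t in D) complex.Re (g t))%R +i*
  (\int[mu]_(t in D) complex.Im (g t))%R.

(* Representatives of the elements of the complex space L_2(mu) on (0, +oo). *)
Definition L2 (mu : {measure set (measurableTypeR R) -> \bar R})
    (g : R -> R[i]) : Prop :=
  [/\ measurable_fun (Rpos : set (measurableTypeR R))
        (fun t => complex.Re (g t)),
      measurable_fun (Rpos : set (measurableTypeR R))
        (fun t => complex.Im (g t)) &
      (\int[mu]_(t in Rpos)
         (complex.Re (g t) ^+ 2 + complex.Im (g t) ^+ 2)%:E < +oo)%E].

(* For an open set D; the scalar field of the normed space R[i]^o is R[i], so
   [derivable] is complex differentiability. *)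
Definition holomorphic_on (D : set R[i]) (F : R[i] -> R[i]) : Prop :=
  forall w, D w -> derivable (F : R[i]^o -> R[i]^o) w 1.

(* The power series converges for every real x, so [limn] is its sum. *)
Definition besselJ1 (x : R) : R :=
  limn (series (fun k : nat =>
    (-1) ^+ k / (k`!%:R * k.+1`!%:R) * (x / 2) ^+ (2 * k + 1)%N)).

End ComplexAnalysis.

Section Farey.
Context {R : realType}.

Definition farey_disk : set R[i] := [set w | 2^-1 < complex.Re (w^-1)].

Definition right_half_plane : set R[i] := [set w | 0 < complex.Re w].

Definition borel_transform (phi : R -> R[i]) (w : R[i]) : R[i] :=
  (w ^+ 2)^-1 *
  cintegral m_measure Rpos (fun t => cexp (- (t%:C / w)) * (expR t)%:C * phi t).

(* f is a total function; only its values on the disk are constrained. *)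
Definition in_H0 (f : R[i] -> R[i]) : Prop :=
  exists2 phi : R -> R[i], L2 m_measure phi &
    forall w, farey_disk w -> f w = borel_transform phi w.

Definition farey_transfer (f : R[i] -> R[i]) (w : R[i]) : R[i] :=
  (1 / (w + 1)) ^+ 2 * (f (w / (w + 1)) + f (1 / (w + 1))).

Definition is_laplace (psi : R -> R[i]) (w l : R[i]) : Prop :=
  let g := fun t => cexp (- (t%:C * w)) * psi t in
  cintegrable lebesgue_measure Rpos g /\
  l = cintegral lebesgue_measure Rpos g.

(* The integral over (0, +oo) is improper at +oo: the limit as A --> +oo of the
   Lebesgue integrals over (0, A]. *)
Definition is_hankel1 (psi : R -> R[i]) (t : R) (l : R[i]) : Prop :=
  let g := fun s =>
    (besselJ1 (2 * Num.sqrt (s * t)) * Num.sqrt (t / s))%:C * psi s in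
  (forall A : R, 0 < A -> cintegrable lebesgue_measure `]0, A]%classic g) /\
  (cintegral lebesgue_measure `]0, A]%classic g : R[i]^o) @[A --> +oo]
    --> (l : R[i]^o).

End Farey.

(* Main.v *)
(* With [p = e^t * (dm/dt) * phi], an element of [L_2(mhat)], one has
   [f w = w^-2 * L[p](1/w)] on the disk, [L] being the Laplace transform.  Let [H]
   be the Hankel transform; its kernel is [t * E (s * t)] with
   [E z = \sum_k (- z)^k / (k! (k+1)!)], and [L[H g](w) = w^-2 * L[g](1/w)].  By
   uniqueness of Laplace transforms the eigenvalue equation becomes, almost
   everywhere,
     [(lambda - e^-t) * p = H g]   with [g = e^-t * p].
   Since the kernel [E (s * t)] is symmetric, [lambda] is real or [p = 0], so real
   and imaginary parts separate.  As [H g] is smooth, so is [p]: at a zero of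
   [lambda - e^-t] the numerator [H g] vanishes too, because [p] is locally
   integrable.  Hence [p = (g + H g) / lambda] tends to a limit with an error
   [O(t^(-3/4))], and the improper integral [H p] exists.  From
   [lambda * L[p](w) = L[g](w) + w^-2 * L[g](1/w)] we see that [L[p]] is invariant
   under [F |-> w^-2 * F(1/w)]; so [L[H p] = L[p]], and [psi := H p], which is [p]
   almost everywhere, is self-reciprocal.  The same invariance gives [L[psi] = f] on
   the disk. *)

Require Import Defs.
From mathcomp Require Import all_boot all_order all_algebra.
From mathcomp Require Import complex.
From mathcomp Require Import all_classical all_reals all_analysis.
From mathcomp Require Import measurable_realfun ring lra.

Set Implicit Arguments.
Unset Strict Implicit.
Unset Printing Implicit Defensive.

Import Order.TTheory GRing.Theory Num.Theory.
Import numFieldNormedType.Exports.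

Local Open Scope classical_set_scope.
Local Open Scope complex_scope.
Local Open Scope ring_scope.

(** Membership in [L_2(mhat)] allows growth close to [e^(t/2)], so the space alone gives no hold on
    the Hankel integral of [p]. All control comes from [p = H g / (lambda - e^-t)]: the quotient
    grows at most polynomially, hence [g = e^-t * p] and its first two derivatives are
    [O(e^(-t/2))]. Two derivatives are what is needed, because two integrations by parts against the
    kernel bring [H g] to its limit, the value of [g] at 0, up to [O(t^(-3/4))]. This rate decides
    the end of the proof: for fixed [t] the kernel [E (s * t)] and the remainder are both
    [O(s^(-3/4))]; neither is integrable, but their product is. The constant limit of [p] has only a
    conditionally convergent transform, and is handled through an explicit primitive of the kernel.

    The passage from [f] to [p] stays real: the eigenvalue equation is evaluated only at the points
    [w = 1 / x] with [x >= 1] real, which suffices for the uniqueness of Laplace transforms. If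
    [lambda] is not real, [p] vanishes almost everywhere, and the argument continues with the
    eigenvalue 1 in place of [lambda]. *)

Section DeriveRules.
Context {R : realType}.
Implicit Types (f g : R -> R) (x : R).

Lemma isd_cst (a x : R) : is_derive x (1 : R) (fun _ : R => a) 0.
Proof. exact: is_derive_cst. Qed.

Lemma isd_id x : is_derive x (1 : R) (fun y : R => y) 1.
Proof. exact: is_derive_id. Qed.

Lemma isd_D f g x (df dg : R) : is_derive x (1 : R) f df ->
  is_derive x (1 : R) g dg -> is_derive x (1 : R) (fun y => f y + g y) (df + dg).
Proof. exact: is_deriveD. Qed.

Lemma isd_N f x (df : R) : is_derive x (1 : R) f df ->
  is_derive x (1 : R) (fun y => - f y) (- df).
Proof. exact: is_deriveN. Qed.

Lemma isd_M f g x (df dg : R) : is_derive x (1 : R) f df ->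
  is_derive x (1 : R) g dg ->
  is_derive x (1 : R) (fun y => f y * g y) (f x * dg + g x * df).
Proof. by move=> hf hg; exact: (is_deriveM hf hg). Qed.

Lemma isd_mull (a x : R) : is_derive x (1 : R) ( *%R a) a.
Proof.
have h := isd_M (isd_cst a x) (isd_id x).
by apply: (is_derive_eq h); rewrite mulr0 addr0 mulr1.
Qed.

Lemma isd_X f n x (df : R) : is_derive x (1 : R) f df ->
  is_derive x (1 : R) (fun y => f y ^+ n) (n%:R * f x ^+ n.-1 * df).
Proof.
move=> hf; have := is_deriveX n hf.
rewrite (_ : f ^+ n = (fun y => f y ^+ n)) //.
by apply/funext => y; rewrite exprfctE.
Qed.

Lemma isd_V f x (df : R) : f x != 0 -> is_derive x (1 : R) f df ->
  is_derive x (1 : R) (fun y => (f y)^-1) (- (f x) ^- 2 * df).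
Proof.
move=> fx0 hf; have dV := @derivableV _ _ f x 1 fx0 (@ex_derive _ _ _ _ _ _ _ hf).
by split => //; rewrite deriveV// (@derive_val _ _ _ _ _ _ _ hf).
Qed.

Lemma isd_comp f g x (df dg : R) : is_derive (g x) (1 : R) f df ->
  is_derive x (1 : R) g dg -> is_derive x (1 : R) (fun y => f (g y)) (df * dg).
Proof. by move=> hf hg; exact: is_derive1_comp. Qed.

Lemma isd_continuous f x (df : R) : is_derive x (1 : R) f df -> {for x, continuous f}.
Proof.
move=> hf; apply/differentiable_continuous/derivable1_diffP.
exact: (@ex_derive _ _ _ _ _ _ _ hf).
Qed.

Lemma isd_sqrt x : 0 < x ->
  is_derive x (1 : R) (@Num.sqrt R) (2 * Num.sqrt x)^-1.
Proof.
move=> x0; have s0 : 0 < Num.sqrt x by rewrite sqrtr_gt0.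
pose p := fun y : R => y ^+ 2.
have := @is_derive_inverse R p Num.sqrt (2 * Num.sqrt x) (Num.sqrt x).
rewrite /p sqr_sqrtr ?ltW//; apply.
- by near=> z; rewrite sqrtr_sqr ger0_norm// ltW//; near: z; exact: lt_nbhsr.
- by near=> z; exact: exprn_continuous.
- by have := isd_X 2 (isd_id (Num.sqrt x)); rewrite expr1 mulr1.
- by rewrite mulf_neq0// gt_eqF.
Unshelve. all: by end_near. Qed.

End DeriveRules.

(** Driven by the syntax of the function body; this is why the rules above are stated for pointwise
    lambda terms. The derivative of an unfamiliar head function is taken from the hypotheses, and
    each inverse leaves its nonvanishing condition. [isderive] lets this compute some derivative
    first and then leaves the equation with the announced value. *)
Ltac isd :=
  lazymatch goal with
  | |- is_derive _ _ (fun _ => ?c) _ => exact: isd_cst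
  | |- is_derive _ _ (fun y => y) _ => exact: isd_id
  | |- is_derive _ _ (GRing.mul _) _ => exact: isd_mull
  | |- is_derive _ _ (fun y => @?f y + @?g y) _ => notypeclasses refine (isd_D _ _); isd
  | |- is_derive _ _ (fun y => - @?f y) _ => notypeclasses refine (isd_N _); isd
  | |- is_derive _ _ (fun y => @?f y * @?g y) _ => notypeclasses refine (isd_M _ _); isd
  | |- is_derive _ _ (fun y => (@?f y) ^+ ?n) _ => notypeclasses refine (isd_X n _); isd
  | |- is_derive _ _ (fun y => (@?f y)^-1) _ => notypeclasses refine (isd_V _ _); [|isd]
  | |- is_derive _ _ (fun y => ?f (@?g y)) _ =>
      first [ eassumption
            | notypeclasses refine (@isd_comp _ f g _ _ _ _ _);
              [first [eassumption|typeclasses eauto|idtac]|isd]]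
  | |- _ => first [eassumption | typeclasses eauto | idtac ]
  end.

Ltac isderive := notypeclasses refine (is_derive_eq _ _); [isd|cbv beta].

(** * Bessel-Clifford functions *)

Section BesselClifford.
Context {R : realType}.
Implicit Types (n k : nat) (x z s t : R).

(** Bessel functions are replaced by the entire functions [C_n(z) = \sum_k (- z)^k / (k! (k+n)!)].
    No square root occurs, differentiation only shifts the index, and arguments slightly below 0 are
    allowed, which two-sided derivatives at 0 require. *)
Definition bclif_coef n : R ^nat := fun k => (-1) ^+ k / (k`! * (k + n)`!)%N%:R.

(* [bclif n z] is [z `^ (- n / 2) * J_n (2 * sqrt z)] for [0 < z]. *)
Definition bclif n z : R := limn (pseries (bclif_coef n) z).

Lemma bclif_coef_le n k : `|bclif_coef n k| <= k`!%:R^-1.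
Proof.
rewrite /bclif_coef normrM normrX normrN1 expr1n mul1r ger0_norm ?invr_ge0//.
by rewrite lef_pV2 ?posrE ?ltr0n ?muln_gt0 ?fact_gt0// ler_nat leq_pmulr ?fact_gt0.
Qed.

Lemma bclif_terms_le n z k : `|bclif_coef n k * z ^+ k| <= exp_coeff `|z| k.
Proof.
rewrite normrM normrX /exp_coeff /= mulrC ler_wpM2l ?exprn_ge0//.
exact: bclif_coef_le.
Qed.

Lemma is_cvg_bclif n z : cvgn (pseries (bclif_coef n) z).
Proof.
apply: normed_cvg; apply: (series_le_cvg _ _ (bclif_terms_le n z)) => //.
- by move=> k; rewrite exp_coeff_ge0.
- exact: is_cvg_series_exp_coeff.
Qed.

Lemma norm_bclif_le n z : `|bclif n z| <= expR `|z|.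
Proof.
have cn : cvgn [normed series (fun k => bclif_coef n k * z ^+ k)].
  apply: (series_le_cvg _ _ (bclif_terms_le n z)) => //.
  - by move=> k; rewrite exp_coeff_ge0.
  - exact: is_cvg_series_exp_coeff.
apply: le_trans (lim_series_norm cn) _.
exact: (lim_series_le cn (is_cvg_series_exp_coeff `|z|) (bclif_terms_le n z)).
Qed.

Lemma bclif_diffs n : pseries_diffs (bclif_coef n) = - bclif_coef n.+1.
Proof.
apply/funext => k; rewrite /pseries_diffs /bclif_coef fctE.
rewrite factS addSnnS !natrM exprS -natr1.
by field; rewrite natr1 ?pnatr_eq0 -?lt0n !fact_gt0.
Qed.

Lemma is_cvg_pseriesN (c : R ^nat) z : cvgn (pseries c z) -> cvgn (pseries (- c) z).
Proof.
move=> h; rewrite [X in cvgn X](_ : _ = - pseries c z); last first.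
  by apply/funext => k; rewrite /pseries /series /= !fctE -sumrN; under eq_bigr do rewrite mulNr.
exact: is_cvgN.
Qed.

Lemma lim_pseriesN (c : R ^nat) z : cvgn (pseries c z) ->
  limn (pseries (- c) z) = - limn (pseries c z).
Proof.
move=> h; rewrite [X in limn X = _](_ : _ = - pseries c z); last first.
  by apply/funext => k; rewrite /pseries /series /= !fctE -sumrN; under eq_bigr do rewrite mulNr.
exact: limN.
Qed.

Lemma is_derive_bclif n x : is_derive x (1 : R) (bclif n) (- bclif n.+1 x).
Proof.
have d2 : pseries_diffs (pseries_diffs (bclif_coef n)) = - - bclif_coef n.+2.
  by rewrite bclif_diffs pseries_diffsN bclif_diffs.
have h : limn (pseries (pseries_diffs (bclif_coef n)) x) = - bclif n.+1 x.
  by rewrite bclif_diffs lim_pseriesN//; exact: is_cvg_bclif.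
rewrite -h; apply: (@pseries_snd_diffs _ _ (`|x| + 1)).
- exact: is_cvg_bclif.
- by rewrite bclif_diffs; apply: is_cvg_pseriesN; exact: is_cvg_bclif.
- by rewrite d2 opprK; exact: is_cvg_bclif.
- by rewrite (@ger0_norm _ (`|x| + 1)) ?ltrDl// addr_ge0.
Qed.

Lemma continuous_bclif n : continuous (bclif n).
Proof.
move=> x; apply/differentiable_continuous/derivable1_diffP.
by apply: ex_derive; exact: is_derive_bclif.
Qed.

Lemma bclif0 n : bclif n 0 = n`!%:R^-1.
Proof.
apply: cvg_lim => //; rewrite -(cvg_shiftn 1) /=.
rewrite (_ : (fun k => _) = cst n`!%:R^-1); first exact: cvg_cst.
apply/funext => k; rewrite /pseries /series /= addn1 big_nat_recl//=.
rewrite big1 ?addr0 => [|i _]; last by rewrite exprS mul0r mulr0.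
by rewrite /bclif_coef !expr0 mulr1 div1r add0n fact0 mul1n.
Qed.

(** The three-term recurrence of Bessel functions. The factor [z] raises degrees by one, so [k]
    terms of [bclif n.+2] are compared with [k.+1] terms of the other two series; the constant terms
    cancel because [(n+1) / (n+1)! = 1 / n!], and the remaining terms cancel one by one. *)
Lemma bclif_rec n z : z * bclif n.+2 z = n.+1%:R * bclif n.+1 z - bclif n z.
Proof.
have cA := @is_cvg_bclif n.+1 z; have cB := @is_cvg_bclif n z.
have cC := @is_cvg_bclif n.+2 z.
have h : n.+1%:R * bclif n.+1 z - bclif n z - z * bclif n.+2 z = 0.
  have hA : (fun k => n.+1%:R * pseries (bclif_coef n.+1) z k.+1
    - pseries (bclif_coef n) z k.+1 - z * pseries (bclif_coef n.+2) z k)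
     @ \oo --> n.+1%:R * bclif n.+1 z - bclif n z - z * bclif n.+2 z.
    have shift (u : R ^nat) l : u @ \oo --> l -> (fun k => u k.+1) @ \oo --> l.
      by move=> ul; have := ul; rewrite -(cvg_shiftS u).
    apply: cvgB; last by apply: cvgMr; exact: cC.
    apply: cvgB; last by apply: shift; exact: cB.
    by apply: cvgMr; apply: shift; exact: cA.
  apply: (cvg_unique _ hA) => //.
  rewrite (_ : (fun k => _) = cst 0); first exact: cvg_cst.
  apply/funext => k; rewrite /pseries /series /= !big_nat_recl//=.
  rewrite !mulr_sumr mulrDr mulr_sumr.
  have e0 : n.+1%:R * (bclif_coef n.+1 0 * z ^+ 0) - bclif_coef n 0 * z ^+ 0 = 0.
    rewrite /bclif_coef !expr0 fact0 !add0n !mul1n !mulr1 !div1r factS natrM invfM.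
    by rewrite mulVKf ?subrr.
  rewrite opprD addrACA e0 add0r -!sumrB big1// => i _.
  rewrite /bclif_coef !addSn !addnS !factS.
  move: (fact_gt0 i) (fact_gt0 (i + n)); set a := i`!; set b := (i + n)`! => a0 b0.
  have a0' : a%:R != 0 :> R by rewrite pnatr_eq0 -lt0n.
  have b0' : b%:R != 0 :> R by rewrite pnatr_eq0 -lt0n.
  rewrite !exprS !natrM -!natr1 !natrD.
  have h1 : (i%:R + 1 : R) != 0 by rewrite natr1.
  have h2 : (i%:R + n%:R + 1 : R) != 0 by rewrite -natrD natr1.
  have h3 : (i%:R + n%:R + 1 + 1 : R) != 0 by rewrite -natrD !natr1.
  by field; rewrite ?a0' ?b0' ?h1 ?h2 ?h3.
by apply/esym/eqP; rewrite -subr_eq0 h.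
Qed.

Lemma is_derive_bclifM (n : nat) s x :
  is_derive x (1 : R) (fun y => bclif n (s * y)) (- (s * bclif n.+1 (s * x))).
Proof.
have h := is_derive_bclif n (s * x).
by isderive; ring.
Qed.


Let derive_nonincreasing (f df : R -> R) a b : 0 <= a -> a <= b ->
  (forall x, 0 <= x -> is_derive x (1 : R) f (df x)) ->
  (forall x, a < x -> df x <= 0) -> f b <= f a.
Proof.
move=> a0 ab hf df0.
have dfE x : 0 <= x -> derive1 f x = df x.
  by move=> /hf h; rewrite derive1E (@derive_val _ _ _ _ _ _ _ h).
apply: (@ler0_derive1_le_cc R f a b) => //.
- move=> x /[!in_itv]/= /andP[ax _].
  exact: (@ex_derive _ _ _ _ _ _ _ (hf x (ltW (le_lt_trans a0 ax)))).
- move=> x /[!in_itv]/= /andP[ax _].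
  by rewrite dfE ?df0// ltW// (le_lt_trans a0).
- apply: continuous_in_subspaceT => x /[!inE]/= /[!in_itv]/= /andP[ax _].
  exact: isd_continuous (hf x (le_trans a0 ax)).
- by rewrite in_itv/= ab lexx.
- by rewrite in_itv/= ab lexx.
Qed.

(** By the recurrence, [C = bclif n] solves [z C'' + (n+1) C' + C = 0]. Its energy [C^2 + z C'^2]
    has derivative [- (2n+1) C'^2], and equals [1 / n!^2] at 0. *)
Lemma bclif_energy n x : 0 <= x -> bclif n x ^+ 2 + x * bclif n.+1 x ^+ 2 <= 1.
Proof.
move=> x0.
pose V := fun x : R => bclif n x ^+ 2 + x * bclif n.+1 x ^+ 2.
pose dV := fun x : R => - (2 * n%:R + 1) * bclif n.+1 x ^+ 2.
have : V x <= V 0.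
  apply: (@derive_nonincreasing V dV) => // y y0; last first.
    by rewrite /dV mulNr oppr_le0 mulr_ge0// ?sqr_ge0// addr_ge0// mulr_ge0.
  have h0 := is_derive_bclif n y; have h1 := is_derive_bclif n.+1 y.
  rewrite /V /dV; isderive => /=; rewrite !expr1.
  have -> : y * (2 * bclif n.+1 y * - bclif n.+2 y) =
    - (2 * bclif n.+1 y) * (y * bclif n.+2 y) by ring.
  rewrite bclif_rec -natr1; ring.
move=> /le_trans; apply; rewrite /V bclif0 mul0r addr0 exprVn.
rewrite invf_le1 ?exprn_gt0 ?ltr0n ?fact_gt0// exprn_ege1// ler1n fact_gt0//.
Qed.

Lemma norm_bclif_le1 n x : 0 <= x -> `|bclif n x| <= 1.
Proof.
move=> x0; rewrite -(@ler_pXn2r _ 2)// ?nnegrE// expr1n real_normK ?num_real//.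
apply: le_trans (bclif_energy n x0); by rewrite lerDl mulr_ge0// sqr_ge0.
Qed.

(* The decreasing quantity is the energy of [sqrt x * J_0 x], which solves
   [u'' + (1 + 1 / (4 x^2)) u = 0], in the variable [x = 2 sqrt z]. *)
Lemma bclif01_decay : exists2 C, 0 < C & forall z, 0 < z ->
  bclif 0 z ^+ 2 <= C / Num.sqrt z /\ bclif 1 z ^+ 2 <= C / (z * Num.sqrt z).
Proof.
pose Q := fun y : R => y * bclif 0 (y ^+ 2) ^+ 2 + y ^+ 3 * bclif 1 (y ^+ 2) ^+ 2
  - y * bclif 0 (y ^+ 2) * bclif 1 (y ^+ 2) / 2 + bclif 0 (y ^+ 2) ^+ 2 / (8 * y).
pose dQ := fun y : R => - (bclif 0 (y ^+ 2) ^+ 2 / (8 * y ^+ 2)).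
have hQ y : 1 <= y -> Q y <= Q 1.
  (* [derive_nonincreasing] wants a derivative on all of [[0, +oo)], while [Q] is singular at 0;
     hence the shift by one. *)
  move=> y1; pose Q1 x := Q (x + 1); pose dQ1 x := dQ (x + 1).
  have : Q1 (y - 1) <= Q1 0; last by rewrite /Q1 add0r subrK.
  apply: (@derive_nonincreasing Q1 dQ1) => //; rewrite ?subr_ge0// => x x0; last first.
    by rewrite /dQ1 /dQ oppr_le0 mulr_ge0 ?sqr_ge0// invr_ge0 mulr_ge0// sqr_ge0.
  have x1 : x + 1 != 0 by rewrite gt_eqF// ltr_wpDl.
  have h0 := is_derive_bclif 0 ((x + 1) ^+ 2).
  have h1 := is_derive_bclif 1 ((x + 1) ^+ 2).
  have e2 : bclif 2 ((x + 1) ^+ 2) =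
      (bclif 1 ((x + 1) ^+ 2) - bclif 0 ((x + 1) ^+ 2)) / (x + 1) ^+ 2.
    have := bclif_rec 0 ((x + 1) ^+ 2); rewrite mul1r => <-.
    by rewrite mulrAC divff ?mul1r// expf_neq0.
  rewrite /Q1 /dQ1 /Q /dQ; isderive => /=; first by rewrite mulf_neq0.
  by rewrite e2; field.
have Q_ge y : 1 <= y -> y * bclif 0 (y ^+ 2) ^+ 2 <= Q y /\
    y ^+ 3 * bclif 1 (y ^+ 2) ^+ 2 <= 2 * Q y.
  move=> y1; have y0 : 0 < y by rewrite (lt_le_trans _ y1).
  have yn0 : y != 0 by rewrite gt_eqF.
  set p := bclif 0 (y ^+ 2); set q := bclif 1 (y ^+ 2).
  (* Completing the square absorbs the cross term, so that [Q] controls each of the two squares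
     separately. *)
  have yQ : y * Q y = y ^+ 2 * p ^+ 2 + (y ^+ 2 * q - p / 4) ^+ 2 + p ^+ 2 / 16.
    by rewrite /Q -/p -/q; field.
  split; rewrite -(ler_pM2l y0).
    by rewrite yQ; have := sqr_ge0 (y ^+ 2 * q - p / 4); have := sqr_ge0 p; lra.
  have -> : y * (2 * Q y) = 2 * (y * Q y) by ring.
  rewrite yQ.
  have -> : y * (y ^+ 3 * q ^+ 2) = (y ^+ 2 * q) ^+ 2 by ring.
  have := sqr_ge0 (y ^+ 2 * q - p / 2); have := sqr_ge0 (y * p).
  have := sqr_ge0 p; set r := y ^+ 2 * q; nra.
have Q1_ge0 : 0 <= Q 1.
  by have [h _] := Q_ge 1 (lexx _); apply: le_trans h; rewrite mul1r sqr_ge0.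
exists (1 + 2 * Q 1) => [|z z0]; first by rewrite ltr_wpDr// mulr_ge0.
have s0 : 0 < Num.sqrt z by rewrite sqrtr_gt0.
have zE : z = Num.sqrt z ^+ 2 by rewrite sqr_sqrtr// ltW.
have [z1|z1] := leP 1 (Num.sqrt z).
  have [ha hb] := Q_ge _ z1; rewrite -zE in ha hb; have hc := hQ _ z1.
  split; rewrite ler_pdivlMr ?mulr_gt0//; first by rewrite mulrC; lra.
  by rewrite mulrC {1}zE -exprSr; lra.
have hE n : bclif n z ^+ 2 <= 1.
  by rewrite -real_normK ?num_real// exprn_ile1// norm_bclif_le1// ltW.
have C1 : 1 <= 1 + 2 * Q 1 by rewrite lerDl mulr_ge0.
split; apply: le_trans (hE _) _; rewrite ler_pdivlMr ?mulr_gt0// mul1r.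
  by rewrite (le_trans (ltW z1)).
rewrite {1}zE -exprSr; apply: le_trans C1; rewrite exprn_ile1// ltW//.
Qed.

End BesselClifford.

(** * Integrals over the half-line *)

Section IntegralTools.
Context {R : realType}.
Local Notation mu := (@lebesgue_measure R).
Implicit Types (f g F : R -> R) (t x : R).

Definition intR f := mu.-integrable Rpos (EFin \o f).

Lemma Rpos_gt0 t : Rpos t -> 0 < t.
Proof. by rewrite /Rpos /= in_itv /= andbT. Qed.

Lemma gt0_Rpos t : 0 < t -> Rpos t.
Proof. by rewrite /Rpos /= in_itv /= andbT. Qed.

Lemma mRpos : measurable (Rpos : set (measurableTypeR R)).
Proof. exact: measurable_Rpos. Qed.
Hint Resolve mRpos : core.

Lemma intR_measurable f : intR f -> measurable_fun Rpos f.
Proof. by move=> /measurable_int/measurable_EFinP. Qed.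

Lemma le_intR f g : measurable_fun Rpos f ->
  (forall t, 0 < t -> `|f t| <= g t) -> intR g -> intR f.
Proof.
move=> mf fg; apply: le_integrable => //; first exact/measurable_EFinP.
move=> t /Rpos_gt0 t0 /=; rewrite lee_fin (le_trans (fg _ t0))//.
exact: ler_norm.
Qed.

Lemma eq_intR f g : (forall t, 0 < t -> f t = g t) -> intR f -> intR g.
Proof.
by move=> fg; apply: eq_integrable => // t /set_mem /Rpos_gt0 t0 /=; rewrite fg.
Qed.

Lemma eq_RintR f g : (forall t, 0 < t -> f t = g t) ->
  \int[mu]_(t in Rpos) f t = \int[mu]_(t in Rpos) g t.
Proof.
by move=> fg; apply: eq_Rintegral => t /set_mem /Rpos_gt0 t0; rewrite fg.
Qed.

Lemma intRD f g : intR f -> intR g -> intR (fun t => f t + g t).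
Proof.
move=> hf hg; rewrite /intR (_ : _ \o _ = (EFin \o f) \+ (EFin \o g))%E//.
exact: integrableD.
Qed.

Lemma intRN f : intR f -> intR (fun t => - f t).
Proof. by move=> /integrableN. Qed.

Lemma intRB f g : intR f -> intR g -> intR (fun t => f t - g t).
Proof. by move=> hf hg; exact: intRD hf (intRN hg). Qed.

Lemma intRZ a f : intR f -> intR (fun t => a * f t).
Proof. by move=> /(integrableZl mRpos a). Qed.

Lemma intR_norm f : intR f -> intR (fun t => `|f t|).
Proof. by move=> /integrable_norm. Qed.

Lemma RintN f : intR f ->
  \int[mu]_(t in Rpos) (- f t) = - \int[mu]_(t in Rpos) f t.
Proof.
move=> hf; rewrite -mulN1r -RintegralZl//.
by apply: eq_Rintegral => t _; rewrite mulN1r.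
Qed.

Lemma RintD f g : intR f -> intR g ->
  \int[mu]_(t in Rpos) (f t + g t) =
  \int[mu]_(t in Rpos) f t + \int[mu]_(t in Rpos) g t.
Proof. by move=> hf hg; rewrite RintegralD. Qed.

Lemma RintB f g : intR f -> intR g ->
  \int[mu]_(t in Rpos) (f t - g t) =
  \int[mu]_(t in Rpos) f t - \int[mu]_(t in Rpos) g t.
Proof. by move=> hf hg; rewrite RintegralB. Qed.

Lemma RintZ a f : intR f ->
  \int[mu]_(t in Rpos) (a * f t) = a * \int[mu]_(t in Rpos) f t.
Proof. by move=> hf; rewrite RintegralZl. Qed.

Lemma cont_measurable f : (forall t, 0 < t -> {for t, continuous f}) ->
  measurable_fun Rpos f.
Proof.
move=> cf; apply: open_continuous_measurable_fun; first by rewrite /Rpos.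
by move=> t; rewrite inE => /Rpos_gt0; exact: cf.
Qed.

Lemma isd_measurable f df : (forall t, 0 < t -> is_derive t (1 : R) f (df t)) ->
  measurable_fun Rpos f.
Proof. by move=> hf; apply: cont_measurable => t /hf; exact: isd_continuous. Qed.

Lemma trunc_cvg (A : nat -> set R) f : (forall n, measurable (A n)) ->
  (forall n, A n `<=` Rpos) -> (forall t, 0 < t -> \forall n \near \oo, A n t) ->
  intR f -> \int[mu]_(t in A n) f t @[n --> \oo] --> \int[mu]_(t in Rpos) f t.
Proof.
move=> mA Asub Acvg hf; have mf := intR_measurable hf.
have hn n : (\int[mu]_(t in A n) (f t)%:E = \int[mu]_(t in Rpos) (f \_ (A n) t)%:E)%E.
  rewrite -[in LHS](setIidr (Asub n)) integral_mkcondr.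
  by apply: eq_integral => t _; rewrite !patchE; case: ifP.
apply: fine_cvg; rewrite fineK; last exact: integrable_fin_num.
have [] := @dominated_convergence _ _ _ mu Rpos mRpos
  (fun n t => (f \_ (A n) t)%:E) (EFin \o f) (fun t => `|f t|%:E).
- move=> n; apply/measurable_EFinP; apply/(measurable_restrict _ (mA n) mRpos).
  by apply: measurable_funS mf => // t [].
- exact/measurable_EFinP.
- apply: aeW => t /Rpos_gt0 t0; apply: cvg_near_cst.
  by near=> n; rewrite patchE mem_set//; near: n; exact: Acvg.
- exact: intR_norm.
- apply: aeW => t n _ /=; rewrite lee_fin patchE; case: ifPn => // _.
  by rewrite normr0.
by move=> _ _; under eq_fun do rewrite -hn.
Unshelve. all: by end_near. Qed.

Lemma int_trunc_cvg f : intR f ->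
  (\int[mu]_(t in `]0%R, A]) f t) @[A --> +oo] --> \int[mu]_(t in Rpos) f t.
Proof.
move=> hf; apply/cvg_pinftyP => u uy.
apply: trunc_cvg => // [n t|t t0].
  by rewrite /= in_itv/= => /andP[t0 _]; exact: gt0_Rpos.
near=> n; rewrite /= in_itv/= t0 /=; near: n; exact: cvgry_ge.
Unshelve. all: by end_near. Qed.

Lemma FTC_cc F f a b : a < b ->
  (forall t, a <= t -> is_derive t (1 : R) F (f t)) ->
  (forall t, a <= t -> {for t, continuous f}) ->
  \int[mu]_(t in `[a, b]) f t = F b - F a.
Proof.
move=> ab dF cf; rewrite /Rintegral (@continuous_FTC2 _ f F a b ab)//.
- apply: continuous_in_subspaceT => x /[!inE]/= /[!in_itv]/= /andP[ax _].
  exact: cf.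
- split.
  + by move=> x /[!in_itv]/= /andP[/ltW/dF h _]; exact: (@ex_derive _ _ _ _ _ _ _ h).
  + by apply: cvg_at_right_filter; exact: isd_continuous (dF _ (lexx _)).
  + by apply: cvg_at_left_filter; exact: isd_continuous (dF _ (ltW ab)).
- move=> x /[!in_itv]/= /andP[/ltW/dF h _].
  by rewrite derive1E (@derive_val _ _ _ _ _ _ _ h).
Qed.

Lemma FTC_0y F f l0 l : (forall t, 0 < t -> is_derive t (1 : R) F (f t)) ->
  (forall t, 0 < t -> {for t, continuous f}) ->
  F t @[t --> 0^'+] --> l0 -> F t @[t --> +oo] --> l -> intR f ->
  \int[mu]_(t in Rpos) f t = l - l0.
Proof.
move=> dF cf F0 Fy hf.
(* With [n.+2] one has [e n < 1 < a n] from the start, so no interval degenerates. *)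
pose e n : R := n.+2%:R^-1; pose a n : R := n.+2%:R.
have e0 n : 0 < e n by rewrite invr_gt0 ltr0n.
have ea n : e n < a n.
  by rewrite (@lt_trans _ _ 1)// ?ltr1n// invf_lt1// ltr1n.
have ay : a n @[n --> \oo] --> +oo.
  have := @cvgr_idn R; rewrite -(cvg_shiftn 2).
  by under eq_fun do rewrite addn2.
have ec : e n @[n --> \oo] --> (0 : R).
  by apply/(@gtr0_cvgV0 _ _ _ _ a) => //; apply: nearW => n; rewrite ltr0n.
have h1 : F (a n) - F (e n) @[n --> \oo] --> l - l0.
  apply: cvgB; first by move/cvg_pinftyP : Fy; apply.
  by move/cvg_at_rightP : F0; apply; split.
have h2 : \int[mu]_(t in `[e n, a n]) f t @[n --> \oo] -->
    \int[mu]_(t in Rpos) f t.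
  apply: trunc_cvg => // [n t|t t0].
    by rewrite /= in_itv/= => /andP[et _]; apply: gt0_Rpos; exact: lt_le_trans et.
  near=> n; rewrite /= in_itv/=; apply/andP; split; near: n.
    exact: (cvgr_le _ ec).
  exact: cvgry_ge.
apply: cvg_unique h2 _ => //.
apply: cvg_trans h1; apply: near_eq_cvg; apply: nearW => n.
have et t : e n <= t -> 0 < t by exact: lt_le_trans.
have -> // : \int[mu]_(t in `[e n, a n]) f t = F (a n) - F (e n).
by apply: FTC_cc => // t /et; [exact: dF|exact: cf].
Unshelve. all: by end_near. Qed.

Lemma intR_expN p : 0 < p -> intR (fun t => expR (- (p * t))).
Proof.
move=> p0.
have dE x : is_derive x (1 : R) (fun t => - (expR (- (p * t)) / p)) (expR (- (p * x))).
  by isderive; field; rewrite gt_eqF.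
have cE : continuous (fun t => expR (- (p * t))).
  move=> x; have : is_derive x (1 : R) (fun t => expR (- (p * t))) (expR (- (p * x)) * - p).
    by isderive.
  exact: isd_continuous.
apply/integrableP; split; first by apply/measurable_EFinP; apply: cont_measurable => ? _; exact: cE.
under eq_integral => t _ do rewrite /= ger0_norm ?expR_ge0//.
rewrite /Rpos integral_itv_obnd_cbnd//; last first.
  by apply/measurable_EFinP; apply: cont_measurable => ? _; exact: cE.
rewrite (@ge0_continuous_FTC2y _ _ (fun t => - (expR (- (p * t)) / p)) 0 0).
- by rewrite -EFinB ltey.
- by move=> x _; exact: expR_ge0.
- exact: continuous_subspaceT.
- rewrite -oppr0; apply: cvgN; rewrite -(mul0r p^-1); apply: cvgMl.
  have h : (fun t : R => p * t) @ +oo%R --> +oo%R.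
    by apply: gt0_cvgMry => //; exact: cvg_id.
  exact: (cvg_comp _ (fun x : R => expR (- x)) h (@cvgr_expR R)).
- by move=> x _; exact: (@ex_derive _ _ _ _ _ _ _ (dE x)).
- by apply: cvg_at_right_filter; exact: isd_continuous (dE 0).
- by move=> x _; rewrite derive1E (@derive_val _ _ _ _ _ _ _ (dE x)).
Qed.

End IntegralTools.
#[global] Hint Resolve mRpos : core.

(** * Exponential estimates, differentiation under the integral sign, Fubini *)

Section IntegralTheorems.
Context {R : realType}.
Local Notation mu := (@lebesgue_measure R).

(** A single term of the exponential series: [(p t)^k / k! <= e^(p t)]. Powers of [t] are paid for
    in this way by any positive share of the exponential decay. *)
Lemma polyexpN_le (k : nat) (p t : R) : 0 < p -> 0 <= t ->
  t ^+ k * expR (- (p * t)) <= k`!%:R * p ^- k.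
Proof.
move=> p0 t0; rewrite expRN ler_pdivrMr ?expR_gt0//.
have h : (p * t) ^+ k / k`!%:R <= expR (p * t).
  have x0 : 0 <= p * t by rewrite mulr_ge0 ?(ltW p0).
  case: k => [|k]; first by rewrite expr0 fact0 divr1 (le_trans _ (expR_ge1Dx _))// lerDl.
  by apply: le_trans (expR_ge1Dxn k x0); rewrite lerDr.
apply: le_trans (ler_wpM2l _ h); last by rewrite divr_ge0 ?exprn_ge0 ?(ltW p0).
rewrite exprMn le_eqVlt; apply/orP; left; apply/eqP.
have : p ^+ k != 0 by rewrite expf_neq0// gt_eqF.
have : k`!%:R != 0 :> R by rewrite pnatr_eq0 -lt0n fact_gt0.
by move: (k`!%:R) (p ^+ k) => a c a0 c0; field; rewrite c0 a0.
Qed.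

Lemma intR_polyexpN (k : nat) (p : R) : 0 < p ->
  intR (fun t => t ^+ k * expR (- (p * t))).
Proof.
move=> p0; have p2 : 0 < p / 2 by rewrite divr_gt0.
apply: (le_intR _ _ (intRZ (k`!%:R * (p / 2) ^- k) (intR_expN p2))).
  apply: (@isd_measurable _ _ (fun t => t ^+ k * (expR (- (p * t)) * - p) +
    expR (- (p * t)) * (k%:R * t ^+ k.-1 * 1))) => t _.
  by isderive.
move=> t t0; rewrite ger0_norm ?mulr_ge0 ?exprn_ge0 ?expR_ge0 ?(ltW t0)//.
have -> : expR (- (p * t)) = expR (- (p / 2 * t)) * expR (- (p / 2 * t)).
  by rewrite -expRD; congr expR; field.
by rewrite /= mulrA ler_wpM2r ?expR_ge0// polyexpN_le// ltW.
Qed.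

Lemma cvg0_polyexpN (f : R -> R) (C : R) (k : nat) (p : R) : 0 < p ->
  (forall t, 0 < t -> `|f t| <= C * (t ^+ k * expR (- (p * t)))) ->
  f t @[t --> +oo] --> 0.
Proof.
move=> p0 fC; apply/norm_cvg0P.
pose D := `|C| * (k.+1`!%:R * p ^- k.+1).
have h : D * t^-1 @[t --> +oo] --> (0 : R).
  rewrite -(mulr0 D); apply: cvgMr.
  by apply/gtr0_cvgV0; [near=> t; near: t; exact: nbhs_pinfty_gt|exact: cvg_id].
apply: squeeze_cvgr (cvg_cst 0) h; near=> t.
have t0 : 0 < t by near: t; exact: nbhs_pinfty_gt.
rewrite normr_ge0 /= ler_pdivlMr// (le_trans (ler_wpM2r (ltW t0) (fC _ t0)))//.
rewrite -mulrA [_ * t]mulrAC -exprSr.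
apply: le_trans (ler_wpM2l (normr_ge0 C) (polyexpN_le k.+1 p0 (ltW t0))).
by rewrite ler_wpM2r ?ler_norm// mulr_ge0 ?expR_ge0// exprn_ge0// ltW.
Unshelve. all: by end_near. Qed.

Lemma FTC_decay (F f : R -> R) : (forall t : R, 0 <= t -> is_derive t (1 : R) F (f t)) ->
  (forall t : R, 0 < t -> {for t, continuous f}) -> intR f ->
  F t @[t --> +oo] --> 0 -> \int[mu]_(t in Rpos) f t = - F 0.
Proof.
move=> dF cf hf Fy; rewrite (FTC_0y (l0 := F 0) _ cf _ Fy hf) ?sub0r//.
  by move=> t /ltW/dF.
by apply: cvg_at_right_filter; exact: isd_continuous (dF _ (lexx _)).
Qed.

Lemma isd0_eq (f : R -> R) (a b : R) : a <= b ->
  (forall t : R, a <= t -> is_derive t (1 : R) f 0) -> f b = f a.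
Proof.
move=> ab df; apply/eqP; rewrite -subr_eq0; apply/eqP.
have [||c _ ->] := @MVT_segment R f (fun=> 0) a b ab; last by rewrite mul0r.
  by move=> x /[!in_itv]/= /andP[/ltW/df].
apply: continuous_in_subspaceT => x /[!inE]/= /[!in_itv]/= /andP[/df h _].
exact: isd_continuous h.
Qed.

Lemma isd_integral d (Y : measurableType d) (nu : {measure set Y -> \bar R})
    (B : set Y) (f df : R -> Y -> R) (G : Y -> R) (a u v : R) :
  measurable B -> u < a < v ->
  (forall x, u < x < v -> nu.-integrable B (EFin \o f x)) ->
  (forall x y, u < x < v -> B y -> is_derive x (1 : R) (f ^~ y) (df x y)) ->
  nu.-integrable B (EFin \o G) ->
  (forall x y, u < x < v -> B y -> `|df x y| <= G y) ->
  is_derive a (1 : R) (fun x => \int[nu]_(y in B) f x y) (\int[nu]_(y in B) df a y).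
Proof.
move=> mB auv intf hdf intG dG.
have auv' : `]u, v[%classic a by rewrite /= in_itv.
have dE x y : u < x < v -> B y -> partial1of2 f x y = df x y.
  by move=> xuv By; rewrite partial1of2E (@derive_val _ _ _ _ _ _ _ (hdf x y xuv By)).
have intf' x : `]u, v[%classic x -> nu.-integrable B (EFin \o f x).
  by rewrite /= in_itv/= => /intf.
have derf x y : `]u, v[%classic x -> B y -> derivable (f ^~ y) x 1.
  by rewrite /= in_itv/= => xuv By; exact: (@ex_derive _ _ _ _ _ _ _ (hdf x y xuv By)).
have G0 y : 0 <= `|G y| by [].
have intG' : nu.-integrable B (EFin \o (fun y => `|G y|)) by exact: integrable_norm.
have dG' x y : `]u, v[%classic x -> B y -> `|partial1of2 f x y| <= `|G y|.
  rewrite /= in_itv/= => xuv By; rewrite dE// (le_trans (dG _ _ xuv By))//.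
  exact: ler_norm.
have := @derivable_under_integral R _ Y nu f B mB a u v auv' intf' derf _ G0 intG' dG'.
have := @differentiation_under_integral R _ Y nu f B mB a u v auv' intf' derf _ G0 intG' dG'.
move=> h1 h2; split => //; rewrite -derive1E h1.
by apply: eq_Rintegral => y /set_mem By; rewrite dE.
Qed.

(** The product bound makes [K], multiplied by the indicators of both half-lines, integrable over
    the plane. The theorem of Fubini is applied to that product on the whole plane, so [K] has to be
    measurable there; for this reason functions on the half-line are later extended by zero. *)
Lemma fubini_Rpos (K : R -> R -> R) (a b : R -> R) :
  measurable_fun [set: measurableTypeR R * measurableTypeR R] (fun z => K z.1 z.2) ->
  intR a -> intR b ->
  (forall s t, 0 < s -> 0 < t -> `|K s t| <= a s * b t) ->
  \int[mu]_(s in Rpos) (\int[mu]_(t in Rpos) K s t) =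
  \int[mu]_(t in Rpos) (\int[mu]_(s in Rpos) K s t) /\
  intR (fun s => \int[mu]_(t in Rpos) K s t).
Proof.
move=> mK ia ib Kab.
pose k (z : measurableTypeR R * measurableTypeR R) : R :=
  \1_(@Rpos R) z.1 * \1_(@Rpos R) z.2 * K z.1 z.2.
have mind : measurable_fun [set: measurableTypeR R] (\1_(@Rpos R) : R -> R).
  exact: measurable_indic mRpos.
have mk : measurable_fun [set: measurableTypeR R * measurableTypeR R] k.
  apply: measurable_funM => //; apply: measurable_funM.
    by apply: measurableT_comp mind _; exact: measurable_fst.
  by apply: measurableT_comp mind _; exact: measurable_snd.
have mKs s : measurable_fun Rpos (K s).
  have /(_ s) h := measurableT_comp mK (pair1_measurable _).
  by apply: measurable_funTS; exact: h.
have mKt t : measurable_fun Rpos (K ^~ t).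
  have /(_ t) h := measurableT_comp mK (pair2_measurable _).
  by apply: measurable_funTS; exact: h.
have iKs s : 0 < s -> intR (K s).
  by move=> s0; apply: (le_intR (mKs s) _ (intRZ (a s) ib)) => t t0; exact: Kab.
have iKt t : 0 < t -> intR (K ^~ t).
  move=> t0; apply: (le_intR (mKt t) _ (intRZ (b t) ia)) => s s0.
  by rewrite mulrC; exact: Kab.
pose F1 (s : R) := \int[mu]_(t in Rpos) K s t.
pose F2 (t : R) := \int[mu]_(s in Rpos) K s t.
have kE1 s : (\int[mu]_t (k (s, t))%:E = (EFin \o F1) \_ Rpos s)%E.
  rewrite patchE; case: ifPn => [/set_mem sR|sR].
    rewrite /= /F1 /F2 /Rintegral fineK; last by exact: (integrable_fin_num mRpos (iKs s (Rpos_gt0 sR))).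
    rewrite [RHS]integral_mkcond; apply: eq_integral => t _.
    rewrite patchE /k /= !indicE (mem_set sR) mul1r; case: ifPn => _; first by rewrite mul1r.
    by rewrite mul0r.
  rewrite integral0_eq// => t _; rewrite /k /= indicE (negbTE sR) !mul0r//.
have kE2 t : (\int[mu]_s (k (s, t))%:E = (EFin \o F2) \_ Rpos t)%E.
  rewrite patchE; case: ifPn => [/set_mem tR|tR].
    rewrite /= /F1 /F2 /Rintegral fineK; last by exact: (integrable_fin_num mRpos (iKt t (Rpos_gt0 tR))).
    rewrite [RHS]integral_mkcond; apply: eq_integral => s _.
    rewrite patchE /k /= !indicE (mem_set tR) mulr1; case: ifPn => _; first by rewrite mul1r.
    by rewrite mul0r.
  rewrite integral0_eq// => s _; rewrite /k /= !indicE (negbTE tR) mulr0 !mul0r//.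
have ik : (mu \x mu)%E.-integrable setT (EFin \o k).
  apply/integrable12ltyP; first exact/measurable_EFinP.
  have ia' := intR_norm ia; have ib' := intR_norm ib.
  apply: (@le_lt_trans _ _ (\int[mu]_s (((fun s => `|a s|%:E * \int[mu]_(t in Rpos) `|b t|%:E) \_ Rpos) s))%E).
    apply: ge0_le_integral => //.
    - by move=> s _; exact: integral_ge0.
    - apply: (measurable_fun_fubini_tonelli_F (m2 := mu) (abse \o (EFin \o k))) => //.
        by apply: measurableT_comp => //; exact/measurable_EFinP.
      by move=> z; exact: abse_ge0.
    - apply: (measurable_restrictT _ mRpos).1.
      apply: emeasurable_funM => //; apply/measurable_EFinP.
      exact: intR_measurable ia'.
    - move=> s _; rewrite patchE; case: ifPn => [/set_mem sR|sR]; last first.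
        rewrite integral0_eq// => t _; rewrite /k /= indicE (negbTE sR) !mul0r normr0//.
      rewrite -ge0_integralZl//; last first.
        by apply/measurable_EFinP; exact: intR_measurable ib'.
      rewrite [X in (_ <= X)%E]integral_mkcond; apply: ge0_le_integral => //.
      + apply: measurableT_comp => //; apply/measurable_EFinP.
        exact: (measurableT_comp mk (pair1_measurable s)).
      + apply: (measurable_restrictT _ mRpos).1; apply: emeasurable_funM => //.
        by apply/measurable_EFinP; exact: intR_measurable ib'.
      + move=> t _; rewrite patchE /k /= !indicE (mem_set sR) mul1r.
        case: ifPn => [/set_mem tR|tR]; last by rewrite mul0r normr0.
        rewrite mul1r lee_fin (le_trans (Kab _ _ (Rpos_gt0 sR) (Rpos_gt0 tR)))//.
        by rewrite -normrM ler_norm.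
  rewrite -integral_mkcond.
  have : (\int[mu]_(t in Rpos) `|b t|%:E)%E \is a fin_num.
    exact: (integrable_fin_num mRpos ib').
  move=> /fineK <-; rewrite ge0_integralZr//.
  - by apply: lte_mul_pinfty => //; [exact: integral_ge0|exact: (integrable_fin_num mRpos ia')
      |exact: ltey].
  - by apply/measurable_EFinP; exact: intR_measurable ia'.
  - by rewrite lee_fin fine_ge0// integral_ge0.
have i1 : intR (fun s => \int[mu]_(t in Rpos) K s t).
  apply/(integrable_mkcond _ mRpos).
  by apply: eq_integrable (integrable_fubini_F ik) => // s _; exact: kE1.
split => //.
have e1 : (\int[mu]_s \int[mu]_t (k (s, t))%:E = \int[mu]_(s in Rpos) (F1 s)%:E)%E.
  by rewrite [RHS]integral_mkcond; apply: eq_integral => s _; exact: kE1.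
have e2 : (\int[mu]_t \int[mu]_s (k (s, t))%:E = \int[mu]_(t in Rpos) (F2 t)%:E)%E.
  by rewrite [RHS]integral_mkcond; apply: eq_integral => s _; exact: kE2.
have h := congr1 fine (etrans (esym e1) (etrans (Fubini ik) e2)).
by rewrite {1}/Rintegral [in RHS]/Rintegral; exact h.
Qed.

End IntegralTheorems.

(** * Uniqueness of Laplace transforms *)

Section LaplaceUniqueness.
Context {R : realType}.
Local Notation mu := (@lebesgue_measure R).

Lemma ae_imp (P Q : R -> Prop) : (forall t, P t -> Q t) ->
  {ae mu, forall t, P t} -> {ae mu, forall t, Q t}.
Proof. by move=> PQ; apply: (@filterS _ _ (ae_filter_ringOfSetsType mu)). Qed.

Lemma ae_imp2 (P Q S : R -> Prop) : (forall t, P t -> Q t -> S t) ->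
  {ae mu, forall t, P t} -> {ae mu, forall t, Q t} -> {ae mu, forall t, S t}.
Proof. by move=> PQ; apply: (@filterS2 _ _ (ae_filter_ringOfSetsType mu)). Qed.

Lemma dominated_Rint (f_ : nat -> R -> R) (f g : R -> R) :
  (forall n, measurable_fun Rpos (f_ n)) -> measurable_fun Rpos f ->
  {ae mu, forall t, Rpos t -> f_ ^~ t @ \oo --> f t} -> intR g ->
  (forall n t, 0 < t -> `|f_ n t| <= g t) ->
  \int[mu]_(t in Rpos) f_ n t @[n --> \oo] --> \int[mu]_(t in Rpos) f t.
Proof.
move=> mf_ mf ff ig fg.
have [] := @dominated_convergence _ _ _ mu Rpos mRpos (fun n t => (f_ n t)%:E)
  (EFin \o f) (EFin \o g).
- by move=> n; apply/measurable_EFinP; exact: mf_.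
- exact/measurable_EFinP.
- apply: ae_imp ff => t h Rt; apply: cvg_EFin; [exact: nearW|exact: h].
- by [].
- by apply: aeW => t n Rt /=; rewrite lee_fin fg//; exact: Rpos_gt0.
move=> ifl _ h.
by apply: fine_cvg; rewrite fineK//; exact: integrable_fin_num.
Qed.

(* Integrating against exponential polynomials approximates integration
   against [exp (- exp (N (a - t)))], which tends to the indicator of (a, +oo). *)
Let gumbel (N a t : R) := expR (- expR (N * (a - t))).

Let gumbel_partial (N : nat) (a : R) (M : nat) (t : R) : R :=
  \sum_(0 <= k < M) (- expR (N%:R * (a - t))) ^+ k / k`!%:R.

(** With [w = e^(- p0 t) h], the hypothesis at the points [p0 + N M] kills every term of the
    exponential series of [exp (- exp (N (a - t)))] integrated against [w]. Letting [M] and then [N]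
    tend to infinity, [w] has integral 0 over each [(a, +oo)]; Lebesgue differentiation of its
    primitive gives [w = 0] almost everywhere. *)
Lemma laplace_unique (h : R -> R) (p0 : R) :
  intR (fun t => expR (- (p0 * t)) * h t) ->
  (forall p, p0 <= p -> \int[mu]_(t in Rpos) (expR (- (p * t)) * h t) = 0) ->
  {ae mu, forall t, Rpos t -> h t = 0}.
Proof.
move=> ih h0; pose w t := expR (- (p0 * t)) * h t.
have iw : intR w by []; have mw := intR_measurable iw.
have mexp (c d : R) : measurable_fun Rpos (fun t => expR (c * (d - t))).
  apply: (@isd_measurable _ _ (fun t => expR (c * (d - t)) * (c * - 1))) => t _.
  by isderive; ring.
(* Uniform in the number [M] of terms: in absolute value the partial sums of [exp (- y)] stay below
   [exp y], and [y = e^(N (a - t)) <= e^(N a)]. *)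
have gb M N a t : 0 < t -> `|gumbel_partial N a M t| <= expR (expR (N%:R * a)).
  move=> t0; apply: (@le_trans _ _ (expR (expR (N%:R * (a - t))))); last first.
    by rewrite !ler_expR ler_wpM2l// gerBl ltW.
  rewrite /gumbel_partial (le_trans (ler_norm_sum _ _ _))//.
  apply: (@le_trans _ _ (series (exp_coeff (expR (N%:R * (a - t)))) M)).
    rewrite /series /= ler_sum// => k _.
    rewrite normrM normfV normrX normrN (ger0_norm (expR_ge0 _)).
    by rewrite ger0_norm.
  rewrite /expR -/(expR _); apply: nondecreasing_cvgn_le.
    apply: nondecreasing_series => k _ _; apply: exp_coeff_ge0; exact: expR_ge0.
  exact: is_cvg_series_exp_coeff.
have wexp (p : R) : 0 <= p -> intR (fun t => w t * expR (- (p * t))).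
  move=> p0'; apply: le_intR (intR_norm iw).
    apply: measurable_funM => //.
    rewrite (_ : (fun t => _) = (fun t => expR (p * (0 - t)))) //.
    by apply/funext => t; rewrite sub0r mulrN.
  move=> t t0; rewrite normrM ler_piMr// ger0_norm ?expR_ge0// expR_le1 oppr_le0.
  by rewrite mulr_ge0// ltW.
have wexp0 (p : R) : 0 <= p -> \int[mu]_(t in Rpos) (w t * expR (- (p * t))) = 0.
  move=> p0'; rewrite -[RHS](h0 (p0 + p)) ?lerDl//; apply: eq_Rintegral => t _.
  by rewrite /w mulrAC -expRD mulrDl opprD.
have step1 N a : \int[mu]_(t in Rpos) (w t * gumbel N%:R a t) = 0.
  have c0 (M : nat) : \int[mu]_(t in Rpos) (w t * gumbel_partial N a M t) = 0
      /\ measurable_fun Rpos (gumbel_partial N a M).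
    elim: M => [|M [IH1 IH2]].
      rewrite /gumbel_partial; under eq_Rintegral do rewrite big_nil mulr0.
      split; first by rewrite /Rintegral integral0.
      by under eq_fun do rewrite big_nil; exact: measurable_cst.
    have mS : measurable_fun Rpos (gumbel_partial N a M.+1).
      rewrite /gumbel_partial; under eq_fun do rewrite big_nat_recr//=.
      apply: measurable_funD => //; apply: measurable_funM => //.
      by apply: measurable_funX; apply: measurableT_comp => //; exact: mexp.
    split => //.
    (* The new term is a multiple of [e^(- N M t)], so its integral against [w] is the Laplace
       transform of [h] at [p0 + N M]. *)
    have eM t : w t * gumbel_partial N a M.+1 t = w t * gumbel_partial N a M t +
        ((-1) ^+ M * expR (N%:R * a) ^+ M / M`!%:R) *
        (w t * expR (- ((N * M)%:R * t))).
      rewrite /gumbel_partial big_nat_recr//= mulrDr; congr (_ + _).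
      have -> : (- expR (N%:R * (a - t))) ^+ M =
          (-1) ^+ M * expR (N%:R * a) ^+ M * expR (- ((N * M)%:R * t)).
        rewrite [LHS]exprNn -mulrA; congr (_ * _).
        by rewrite -!expRM_natl -expRD; congr expR; rewrite natrM; ring.
      ring.
    have i1 : intR (fun t => w t * gumbel_partial N a M t).
      apply: le_intR (intRZ (expR (expR (N%:R * a))) (intR_norm iw)).
        exact: measurable_funM.
      by move=> t t0; rewrite normrM mulrC ler_wpM2r// gb.
    have i2 := wexp _ (ler0n R (N * M)).
    under eq_Rintegral do rewrite eM.
    by rewrite RintD ?RintZ ?IH1 ?wexp0 ?mulr0 ?addr0//; exact: intRZ.
  have cv : \int[mu]_(t in Rpos) (w t * gumbel_partial N a M t) @[M --> \oo] -->
      \int[mu]_(t in Rpos) (w t * gumbel N%:R a t).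
    apply: (@dominated_Rint _ _ (fun t => expR (expR (N%:R * a)) * `|w t|)).
    - by move=> M; apply: measurable_funM => //; exact: (c0 M).2.
    - apply: measurable_funM => //; rewrite /gumbel.
      by do 2 apply: measurableT_comp => //; exact: mexp.
    - apply: aeW => t _; apply: cvgMr; rewrite /gumbel /gumbel_partial.
      exact: (@is_cvg_series_exp_coeff _ (- expR (N%:R * (a - t)))).
    - exact: intRZ (intR_norm iw).
    - by move=> M t t0; rewrite normrM mulrC ler_wpM2r// gb.
  have cv0 : \int[mu]_(t in Rpos) (w t * gumbel_partial N a M t) @[M --> \oo] --> (0 : R).
    rewrite (_ : (fun M => _) = cst 0); first exact: cvg_cst.
    by apply/funext => M; exact: (c0 M).1.
  exact: (cvg_unique _ cv cv0).
pose ind (a t : R) : R := (a < t)%R%:R.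
have mind a : measurable_fun Rpos (ind a).
  by apply: measurableT_comp => //; exact: measurable_fun_ltr.
have step2 a : \int[mu]_(t in Rpos) (w t * ind a t) = 0.
  have cv : \int[mu]_(t in Rpos) (w t * gumbel N%:R a t) @[N --> \oo] -->
      \int[mu]_(t in Rpos) (w t * ind a t).
    apply: (@dominated_Rint _ _ (fun t => `|w t|)).
    - move=> N; apply: measurable_funM => //; rewrite /gumbel.
      by do 2 apply: measurableT_comp => //; exact: mexp.
    - exact: measurable_funM.
    (* At [t = a] the approximants are constantly [1 / e]; this one point is discarded. *)
    - have : {ae mu, forall t, t != a}.
        exists [set a]; split => //; first exact: lebesgue_measure_set1.
        by move=> t /= /negP; rewrite negbK => /eqP.
      apply: ae_imp => t ta _; apply: cvgMr; rewrite /ind /gumbel.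
      have Ny (c : R) : 0 < c -> (fun N : nat => N%:R * c) @ \oo --> +oo%R.
        move=> c0; have hy : (fun x : R => x * c) @ +oo%R --> +oo%R.
          by apply: gt0_cvgMly => //; exact: cvg_id.
        exact: (cvg_comp _ _ (@cvgr_idn R) hy).
      have [at_|at_|/eqP] := ltgtP a t; last by rewrite eq_sym (negbTE ta).
        have hN := Ny (t - a); rewrite subr_gt0 in hN.
        have h1 := cvg_comp _ (fun x : R => expR (- x)) (hN at_) (@cvgr_expR R).
        have h2 : expR (- expR (- (N%:R * (t - a)))) @[N --> \oo] --> expR (- (0 : R)).
          apply: (cvg_comp _ (fun x : R => expR (- x)) h1).
          have d0 : is_derive (0 : R) (1 : R) (fun x : R => expR (- x)) (expR (- 0) * - 1).
            by isderive.
          exact: isd_continuous d0.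
        rewrite oppr0 expR0 in h2; apply: cvg_trans h2; apply: near_eq_cvg.
        by apply: nearW => N /=; rewrite -mulrN opprB.
      have hN := Ny (a - t); rewrite subr_gt0 in hN.
      have h1 := cvg_comp _ (fun x : R => expR (- x)) (hN at_) (@cvgr_expR R).
      have h2 : expR (- expR (N%:R * (a - t))) @[N --> \oo] --> (0 : R).
        apply: squeeze_cvgr (cvg_cst 0) h1; apply: nearW => N /=.
        by rewrite expR_ge0 /= ler_expR lerN2 (le_trans _ (expR_ge1Dx _))// lerDr.
      exact: h2.
    - exact: intR_norm.
    - by move=> N t t0; rewrite normrM ler_piMr// /gumbel ger0_norm ?expR_ge0.
  have cv0 : \int[mu]_(t in Rpos) (w t * gumbel N%:R a t) @[N --> \oo] --> (0 : R).
    rewrite (_ : (fun M => _) = cst 0); first exact: cvg_cst.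
    by apply/funext => N; exact: step1.
  exact: (cvg_unique _ cv cv0).
(* [FTC1Ny] integrates from minus infinity, hence the extension by zero. The primitive is the full
   integral minus the integral over [(x, +oo)], and both are 0. *)
pose wr := w \_ Rpos.
have iwr : mu.-integrable setT (EFin \o wr).
  rewrite (_ : _ \o _ = (EFin \o w) \_ Rpos); first by apply/(integrable_mkcond _ mRpos).
  by apply/funext => t; rewrite /wr /= !patchE; case: ifP.
have W0 (x : R) : \int[mu]_(t in `]-oo, x]) wr t = 0.
  have iR : intR wr by apply: integrableS iwr.
  have e1 : \int[mu]_(t in Rpos) w t = 0.
    by rewrite -[RHS](wexp0 0)//; apply: eq_Rintegral => t _; rewrite mul0r oppr0 expR0 mulr1.
  have iwi : intR (fun t => w t * ind x t).
    apply: le_intR (intR_norm iw); first exact: measurable_funM.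
    by move=> t _; rewrite normrM ler_piMr// /ind; case: ltP; rewrite ?normr1 ?normr0.
  have e2 : \int[mu]_(t in Rpos) (w t - w t * ind x t) = 0.
    by rewrite RintB// e1 step2 subr0.
  rewrite Rintegral_mkcond -[RHS]e2 [RHS]Rintegral_mkcond; apply: eq_Rintegral => t _.
  rewrite /wr !patchE; case: (boolP (t \in Rpos)) => tR; last by case: ifP.
  rewrite /ind; case: ltP => tx; case: ifPn => [/set_mem|]; rewrite /= ?in_itv/=.
  - by rewrite leNgt tx.
  - by rewrite mulr1 subrr.
  - by rewrite mulr0 subr0.
  - by move=> /negP; rewrite inE /= in_itv/= tx.
have := @FTC1Ny R wr.
have -> : (fun x : R => \int[mu]_(t in [set` `]-oo, x]]) wr t) = cst 0.
  by apply/funext => x; rewrite W0.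
have i1 y : mu.-integrable `]-oo, y] (EFin \o wr) by apply: integrableS iwr.
have i2 : locally_integrable setT wr by apply: open_integrable_locally => //; exact: openT.
move=> /(_ i1 i2); apply: ae_imp => t [_]; rewrite derive1E derive_val => e tR.
move: e; rewrite /wr patchE mem_set// /w => /esym/eqP.
by rewrite mulf_eq0 expR_eq0 /= => /eqP.
Qed.

End LaplaceUniqueness.

(** * The Laplace transform of the Hankel kernel *)

Section LaplaceKernel.
Context {R : realType}.
Local Notation mu := (@lebesgue_measure R).

(** The admission of slightly negative [s], at an exponential price, is what makes derivatives in
    [s] available at the endpoint [s = 0]. *)
Lemma norm_bclif_le_exp n (c s t : R) : 0 <= c -> - c < s -> 0 <= t ->
  `|bclif n (s * t)| <= expR (c * t).
Proof.
move=> c0 cs t0; have [s0|s0] := leP 0 s.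
  by rewrite (le_trans (norm_bclif_le1 _ _)) ?mulr_ge0// (le_trans _ (expR_ge1Dx _))// lerDl mulr_ge0.
apply: le_trans (norm_bclif_le _ _) _.
by rewrite ler_expR normrM (ger0_norm t0) ler_wpM2r// ltr0_norm// lerNl ltW.
Qed.

Let solve2 (p q x y a b : R) : p ^+ 2 + q ^+ 2 != 0 ->
  p * x + q * y = a -> p * y - q * x = b ->
  x = p / (p ^+ 2 + q ^+ 2) * a - q / (p ^+ 2 + q ^+ 2) * b /\
  y = p / (p ^+ 2 + q ^+ 2) * b + q / (p ^+ 2 + q ^+ 2) * a.
Proof. by move=> h <- <-; split; field. Qed.

Let unrotate (a b a0 b0 c d e e' : R) : e' * e = 1 -> c ^+ 2 + d ^+ 2 = 1 ->
  e * (a * c - b * d) = a0 -> e * (b * c + a * d) = b0 ->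
  a = e' * (a0 * c + b0 * d) /\ b = e' * (b0 * c - a0 * d).
Proof.
move=> e1 cd <- <-; split.
  have -> : e' * (e * (a * c - b * d) * c + e * (b * c + a * d) * d)
    = (e' * e) * (a * (c ^+ 2 + d ^+ 2)) by ring.
  by rewrite e1 cd mulr1 mul1r.
have -> : e' * (e * (b * c + a * d) * c - e * (a * c - b * d) * d)
  = (e' * e) * (b * (c ^+ 2 + d ^+ 2)) by ring.
by rewrite e1 cd mulr1 mul1r.
Qed.

(** For [Z = A + i B] the system reads [Z' = - (P + i Q) Z]. The two auxiliary functions are the
    real and imaginary parts of [e^(x (P + i Q)) Z x], which is constant. *)
Let rotate_ode (A B : R -> R) (P Q s : R) : 0 <= s ->
  (forall x : R, 0 <= x -> is_derive x (1 : R) A (- (P * A x - Q * B x))) ->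
  (forall x : R, 0 <= x -> is_derive x (1 : R) B (- (P * B x + Q * A x))) ->
  A s = expR (- (s * P)) * (A 0 * cos (s * Q) + B 0 * sin (s * Q)) /\
  B s = expR (- (s * P)) * (B 0 * cos (s * Q) - A 0 * sin (s * Q)).
Proof.
move=> s0 dA dB.
apply: (@unrotate _ _ _ _ _ _ (expR (s * P))).
- by rewrite -expRD addNr expR0.
- exact: cos2Dsin2.
- transitivity (expR (0 * P) * (A 0 * cos (0 * Q) - B 0 * sin (0 * Q))).
    apply: (isd0_eq (f := fun x => expR (x * P) * (A x * cos (x * Q) - B x * sin (x * Q)))) => // x x0.
    by have hA := dA x x0; have hB := dB x x0; isderive; ring.
  by rewrite !mul0r expR0 cos0 sin0 mulr0 mulr1 mul1r subr0.
- transitivity (expR (0 * P) * (B 0 * cos (0 * Q) + A 0 * sin (0 * Q))).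
    apply: (isd0_eq (f := fun x => expR (x * P) * (B x * cos (x * Q) + A x * sin (x * Q)))) => // x x0.
    by have hA := dA x x0; have hB := dB x x0; isderive; ring.
  by rewrite !mul0r expR0 cos0 sin0 mulr0 mulr1 mul1r addr0.
Qed.

Variables (p q : R).
Hypothesis p0 : 0 < p.

Let C (t : R) := expR (- (p * t)) * cos (q * t).
Let S (t : R) := expR (- (p * t)) * sin (q * t).

Let dC t : is_derive t (1 : R) C (- p * C t - q * S t).
Proof. by rewrite /C /S; isderive; ring. Qed.

Let dS t : is_derive t (1 : R) S (- p * S t + q * C t).
Proof. by rewrite /C /S; isderive; ring. Qed.

Let normC t : `|C t| <= expR (- (p * t)).
Proof. by rewrite /C normrM ger0_norm ?expR_ge0// ler_piMr ?expR_ge0// cos_max. Qed.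

Let normS t : `|S t| <= expR (- (p * t)).
Proof. by rewrite /S normrM ger0_norm ?expR_ge0// ler_piMr ?expR_ge0// sin_max. Qed.

Let N2 := p ^+ 2 + q ^+ 2.
Let N2_neq0 : N2 != 0.
Proof. by rewrite gt_eqF// ltr_wpDr ?sqr_ge0// exprn_gt0. Qed.

(* With [w = p + i q], [P - i Q = 1 / w]. *)
Let P := p / N2.
Let Q := q / N2.

Let cC : continuous C.
Proof. by move=> t; exact: isd_continuous (dC t). Qed.

Let cS : continuous S.
Proof. by move=> t; exact: isd_continuous (dS t). Qed.

Let int_base (X phi : R -> R) (k : nat) :
  (forall t, `|X t| <= expR (- (p * t))) -> continuous X ->
  (forall t, 0 < t -> `|phi t| <= t ^+ k) -> continuous phi ->
  intR (fun t => X t * phi t).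
Proof.
move=> hX cX hphi cphi; apply: le_intR (intR_polyexpN k p0).
  by apply: cont_measurable => t _; apply: cvgM; [exact: cX|exact: cphi].
by move=> t t0; rewrite normrM mulrC ler_pM// hphi.
Qed.

Let lim_base (X phi : R -> R) (k : nat) :
  (forall t, `|X t| <= expR (- (p * t))) ->
  (forall t, 0 < t -> `|phi t| <= t ^+ k) ->
  X t * phi t @[t --> +oo] --> 0.
Proof.
move=> hX hphi; apply: (@cvg0_polyexpN _ _ 1 k p) => // t t0.
by rewrite mul1r normrM mulrC ler_pM// hphi.
Qed.

(** The rule [w L[phi](w) = phi 0 + L[phi'](w)] for [w = p + i q], split into parts with
    [e^(- w t) = C t - i S t]. *)
Let by_parts (phi dphi : R -> R) (k l : nat) :
  (forall t, is_derive t (1 : R) phi (dphi t)) -> continuous dphi ->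
  (forall t, 0 < t -> `|phi t| <= t ^+ k) ->
  (forall t, 0 < t -> `|dphi t| <= t ^+ l) ->
  p * (\int[mu]_(t in Rpos) (C t * phi t)) + q * (\int[mu]_(t in Rpos) (S t * phi t)) =
    phi 0 + \int[mu]_(t in Rpos) (C t * dphi t) /\
  p * (\int[mu]_(t in Rpos) (S t * phi t)) - q * (\int[mu]_(t in Rpos) (C t * phi t)) =
    \int[mu]_(t in Rpos) (S t * dphi t).
Proof.
move=> hd cd bphi bdphi.
have cphi : continuous phi by move=> t; exact: isd_continuous (hd t).
have i1 := int_base normC cC bphi cphi.
have i2 := int_base normS cS bphi cphi.
have i3 := int_base normC cC bdphi cd.
have i4 := int_base normS cS bdphi cd.
split.
  have : \int[mu]_(t in Rpos) (C t * dphi t - (p * (C t * phi t) + q * (S t * phi t))) =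
      - (C 0 * phi 0).
    apply: (@FTC_decay _ (fun t => C t * phi t)).
    - by move=> t _; have h1 := hd t; have h2 := dC t; isderive; ring.
    - move=> t _; apply: cvgB; first by apply: cvgM; [exact: cC|exact: cd].
      by apply: cvgD; apply: cvgMr; apply: cvgM; try exact: cphi; [exact: cC|exact: cS].
    - by apply: intRB => //; apply: intRD; exact: intRZ.
    - exact: lim_base normC bphi.
  rewrite RintB ?RintD ?RintZ//; try by [exact: intRZ|apply: intRD; exact: intRZ].
  by rewrite (_ : C 0 = 1) => [h|]; [lra|rewrite /C !mulr0 oppr0 expR0 cos0 mulr1].
have : \int[mu]_(t in Rpos) (S t * dphi t - (p * (S t * phi t) - q * (C t * phi t))) =
    - (S 0 * phi 0).
  apply: (@FTC_decay _ (fun t => S t * phi t)).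
  - by move=> t _; have h1 := hd t; have h2 := dS t; isderive; ring.
  - move=> t _; apply: cvgB; first by apply: cvgM; [exact: cS|exact: cd].
    by apply: cvgB; apply: cvgMr; apply: cvgM; try exact: cphi; [exact: cS|exact: cC].
  - by apply: intRB => //; apply: intRB; exact: intRZ.
  - exact: lim_base normS bphi.
rewrite RintB ?RintB ?RintZ//; try by [exact: intRZ|apply: intRB; exact: intRZ].
by rewrite (_ : S 0 = 0) => [h|]; [lra|rewrite /S !mulr0 sin0 mulr0].
Qed.

(** The value [L[t](w) = w^-2], by two integrations by parts that start from the constant 1. *)
Let base_int : \int[mu]_(t in Rpos) (C t * t) = P ^+ 2 - Q ^+ 2 /\
  \int[mu]_(t in Rpos) (S t * t) = 2 * P * Q.
Proof.
have [a1 a2] := @by_parts (fun=> 1) (fun=> 0) 0 0 (fun t => isd_cst 1 t)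
  (fun t => @cvg_cst _ _ _ _ _)
  (fun t _ => ltac:(by rewrite normr1 expr0)) (fun t _ => ltac:(by rewrite normr0 expr0)).
have [b1 b2] := @by_parts (fun t => t) (fun=> 1) 1 0 (fun t => isd_id t)
  (fun t => @cvg_cst _ _ _ _ _)
  (fun t t0 => ltac:(by rewrite expr1 gtr0_norm)) (fun t _ => ltac:(by rewrite normr1 expr0)).
have z (X : R -> R) : \int[mu]_(t in Rpos) (X t * 0) = 0.
  by under eq_Rintegral do rewrite mulr0; rewrite /Rintegral integral0.
rewrite !z in a1 a2; move: a1 a2 b1 b2.
set I0 := \int[mu]_(t in Rpos) (C t * 1); set J0 := \int[mu]_(t in Rpos) (S t * 1).
set I1 := \int[mu]_(t in Rpos) (C t * t); set J1 := \int[mu]_(t in Rpos) (S t * t).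
rewrite !addr0 add0r => a1 a2 b1 b2.
have [I0E J0E] := solve2 N2_neq0 a1 a2; have [-> ->] := solve2 N2_neq0 b1 b2.
by rewrite I0E J0E -/N2 -/P -/Q; split; ring.
Qed.

(** The counterpart of the Bessel identity [(x^2 J_2)' = x^2 J_1]. *)
Let dphi2 (s t : R) : is_derive t (1 : R) (fun t => t ^+ 2 * bclif 2 (s * t)) (t * bclif 1 (s * t)).
Proof.
have h := is_derive_bclifM 2 s t; isderive => /=.
have -> : t ^+ 2 * - (s * bclif 3 (s * t)) = - (t * ((s * t) * bclif 3 (s * t))) by ring.
rewrite bclif_rec; ring.
Qed.

Let A (s : R) := \int[mu]_(t in Rpos) (C t * (t * bclif 1 (s * t))).
Let B (s : R) := \int[mu]_(t in Rpos) (S t * (t * bclif 1 (s * t))).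
Let A2 (s : R) := \int[mu]_(t in Rpos) (C t * (t ^+ 2 * bclif 2 (s * t))).
Let B2 (s : R) := \int[mu]_(t in Rpos) (S t * (t ^+ 2 * bclif 2 (s * t))).

Let cbm n (s : R) : continuous (fun t => bclif n (s * t)).
Proof. by move=> t; exact: isd_continuous (is_derive_bclifM n s t). Qed.

Let A2E s : 0 <= s -> A2 s = P * A s - Q * B s /\ B2 s = P * B s + Q * A s.
Proof.
move=> s0.
have [] := @by_parts (fun t => t ^+ 2 * bclif 2 (s * t)) (fun t => t * bclif 1 (s * t)) 2 1 (dphi2 s).
- by move=> t; apply: cvgM; [exact: cvg_id|exact: cbm].
- move=> t t0; rewrite normrM ger0_norm ?sqr_ge0// ler_piMr ?sqr_ge0//.
  by rewrite norm_bclif_le1// mulr_ge0// ltW.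
- move=> t t0; rewrite normrM gtr0_norm// expr1 ler_piMr ?(ltW t0)//.
  by rewrite norm_bclif_le1// mulr_ge0// ltW.
rewrite expr0n /= mul0r add0r -/(A s) -/(B s) -/(A2 s) -/(B2 s) => a b.
exact: solve2 N2_neq0 a b.
Qed.

Let dint (X : R -> R) (s : R) : (forall t, `|X t| <= expR (- (p * t))) ->
  continuous X -> 0 <= s ->
  is_derive s (1 : R) (fun s => \int[mu]_(t in Rpos) (X t * (t * bclif 1 (s * t))))
    (- \int[mu]_(t in Rpos) (X t * (t ^+ 2 * bclif 2 (s * t)))).
Proof.
move=> hX cX s0; have p2 : 0 < p / 2 by rewrite divr_gt0.
(* For [x] above [- p / 2] the Bessel factor may grow like [e^(p t / 2)]; half of the decay
   [e^(- p t)] pays for it. *)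
have bd n k (x t : R) : - (p / 2) < x -> 0 < t ->
    `|X t * (t ^+ k * bclif n (x * t))| <= t ^+ k * expR (- (p / 2 * t)).
  move=> xp t0; rewrite !normrM (ger0_norm (exprn_ge0 _ (ltW t0))) mulrCA.
  rewrite ler_wpM2l ?exprn_ge0 ?(ltW t0)//.
  have -> : expR (- (p / 2 * t)) = expR (- (p * t)) * expR (p / 2 * t).
    by rewrite -expRD; congr expR; field.
  by rewrite ler_pM// norm_bclif_le_exp// ltW.
have mb n k (x : R) : measurable_fun Rpos (fun t => X t * (t ^+ k * bclif n (x * t))).
  apply: cont_measurable => t _; apply: cvgM; first exact: cX.
  by apply: cvgM; [exact: exprn_continuous|exact: cbm].
have i2 : intR (fun t => X t * (t ^+ 2 * bclif 2 (s * t))).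
  apply: le_intR (intR_polyexpN 2 p2) => // t t0; apply: bd => //.
  by rewrite (lt_le_trans _ s0)// oppr_lt0.
rewrite -RintN//.
apply: (@isd_integral _ _ _ mu Rpos (fun s t => X t * (t * bclif 1 (s * t)))
  (fun s t => - (X t * (t ^+ 2 * bclif 2 (s * t))))
  (fun t => t ^+ 2 * expR (- (p / 2 * t))) s (- (p / 2)) (s + 1)).
- exact: mRpos.
- by rewrite (lt_le_trans _ s0) ?oppr_lt0//= ltrDl.
- move=> x /andP[px _]; apply: le_intR (intR_polyexpN 1 p2).
    exact: mb 1%N 1%N x.
  by move=> t t0; apply: (bd 1%N 1%N).
- move=> x t _ _; have h := is_derive_bclif 1 (x * t).
  isderive => //=; ring.
- exact: intR_polyexpN.
- by move=> x t /andP[px _] /Rpos_gt0 t0; rewrite normrN; exact: bd.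
Qed.

(** In complex form [L[t C_1(s t)](w) = w^-2 e^(- s / w)]. As a function of [s] the left side solves
    [Z' = - Z / w]: differentiation under the integral gives [- L[t^2 C_2(s t)]], and one
    integration by parts turns this into [- L[t C_1(s t)] / w]. The value at [s = 0] is
    [base_int]. *)
Lemma laplace_bclif1 s : 0 <= s ->
  \int[mu]_(t in Rpos) (expR (- (p * t)) * cos (q * t) * (t * bclif 1 (s * t))) =
    expR (- (s * P)) * ((P ^+ 2 - Q ^+ 2) * cos (s * Q) + 2 * P * Q * sin (s * Q)) /\
  \int[mu]_(t in Rpos) (expR (- (p * t)) * sin (q * t) * (t * bclif 1 (s * t))) =
    expR (- (s * P)) * (2 * P * Q * cos (s * Q) - (P ^+ 2 - Q ^+ 2) * sin (s * Q)).
Proof.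
move=> s0; rewrite -/(A s) -/(B s).
have dA (x : R) : 0 <= x -> is_derive x (1 : R) A (- (P * A x - Q * B x)).
  by move=> x0; rewrite -(A2E x0).1; exact: dint.
have dB (x : R) : 0 <= x -> is_derive x (1 : R) B (- (P * B x + Q * A x)).
  by move=> x0; rewrite -(A2E x0).2; exact: dint.
have A0 : A 0 = P ^+ 2 - Q ^+ 2.
  rewrite -base_int.1; apply: eq_Rintegral => t _.
  by rewrite mul0r bclif0 /= invr1 mulr1.
have B0 : B 0 = 2 * P * Q.
  rewrite -base_int.2; apply: eq_Rintegral => t _.
  by rewrite mul0r bclif0 /= invr1 mulr1.
by rewrite -A0 -B0; exact: rotate_ode.
Qed.

End LaplaceKernel.

(** * The Hankel transform *)

Section HankelTransform.
Context {R : realType}.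
Local Notation mu := (@lebesgue_measure R).

(** Closed under differentiation in [t], which raises both indices and changes the sign; the two
    indices exist for this purpose. *)
Definition bclif_int (n k : nat) (g : R -> R) (t : R) : R :=
  \int[mu]_(s in Rpos) (s ^+ k * bclif n (s * t) * g s).

(* [\int_0^oo J_1 (2 * sqrt (s * t)) * sqrt (t / s) * g s ds] *)
Definition hankel (g : R -> R) (t : R) : R := t * bclif_int 1 0 g t.

Lemma measurable_bclif_mulr n (t : R) : measurable_fun [set: R] (fun s => bclif n (s * t)).
Proof.
apply: continuous_measurable_fun => s.
apply: continuous_comp; last exact: continuous_bclif.
by apply: cvgMl; exact: cvg_id.
Qed.

Lemma intR_bclif (n k : nat) (g : R -> R) (t : R) : measurable_fun Rpos g -> 0 <= t ->
  intR (fun s => s ^+ k * g s) -> intR (fun s => s ^+ k * bclif n (s * t) * g s).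
Proof.
move=> mg t0 /intR_norm ig; apply: le_intR ig.
  apply: measurable_funM => //; apply: measurable_funM; first exact: measurable_funX.
  by apply: measurable_funTS; exact: measurable_bclif_mulr.
move=> s s0; rewrite mulrAC normrM ler_piMr//.
by rewrite norm_bclif_le1// mulr_ge0// ltW.
Qed.

Lemma norm_bclif_int_le (n k : nat) (g : R -> R) (t : R) : measurable_fun Rpos g ->
  0 <= t -> intR (fun s => s ^+ k * g s) ->
  `|bclif_int n k g t| <= \int[mu]_(s in Rpos) `|s ^+ k * g s|.
Proof.
move=> mg t0 ig; have i1 := intR_bclif n mg t0 ig.
rewrite (le_trans (le_normr_Rintegral _ i1))//.
apply: le_Rintegral => //; [exact: intR_norm|exact: intR_norm|].
move=> s /Rpos_gt0 s0; rewrite mulrAC normrM ler_piMr//.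
by rewrite norm_bclif_le1// mulr_ge0// ltW.
Qed.

Section Derivatives.
Variable g : R -> R.
Hypothesis mg : measurable_fun [set: R] g.
Hypothesis ig : forall k, intR (fun s => s ^+ k * (expR (4^-1 * s) * g s)).

Let mgR : measurable_fun Rpos g. Proof. exact: measurable_funTS. Qed.

Lemma intR_moment k : intR (fun s => s ^+ k * g s).
Proof.
apply: le_intR (intR_norm (ig k)).
  by apply: measurable_funM => //; exact: measurable_funX.
move=> s s0; rewrite mulrCA [leRHS]normrM ler_peMl// ger0_norm ?expR_ge0//.
by rewrite (le_trans _ (expR_ge1Dx _))// lerDl mulr_ge0// ltW.
Qed.

(** The weight [e^(s/4)] in the assumption on [g] dominates the Bessel factor for all [t > - 1/4],
    so differentiation under the integral is two-sided at [t = 0] as well. *)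
Lemma isd_bclif_int n k (t : R) : - 4^-1 < t ->
  is_derive t (1 : R) (bclif_int n k g) (- bclif_int n.+1 k.+1 g t).
Proof.
move=> t4.
have bd m j (x s : R) : - 4^-1 < x -> 0 < s ->
    `|s ^+ j * bclif m (s * x) * g s| <= `|s ^+ j * (expR (4^-1 * s) * g s)|.
  move=> x4 s0; rewrite !normrM -mulrA ler_wpM2l// ler_wpM2r//.
  by rewrite (ger0_norm (expR_ge0 _)) mulrC norm_bclif_le_exp// ltW.
have ii m j (x : R) : - 4^-1 < x -> intR (fun s => s ^+ j * bclif m (s * x) * g s).
  move=> x4; apply: le_intR (intR_norm (ig j)); last by move=> s s0; exact: bd.
  apply: measurable_funM => //; apply: measurable_funM; first exact: measurable_funX.
  by apply: measurable_funTS; exact: measurable_bclif_mulr.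
rewrite /bclif_int -RintN; last exact: ii.
apply: (@isd_integral _ _ _ mu Rpos (fun t s => s ^+ k * bclif n (s * t) * g s)
  (fun t s => - (s ^+ k.+1 * bclif n.+1 (s * t) * g s))
  (fun s => `|s ^+ k.+1 * (expR (4^-1 * s) * g s)|) t (- 4^-1) (t + 1)).
- exact: mRpos.
- by rewrite t4 ltrDl/=.
- by move=> x /andP[x4 _]; exact: ii.
- by move=> x s _ _; have h := is_derive_bclif n (s * x); isderive; rewrite exprS; ring.
- exact: intR_norm.
- by move=> x s /andP[x4 _] /Rpos_gt0 s0; rewrite normrN; exact: bd.
Qed.

(** The kernel [t C_1(s t)] has the [t]-derivative [C_0(s t)], by the recurrence with [n = 0]. *)
Lemma isd_hankel (t : R) : - 4^-1 < t ->
  is_derive t (1 : R) (hankel g) (bclif_int 0 0 g t).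
Proof.
move=> t4; have h := isd_bclif_int 1 0 t4.
have e : bclif_int 0 0 g t = bclif_int 1 0 g t - t * bclif_int 2 1 g t.
  have bd m j (s : R) : 0 < s ->
      `|s ^+ j * bclif m (s * t) * g s| <= `|s ^+ j * (expR (4^-1 * s) * g s)|.
    move=> s0; rewrite !normrM -mulrA ler_wpM2l// ler_wpM2r//.
    by rewrite (ger0_norm (expR_ge0 _)) mulrC norm_bclif_le_exp// ltW.
  have ii m j : intR (fun s => s ^+ j * bclif m (s * t) * g s).
    apply: le_intR (intR_norm (ig j)); last by move=> s s0; exact: bd.
    apply: measurable_funM => //; apply: measurable_funM; first exact: measurable_funX.
    by apply: measurable_funTS; exact: measurable_bclif_mulr.
  rewrite /bclif_int -RintZ; last exact: ii.
  rewrite -RintB; [|exact: ii|apply: intRZ; exact: ii].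
  apply: eq_Rintegral => s _; have := bclif_rec 0 (s * t); rewrite mul1r => hr.
  have -> : bclif 0 (s * t) = bclif 1 (s * t) - s * t * bclif 2 (s * t) by rewrite hr; ring.
  by rewrite !expr0 !expr1; ring.
by rewrite /hankel; isderive; rewrite e; ring.
Qed.

End Derivatives.

Lemma norm_hankel_le (g : R -> R) (t : R) : measurable_fun Rpos g -> intR g ->
  0 <= t -> `|hankel g t| <= t * \int[mu]_(s in Rpos) `|g s|.
Proof.
move=> mg ig t0; have ig' : intR (fun s => s ^+ 0 * g s).
  by apply: eq_intR ig => s _; rewrite mul1r.
rewrite /hankel normrM (ger0_norm t0) ler_wpM2l// (le_trans (norm_bclif_int_le _ _ _ ig'))//.
by rewrite le_eqVlt; apply/orP; left; apply/eqP/eq_Rintegral => s _; rewrite mul1r.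
Qed.

(** Fubini with the product bound [|g s| * (t e^(- p t))], then [laplace_bclif1] for the inner
    integral. Since [P - i Q = 1 / w], the two right-hand sides are the parts of [w^-2 L[g](1 /
    w)]. *)
Lemma laplace_hankel (g : R -> R) (p q : R) : measurable_fun [set: R] g -> intR g -> 0 < p ->
  let P := p / (p ^+ 2 + q ^+ 2) in let Q := q / (p ^+ 2 + q ^+ 2) in
  \int[mu]_(t in Rpos) (expR (- (p * t)) * cos (q * t) * hankel g t) =
    \int[mu]_(s in Rpos) (expR (- (P * s)) *
      ((P ^+ 2 - Q ^+ 2) * cos (Q * s) + 2 * P * Q * sin (Q * s)) * g s) /\
  \int[mu]_(t in Rpos) (expR (- (p * t)) * sin (q * t) * hankel g t) =
    \int[mu]_(s in Rpos) (expR (- (P * s)) *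
      (2 * P * Q * cos (Q * s) - (P ^+ 2 - Q ^+ 2) * sin (Q * s)) * g s).
Proof.
move=> mg ig p0 P Q; have mgR : measurable_fun Rpos g by exact: measurable_funTS.
have ig' : intR (fun s => s ^+ 0 * g s).
  by apply: eq_intR ig => s _; rewrite mul1r.
have gen (X : R -> R) : (forall t, `|X t| <= 1) -> measurable_fun [set: R] X ->
    \int[mu]_(t in Rpos) (expR (- (p * t)) * X t * hankel g t) =
    \int[mu]_(s in Rpos)
      ((\int[mu]_(t in Rpos) (expR (- (p * t)) * X t * (t * bclif 1 (s * t)))) * g s).
  move=> X1 mX.
  have me : measurable_fun [set: R] (fun t => expR (- (p * t))).
    by apply: measurableT_comp => //; apply: measurable_funN; exact: measurable_funM.
  pose K s t := g s * (expR (- (p * t)) * X t * (t * bclif 1 (s * t))).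
  have mK : measurable_fun [set: measurableTypeR R * measurableTypeR R] (fun z => K z.1 z.2).
    apply: measurable_funM; first exact: (measurableT_comp mg measurable_fst).
    apply: measurable_funM.
      by apply: measurable_funM; [exact: (measurableT_comp me measurable_snd)|
        exact: (measurableT_comp mX measurable_snd)].
    apply: measurable_funM; first exact: measurable_snd.
    apply: measurableT_comp; first by apply: continuous_measurable_fun; exact: continuous_bclif.
    by apply: measurable_funM; [exact: measurable_fst|exact: measurable_snd].
  have Xb s t : 0 < s -> 0 < t ->
      `|expR (- (p * t)) * X t * (t * bclif 1 (s * t))| <= t ^+ 1 * expR (- (p * t)).
    move=> s0 t0; rewrite !normrM (ger0_norm (expR_ge0 _)) (gtr0_norm t0) mulrACA.
    rewrite expr1 [leRHS]mulrC ler_piMr ?mulr_ge0 ?expR_ge0 ?(ltW t0)//.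
    by rewrite mulr_ile1// norm_bclif_le1// mulr_ge0// ltW.
  have Kb s t : 0 < s -> 0 < t -> `|K s t| <= `|g s| * (t ^+ 1 * expR (- (p * t))).
    by move=> s0 t0; rewrite normrM ler_wpM2l// Xb.
  have [h _] := fubini_Rpos mK (intR_norm ig) (intR_polyexpN 1 p0) Kb.
  transitivity (\int[mu]_(t in Rpos) (\int[mu]_(s in Rpos) K s t)).
    apply: eq_RintR => t t0; rewrite /hankel /bclif_int mulrA -RintZ; last first.
      exact: (@intR_bclif 1 0 g t mgR (ltW t0) ig').
    by apply: eq_Rintegral => s _; rewrite /K expr0; ring.
  apply: etrans (esym h) _; apply: eq_RintR => s s0.
  apply: etrans (RintZ (g s) _) (mulrC _ _).
  apply: le_intR (intR_polyexpN 1 p0).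
    apply: measurable_funM; first by apply: measurable_funTS; exact: measurable_funM.
    apply: measurable_funM; first exact: measurable_id.
    by apply: cont_measurable => t _; exact: isd_continuous (is_derive_bclifM 1 s t).
  by move=> t t0; exact: Xb.
split.
  rewrite (gen (fun t => cos (q * t))); first last.
  - apply: measurableT_comp; last exact: measurable_funM.
    by apply: continuous_measurable_fun; exact: continuous_cos.
  - by move=> t; exact: cos_max.
  apply: eq_RintR => s s0; rewrite (laplace_bclif1 q p0 (ltW s0)).1 -/P -/Q.
  by rewrite ![s * _]mulrC.
rewrite (gen (fun t => sin (q * t))); first last.
- apply: measurableT_comp; last exact: measurable_funM.
  by apply: continuous_measurable_fun; exact: continuous_sin.
- by move=> t; exact: sin_max.
apply: eq_RintR => s s0; rewrite (laplace_bclif1 q p0 (ltW s0)).2 -/P -/Q.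
by rewrite ![s * _]mulrC.
Qed.

End HankelTransform.

(** * Quotients at a simple zero *)

Section PolyBounded.
Context {R : realType}.

Definition poly_bounded (f : R -> R) :=
  exists C k, forall t : R, 0 <= t -> `|f t| <= C * (1 + t) ^+ k.

Lemma poly_bounded_cst (f : R -> R) C : (forall t, 0 <= t -> `|f t| <= C) -> poly_bounded f.
Proof. by move=> fC; exists C, 0%N => t t0; rewrite expr0 mulr1 fC. Qed.

Lemma poly_boundedN f : poly_bounded f -> poly_bounded (fun t => - f t).
Proof. by move=> [C [k h]]; exists C, k => t t0; rewrite normrN h. Qed.

Lemma poly_boundedM f g : poly_bounded f -> poly_bounded g -> poly_bounded (fun t => f t * g t).
Proof.
move=> [C [k hf]] [D [l hg]]; exists (C * D), (k + l)%N => t t0.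
by rewrite normrM exprD mulrACA ler_pM ?hf ?hg.
Qed.

Lemma poly_boundedD f g : poly_bounded f -> poly_bounded g -> poly_bounded (fun t => f t + g t).
Proof.
move=> [C [k hf]] [D [l hg]]; exists (`|C| + `|D|), (k + l)%N => t t0.
have t1 : 1 <= 1 + t by rewrite lerDl.
rewrite (le_trans (ler_normD _ _))// mulrDl lerD//.
  rewrite (le_trans (hf _ t0))// (le_trans (ler_wpM2r _ (ler_norm C))) ?exprn_ge0 ?addr_ge0//.
  by rewrite ler_wpM2l// ler_weXn2l// leq_addr.
rewrite (le_trans (hg _ t0))// (le_trans (ler_wpM2r _ (ler_norm D))) ?exprn_ge0 ?addr_ge0//.
by rewrite ler_wpM2l// ler_weXn2l// leq_addl.
Qed.

Lemma poly_boundedX f n : poly_bounded f -> poly_bounded (fun t => f t ^+ n).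
Proof.
move=> hf; elim: n => [|n IH].
  by apply: (@poly_bounded_cst _ 1) => t _; rewrite expr0 normr1.
have [C [k h]] := poly_boundedM hf IH.
by exists C, k => t t0; rewrite exprS h.
Qed.

Lemma poly_bounded_expN f (a : R) : 0 < a -> poly_bounded f ->
  exists2 C, 0 <= C & forall t : R, 0 <= t -> `|f t| <= C * expR (a * t).
Proof.
move=> a0 [C [k h]]; exists (`|C| * (k`!%:R * a ^- k * expR a)) => [|t t0].
  by rewrite !mulr_ge0 ?expR_ge0// invr_ge0 exprn_ge0// ltW.
rewrite (le_trans (h _ t0))// (le_trans (ler_wpM2r _ (ler_norm C))) ?exprn_ge0 ?addr_ge0//.
rewrite -[leRHS]mulrA ler_wpM2l//.
have := polyexpN_le k a0 (addr_ge0 ler01 t0).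
by rewrite expRN ler_pdivrMr ?expR_gt0// mulrDr mulr1 expRD mulrA.
Qed.

End PolyBounded.

(** * Division by a simple zero: Hadamard's lemma *)

Section Hadamard.
Context {R : realType}.
Local Notation mu := (@lebesgue_measure R).
Variables (f : nat -> R -> R) (e t0 : R).
Hypothesis e0 : 0 < e.
Hypothesis t0_ge0 : 0 <= t0.
Hypothesis df : forall k (t : R), - e < t -> is_derive t (1 : R) (f k) (f k.+1 t).

(** For [k = 0] this is the smooth version of [f 0 t / (t - t0)] when [f 0 t0 = 0]; [hadamard k] is
    its derivative of order [k]. The sequence [f] lists successive derivatives on [(- e, +oo)], and
    the margin [e] again serves two-sided derivatives at 0. *)
Definition hadamard k (t : R) : R :=
  \int[mu]_(x in `[0%R, 1%R]) (x ^+ k * f k.+1 (t0 + x * (t - t0))).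

Let arg_gt (x t : R) : - e < t -> 0 <= x <= 1 -> - e < t0 + x * (t - t0).
Proof.
move=> et /andP[x0 x1]; rewrite -subr_gt0.
have -> : t0 + x * (t - t0) - - e = (1 - x) * (t0 + e) + x * (t + e) by ring.
have t0e : 0 < t0 + e by rewrite ltr_wpDl.
have te : 0 < t + e by rewrite -ltrBlDr sub0r.
move: x0; rewrite le_eqVlt => /predU1P[<-|x0]; first by rewrite subr0 mul1r mul0r addr0.
by rewrite ltr_wpDl ?mulr_gt0// mulr_ge0 ?subr_ge0// ltW.
Qed.

Let isd_arg k (x t : R) : - e < t0 + x * (t - t0) ->
  is_derive t (1 : R) (fun t => f k (t0 + x * (t - t0))) (x * f k.+1 (t0 + x * (t - t0))).
Proof. by move=> h; have h2 := df k h; isderive; ring. Qed.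

Let isd_argx k (x t : R) : - e < t0 + x * (t - t0) ->
  is_derive x (1 : R) (fun x => f k (t0 + x * (t - t0))) ((t - t0) * f k.+1 (t0 + x * (t - t0))).
Proof. by move=> h; have h2 := df k h; isderive; ring. Qed.

Let within_argx k j (t : R) : - e < t ->
  {within `[0, 1], continuous (fun x => x ^+ j * f k (t0 + x * (t - t0)))}.
Proof.
move=> et; apply: continuous_in_subspaceT => x /[!inE]/= /[!in_itv]/= x01.
apply: cvgM; first exact: exprn_continuous.
exact: isd_continuous (isd_argx k (arg_gt et x01)).
Qed.

Let bounded k (a b : R) : - e < a -> exists M, forall x, a <= x <= b -> `|f k x| <= M.
Proof.
move=> ea; have [ab|ba] := leP a b; last first.
  exists 0 => x /andP[ax xb]; have := le_trans ax xb.
  by rewrite leNgt ba.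
have cf : {within `[a, b], continuous (fun x => `|f k x|)}.
  apply: continuous_in_subspaceT => x /[!inE]/= /[!in_itv]/= /andP[ax _].
  by apply: cvg_norm; exact: isd_continuous (df k (lt_le_trans ea ax)).
have [c _ hc] := EVT_max ab cf.
by exists `|f k c| => x xab; apply: hc; rewrite in_itv.
Qed.

Lemma hadamard_factor (t : R) : f 0 t0 = 0 -> 0 <= t -> f 0 t = (t - t0) * hadamard 0 t.
Proof.
move=> f0 t_ge0; have et : - e < t by rewrite (lt_le_trans _ t_ge0)// oppr_lt0.
have i1 : mu.-integrable `[0, 1] (EFin \o (fun x => x ^+ 0 * f 1 (t0 + x * (t - t0)))).
  by apply: continuous_compact_integrable; [exact: segment_compact|exact: within_argx].
rewrite /hadamard -RintegralZl//.
rewrite /Rintegral (@continuous_FTC2 _ _ (fun x => f 0 (t0 + x * (t - t0))) 0 1)//.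
- by rewrite mul1r mul0r addr0 subrKC f0 sube0.
- apply: continuous_in_subspaceT => x /[!inE]/= /[!in_itv]/= x01.
  apply: cvgMr; apply: cvgM; first exact: exprn_continuous.
  exact: isd_continuous (isd_argx 1 (arg_gt et x01)).
- have h (x : R) : 0 <= x <= 1 -> {for x, continuous (fun y : R => f 0 (t0 + y * (t - t0)))}.
    by move=> x01; exact: isd_continuous (isd_argx 0 (arg_gt et x01)).
  split.
  + move=> x /[!in_itv]/= /andP[x0 x1]; apply: (@ex_derive _ _ _ _ _ _ _ (isd_argx 0 _)).
    by rewrite arg_gt// !ltW.
  + by apply: cvg_at_right_filter; apply: h; rewrite lexx ler01.
  + by apply: cvg_at_left_filter; apply: h; rewrite lexx ler01.
- move=> x /[!in_itv]/= /andP[x0 x1].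
  rewrite derive1E (@derive_val _ _ _ _ _ _ _ (isd_argx 0 _)) ?expr0 ?mul1r//.
  by rewrite arg_gt// !ltW.
Qed.

Lemma isd_hadamard k (t : R) : 0 <= t -> is_derive t (1 : R) (hadamard k) (hadamard k.+1 t).
Proof.
move=> t_ge0.
(* For parameters in [(- e/2, t + 1)] the points [t0 + x (t - t0)] stay in the segment
   [[- e/2, t0 + t + 1]], on which the next derivative is bounded. *)
have e2 : - e < - (e / 2) by have := e0; lra.
have [M hM] := bounded k.+2 (t0 + t + 1) e2.
apply: (@isd_integral _ _ _ mu `[0%R, 1%R] (fun t x => x ^+ k * f k.+1 (t0 + x * (t - t0)))
  (fun t x => x ^+ k.+1 * f k.+2 (t0 + x * (t - t0))) (fun=> M) t (- (e / 2)) (t + 1)) => //.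
- by have h0 := e0; apply/andP; split; lra.
- move=> x /andP[ex _]; apply: continuous_compact_integrable.
    exact: segment_compact.
  by apply: within_argx; exact: lt_trans ex.
- move=> x y /andP[ex _]; rewrite /= in_itv/= => y01.
  have h := isd_arg k.+1 (arg_gt (lt_trans e2 ex) y01).
  by isderive; rewrite exprSr; ring.
- apply: continuous_compact_integrable; first exact: segment_compact.
  by apply: continuous_subspaceT => x; exact: cvg_cst.
- move=> x y /andP[ex xt]; rewrite /= in_itv/= => /andP[y0 y1].
  rewrite normrM ger0_norm ?exprn_ge0// -[leRHS]mul1r ler_pM ?exprn_ge0//.
    by rewrite exprn_ile1.
  have h1 := e0; have h2 := t0_ge0.
  by apply: hM; apply/andP; split; nra.
Qed.

Lemma norm_hadamard_le k M (t : R) : (forall t, 0 <= t -> `|f k.+1 t| <= M) -> 0 <= t ->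
  `|hadamard k t| <= M.
Proof.
move=> hM t_ge0; have et : - e < t by rewrite (lt_le_trans _ t_ge0)// oppr_lt0.
have i1 : mu.-integrable `[0, 1] (EFin \o (fun x => x ^+ k * f k.+1 (t0 + x * (t - t0)))).
  by apply: continuous_compact_integrable; [exact: segment_compact|exact: within_argx].
have iM : mu.-integrable `[0%R, 1%R] (EFin \o (fun=> M)).
  apply: continuous_compact_integrable; first exact: segment_compact.
  by apply: continuous_subspaceT => x; exact: cvg_cst.
rewrite (le_trans (le_normr_Rintegral _ i1))//.
apply: (@le_trans _ _ (\int[mu]_(x in `[0%R, 1%R]) M)).
  apply: le_Rintegral => //; first exact: integrable_norm.
  move=> x; rewrite /= in_itv/= => /andP[x0 x1].
  rewrite normrM ger0_norm ?exprn_ge0// -[leRHS]mul1r ler_pM ?exprn_ge0//.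
    by rewrite exprn_ile1.
  by apply: hM; have h1 := t0_ge0; nra.
by rewrite Rintegral_cst//= lebesgue_measure_itv/= lte_fin ltr01 oppr0 adde0 mulr1.
Qed.

End Hadamard.

Section Quotient.
Context {R : realType}.
Variables (U U1 U2 U3 V V1 V2 V3 : R -> R).
Hypothesis dU : forall t : R, 0 <= t -> is_derive t (1 : R) U (U1 t).
Hypothesis dU1 : forall t : R, 0 <= t -> is_derive t (1 : R) U1 (U2 t).
Hypothesis dU2 : forall t : R, 0 <= t -> is_derive t (1 : R) U2 (U3 t).
Hypothesis dV : forall t : R, 0 <= t -> is_derive t (1 : R) V (V1 t).
Hypothesis dV1 : forall t : R, 0 <= t -> is_derive t (1 : R) V1 (V2 t).
Hypothesis dV2 : forall t : R, 0 <= t -> is_derive t (1 : R) V2 (V3 t).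
Hypothesis V_neq0 : forall t, 0 <= t -> V t != 0.
Hypothesis bU : poly_bounded U.
Hypothesis bU1 : poly_bounded U1.
Hypothesis bU2 : poly_bounded U2.
Hypothesis bV1 : poly_bounded V1.
Hypothesis bV2 : poly_bounded V2.
Hypothesis bW : poly_bounded (fun t => (V t)^-1).

(** All terms in the derivatives of [U / V] up to order two are polynomially bounded, and half of
    [e^(- t)] absorbs them. The third derivatives of [U] and [V] enter only through the continuity
    of [G2]. *)
Lemma smooth_quotient : exists (G G1 G2 : R -> R) (C : R),
  (forall t, 0 <= t -> G t = expR (- t) * (U t / V t)) /\
  (forall t : R, 0 <= t -> is_derive t (1 : R) G (G1 t)) /\
  (forall t : R, 0 <= t -> is_derive t (1 : R) G1 (G2 t)) /\
  (forall t : R, 0 <= t -> {for t, continuous G2}) /\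
  (forall t : R, 0 <= t -> [/\ `|G t| <= C * expR (- (2^-1 * t)),
    `|G1 t| <= C * expR (- (2^-1 * t)) & `|G2 t| <= C * expR (- (2^-1 * t))]).
Proof.
pose W t := (V t)^-1.
have dW (t : R) : 0 <= t -> is_derive t (1 : R) W (- (W t ^+ 2 * V1 t)).
  move=> t0; have h := dV t0; rewrite /W; isderive; first exact: V_neq0.
  by rewrite exprVn; ring.
pose A t := U t * W t.
pose A1 t := U1 t * W t - U t * (W t ^+ 2 * V1 t).
pose A2 t := U2 t * W t - 2 * U1 t * (W t ^+ 2 * V1 t) - U t * (W t ^+ 2 * V2 t)
  + 2 * U t * (W t ^+ 3 * V1 t ^+ 2).
have dA (t : R) : 0 <= t -> is_derive t (1 : R) A (A1 t).
  by move=> t0; have h1 := dU t0; have h2 := dW t t0; rewrite /A /A1; isderive; ring.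
have dA1 (t : R) : 0 <= t -> is_derive t (1 : R) A1 (A2 t).
  move=> t0; have h1 := dU t0; have h2 := dW t t0; have h3 := dU1 t0; have h4 := dV1 t0.
  by rewrite /A1 /A2; isderive => /=; ring.
have cA2 (t : R) : 0 <= t -> {for t, continuous A2}.
  move=> t0; have h1 := dU t0; have h2 := dW t t0; have h3 := dU1 t0; have h4 := dV1 t0.
  have h5 := dU2 t0; have h6 := dV2 t0.
  have : exists d, is_derive t (1 : R) A2 d by rewrite /A2; eexists; isd.
  by move=> [d]; exact: isd_continuous.
have bA : poly_bounded A by exact: poly_boundedM.
have bA1 : poly_bounded A1.
  apply: poly_boundedD; first exact: poly_boundedM.
  apply: poly_boundedN; apply: poly_boundedM => //; apply: poly_boundedM => //.
  exact: poly_boundedX.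
have b2 : poly_bounded (fun=> 2 : R) by apply: (@poly_bounded_cst _ _ 2) => t _; rewrite ger0_norm.
have bA2 : poly_bounded A2.
  have bWX n : poly_bounded (fun t => W t ^+ n) by exact: poly_boundedX.
  apply: poly_boundedD; [apply: poly_boundedD; [apply: poly_boundedD|]|].
  - exact: poly_boundedM.
  - by apply: poly_boundedN; apply: poly_boundedM; exact: poly_boundedM.
  - by apply: poly_boundedN; apply: poly_boundedM => //; exact: poly_boundedM.
  - apply: poly_boundedM; first exact: poly_boundedM.
    by apply: poly_boundedM => //; exact: poly_boundedX.
have [C C0 hC] : exists2 C, 0 <= C & forall t : R, 0 <= t ->
    [/\ `|A t| <= C * expR (2^-1 * t), `|A1 t| <= C * expR (2^-1 * t) &
        `|A2 t| <= C * expR (2^-1 * t)].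
  have h2 : 0 < 2^-1 :> R by [].
  have [Ca Ca0 ha] := poly_bounded_expN h2 bA.
  have [Cb Cb0 hb] := poly_bounded_expN h2 bA1.
  have [Cc Cc0 hc] := poly_bounded_expN h2 bA2.
  exists (Ca + Cb + Cc) => [|t t0]; first by rewrite !addr_ge0.
  by split; [apply: le_trans (ha t t0) _|apply: le_trans (hb t t0) _|apply: le_trans (hc t t0) _];
    rewrite ler_wpM2r ?expR_ge0//; lra.
(* The factor 4 is the sum of the absolute coefficients in [A2 - 2 A1 + A]. *)
exists (fun t => expR (- t) * A t), (fun t => expR (- t) * (A1 t - A t)),
  (fun t => expR (- t) * (A2 t - 2 * A1 t + A t)), (4 * C).
split; first by [].
split; first by move=> t t0; have h1 := dA t t0; isderive; ring.
split; first by move=> t t0; have h1 := dA t t0; have h2 := dA1 t t0; isderive; ring.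
split.
  move=> t t0; apply: cvgM.
    have : is_derive t (1 : R) (fun t : R => expR (- t)) (expR (- t) * - 1) by isderive.
    exact: isd_continuous.
  apply: cvgD; last exact: isd_continuous (dA t t0).
  apply: cvgB; first exact: cA2.
  by apply: cvgMr; exact: isd_continuous (dA1 t t0).
move=> t t0; have [h0 h1 h2] := hC t t0.
have eE : expR (- (2^-1 * t)) = expR (- t) * expR (2^-1 * t).
  by rewrite -expRD; congr expR; field.
have key x : `|x| <= 4 * (C * expR (2^-1 * t)) ->
    `|expR (- t) * x| <= 4 * C * expR (- (2^-1 * t)).
  move=> hx; rewrite normrM ger0_norm ?expR_ge0// eE mulrCA ler_wpM2l ?expR_ge0//.
  by rewrite -mulrA.
have nn := mulr_ge0 C0 (expR_ge0 (2^-1 * t)).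
split; apply: key; first lra.
  by rewrite (le_trans (ler_normB _ _))//; lra.
rewrite (le_trans (ler_normD _ _))// (le_trans (lerD (ler_normB _ _) (lexx _)))//.
by rewrite normrM ger0_norm//; lra.
Qed.

End Quotient.

(** * Regularity of eigenfunctions *)

Section EigenRegularity.
Context {R : realType}.
Local Notation mu := (@lebesgue_measure R).

(** After cancellation the claim is [t <= (1 - e^-t) (1 + t)], that is, [(1 + t) e^-t <= 1]. It
    serves as an upper bound for the reciprocal of the density. *)
Lemma mhat_density_ge (t : R) : 0 < t -> 1 <= mhat_density t * ((1 + t) * ln 2 * expR t).
Proof.
move=> t0; have l2 : 0 < ln 2 :> R by rewrite ln_gt0// ltr1n.
have e1 : 1 + t <= expR t by exact: expR_ge1Dx.
have et : expR t != 0 by rewrite gt_eqF// expR_gt0.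
have -> : mhat_density t * ((1 + t) * ln 2 * expR t) = (1 - expR (- t)) * (1 + t) / t.
  by rewrite /mhat_density expRN; field; rewrite et !gt_eqF.
rewrite ler_pdivlMr// mul1r.
have : (1 + t) * expR (- t) <= 1 by rewrite expRN ler_pdivrMr ?expR_gt0// mul1r.
by lra.
Qed.

Lemma mhat_density_gt0 (t : R) : 0 < t -> 0 < mhat_density t.
Proof.
move=> t0; rewrite lt_neqAle mhat_density_ge0// andbT eq_sym; apply/eqP => h.
by have := mhat_density_ge t0; rewrite h mul0r ler10.
Qed.

(** A pointwise Cauchy-Schwarz: with [r] the density, [|psi| y <= r psi^2 + y^2 / r] for
    [y = e^(- p t)]. As [1 / r <= (1 + t) ln 2 e^t], the last term is integrable exactly because
    [2 p - 1 > 0]. *)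
Lemma intR_L2mhat (psi : R -> R) (p : R) : 2^-1 < p -> measurable_fun Rpos psi ->
  intR (fun t => psi t ^+ 2 * mhat_density t) -> intR (fun t => expR (- (p * t)) * psi t).
Proof.
move=> p2 mpsi ipsi.
have p1 : 0 < 2 * p - 1 by lra.
have l2 : 0 < ln 2 :> R by rewrite ln_gt0// ltr1n.
have i2 : intR (fun t => ln 2 * (expR (- ((2 * p - 1) * t)) + t ^+ 1 * expR (- ((2 * p - 1) * t)))).
  by apply: intRZ; apply: intRD; [exact: intR_expN|exact: intR_polyexpN].
apply: le_intR (intRD ipsi i2).
  apply: measurable_funM => //; apply: measurable_funTS; apply: measurableT_comp => //.
  by apply: measurable_funN; exact: measurable_funM.
move=> t t0; rewrite normrM (ger0_norm (expR_ge0 _)).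
have -> : ln 2 * (expR (- ((2 * p - 1) * t)) + t ^+ 1 * expR (- ((2 * p - 1) * t)))
    = expR (- (p * t)) ^+ 2 * ((1 + t) * ln 2 * expR t).
  have -> : expR (- ((2 * p - 1) * t)) = expR (- (p * t)) ^+ 2 * expR t.
    by rewrite -expRM_natl -expRD; congr expR; ring.
  by rewrite expr1; ring.
rewrite -(@real_normK _ (psi t)) ?num_real//.
have h1 := mhat_density_ge t0; have h0 := mhat_density_gt0 t0.
set r := mhat_density t in h1 h0 *; set k := (1 + t) * _ * _ in h1 *.
set x := `|psi t|; set y := expR _.
rewrite -(ler_pM2l h0) -subr_ge0.
have -> : r * (x ^+ 2 * r + y ^+ 2 * k) - r * (y * x) =
  (r * x - y / 2) ^+ 2 + y ^+ 2 * (r * k - 4^-1) by field.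
by rewrite addr_ge0 ?sqr_ge0// mulr_ge0 ?sqr_ge0// subr_ge0 (le_trans _ h1)// invf_le1//; lra.
Qed.

Lemma intR_exp_moment (k : nat) (psi : R -> R) : measurable_fun [set: R] psi ->
  intR (fun t => psi t ^+ 2 * mhat_density t) ->
  intR (fun s => s ^+ k * (expR (4^-1 * s) * (expR (- s) * psi s))).
Proof.
move=> mpsi ipsi.
(* The exponents add up as [1/4 - 1 = - 1/8 - 5/8]: the share [1/8] absorbs [s^k], and [5/8] is
   still above the threshold [1/2] of [intR_L2mhat]. *)
have p58 : 2^-1 < 5 / 8 :> R by lra.
have := intR_norm (intR_L2mhat p58 (measurable_funTS mpsi) ipsi).
move=> /(intRZ (k`!%:R * 8^-1 ^- k)); apply: le_intR.
  apply: measurable_funTS; apply: measurable_funM; first exact: measurable_funX.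
  apply: measurable_funM; first by apply: measurableT_comp => //; exact: measurable_funM.
  by apply: measurable_funM => //; apply: measurableT_comp => //; exact: measurable_funN.
move=> t t0; rewrite !normrM (ger0_norm (exprn_ge0 _ (ltW t0))) !(ger0_norm (expR_ge0 _)).
rewrite !mulrA ler_wpM2r//.
have -> : t ^+ k * expR (4^-1 * t) * expR (- t) =
    (t ^+ k * expR (- (8^-1 * t))) * expR (- (5 / 8 * t)).
  by rewrite -!mulrA -!expRD; congr (_ * expR _); field.
by rewrite ler_wpM2r ?expR_ge0// polyexpN_le// ltW.
Qed.

Variables (l : R) (psi : R -> R).
Hypothesis l0 : l != 0.
Hypothesis mpsi : measurable_fun [set: R] psi.
Hypothesis ipsi : intR (fun t => psi t ^+ 2 * mhat_density t).
Let g s := expR (- s) * psi s.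
Hypothesis eqn : {ae mu, forall t, Rpos t -> (l - expR (- t)) * psi t = hankel g t}.

Let mg : measurable_fun [set: R] g.
Proof.
by apply: measurable_funM => //; apply: measurableT_comp => //; exact: measurable_funN.
Qed.

Let ig k := intR_exp_moment k mpsi ipsi.

(** The successive derivatives of the numerator [H g]; [v] below plays the same part for the
    denominator [l - e^-t]. Both have the form that the section on Hadamard division expects. *)
Let u (k : nat) : R -> R :=
  if k is k'.+1 then (fun t => (-1) ^+ k' * bclif_int k' k' g t) else hankel g.

Let du k (t : R) : - 4^-1 < t -> is_derive t (1 : R) (u k) (u k.+1 t).
Proof.
move=> t4; case: k => [|k] /=.
  by rewrite expr0 mul1r; exact: isd_hankel.
have h := isd_bclif_int mg ig k k t4.
by isderive; rewrite exprS; ring.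
Qed.

Let ub k : exists M, forall t, 0 <= t -> `|u k.+1 t| <= M.
Proof.
eexists => t t0; rewrite /= normrM normrX normrN1 expr1n mul1r.
exact: (norm_bclif_int_le k (measurable_funTS mg) t0 (intR_moment mg ig k)).
Qed.

Let v (k : nat) : R -> R :=
  if k is k'.+1 then (fun t => (-1) ^+ k' * expR (- t)) else (fun t => l - expR (- t)).

Let dv k (t : R) : is_derive t (1 : R) (v k) (v k.+1 t).
Proof.
case: k => [|k] /=; first by rewrite expr0 mul1r; isderive; ring.
by isderive; rewrite exprS; ring.
Qed.

Let vb k t : 0 <= t -> `|v k.+1 t| <= 1.
Proof.
move=> t0 /=; rewrite normrM normrX normrN1 expr1n mul1r ger0_norm ?expR_ge0//.
by rewrite expR_le1 oppr_le0.
Qed.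

(* Otherwise [psi] would have a nonintegrable singularity at the zero of
   [l - expR (- t)]. *)
Let u_zero t0 : 0 <= t0 -> l = expR (- t0) -> u 0 t0 = 0.
Proof.
(* At [t0 = 0] the factor [t] of the kernel gives the zero at once; only [t0 > 0] needs the
   integrability of [psi]. *)
rewrite le_eqVlt => /predU1P[<- _|t0_gt0 lE]; first by rewrite /= /hankel mul0r.
apply: contrapT => /eqP u0.
have cu : {for t0, continuous (u 0)}.
  by apply: isd_continuous (du 0 _); rewrite (lt_trans _ t0_gt0)// oppr_lt0.
have u2 : 0 < `|u 0 t0| / 2 by rewrite divr_gt0 ?normr_gt0.
have [d /= d0 hd] : \forall t \near t0, `|u 0 t0| / 2 <= `|u 0 t|.
  have /cvgrPdist_le /(_ _ u2) := cu; apply: filterS => t ht.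
  by have := ler_normD (u 0 t0 - u 0 t) (u 0 t); rewrite subrK; lra.
(* A lower bound of the density on [(t0, t0 + 1)], obtained from [mhat_density_ge] at the right
   end. *)
pose rho : R := expR (- (t0 + 1)) / ((t0 + 2) * ln 2).
have l2 : 0 < ln 2 :> R by rewrite ln_gt0// ltr1n.
have rho0 : 0 < rho by rewrite divr_gt0 ?expR_gt0// mulr_gt0// addr_gt0.
have rho_le t : t0 < t -> t < t0 + 1 -> rho <= mhat_density t.
  move=> t0t tt0; have t_gt0 : 0 < t by exact: lt_trans t0t.
  have h := mhat_density_ge t_gt0.
  apply: (@le_trans _ _ ((1 + t) * ln 2 * expR t)^-1); last first.
    by rewrite -div1r ler_pdivrMr// !mulr_gt0 ?expR_gt0// addr_gt0.
  rewrite invfM -expRN mulrC ler_pM ?expR_ge0 ?invr_ge0 ?mulr_ge0 ?(ltW l2)//.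
  - by rewrite addr_ge0// ltW.
  - by rewrite ler_expR; lra.
  - rewrite lef_pV2 ?posrE ?mulr_gt0 ?addr_gt0// ler_pM2r//; lra.
(* On [(t0, t0 + e)] one has [|l - e^-t| <= t - t0 < e], because [l <= 1]; so [|psi| >= c / e]
   there, and the integral of [psi^2] is at least [(c / e)^2 * rho * e]. This cannot stay below a
   fixed bound as [e] shrinks. *)
have [e_ bnd] : exists K : R, forall e, 0 < e -> e < d -> e < 1 ->
    (`|u 0 t0| / 2) ^+ 2 * rho <= K * e.
  exists (\int[mu]_(t in Rpos) (psi t ^+ 2 * mhat_density t)) => e e0 ed e1.
  set c := `|u 0 t0| / 2.
  pose I : set R := `]t0, (t0 + e)[%classic.
  have mI : measurable (I : set (measurableTypeR R)) by exact: measurable_itv.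
  have sI : I `<=` @Rpos R.
    by move=> t; rewrite /I /= in_itv/= => /andP[t0t _]; apply: gt0_Rpos; exact: lt_trans t0t.
  have h1 : (\int[mu]_(t in I) ((c / e) ^+ 2 * rho)%:E <=
      \int[mu]_(t in Rpos) (psi t ^+ 2 * mhat_density t)%:E)%E.
    apply: (@le_trans _ _ (\int[mu]_(t in I) (psi t ^+ 2 * mhat_density t)%:E)%E).
      apply: ae_ge0_le_integral => //.
      - by move=> t _; rewrite lee_fin mulr_ge0 ?sqr_ge0// ltW.
      - move=> t /sI/Rpos_gt0 t_gt0.
        by rewrite lee_fin mulr_ge0 ?sqr_ge0// mhat_density_ge0.
      - apply: measurable_funS (measurable_int _ ipsi) => //.
      move: eqn; apply: ae_imp => t ht tI; have tR := sI _ tI; have t_gt0 := Rpos_gt0 tR.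
      move: tI; rewrite /I /= in_itv/= => /andP[t0t tt0].
      rewrite lee_fin ler_pM ?sqr_ge0 ?(ltW rho0)//; last first.
        by apply: rho_le => //; apply: lt_trans tt0 _; rewrite ltrD2l.
      have hu : c <= `|u 0 t|.
        by apply: hd => /=; rewrite ltr0_norm ?subr_lt0// opprB ltrBlDl (lt_trans tt0)// ltrD2l.
      rewrite -(@real_normK _ (psi t)) ?num_real// lerXn2r ?nnegrE ?divr_ge0 ?(ltW u2) ?(ltW e0)//.
      rewrite ler_pdivrMr// (le_trans hu)// /u -ht// normrM mulrC ler_wpM2l//.
      have -> : l - expR (- t) = l * (1 - expR (- (t - t0))).
        by rewrite lE mulrBr mulr1 -expRD; congr (_ - expR _); ring.
      have x1 : 1 - (t - t0) <= expR (- (t - t0)) by exact: expR_ge1Dx.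
      have x2 : expR (- (t - t0)) <= 1 by rewrite expR_le1 oppr_le0 subr_ge0 ltW.
      have l1 : l <= 1 by rewrite lE expR_le1 oppr_le0 ltW.
      have lp : 0 <= l by rewrite lE expR_ge0.
      rewrite normrM !ger0_norm ?subr_ge0//.
      by rewrite (le_trans (ler_pM _ _ l1 (lexx _))) ?subr_ge0// mul1r; lra.
    apply: ge0_subset_integral => //; first exact: (measurable_int _ ipsi).
    by move=> t /Rpos_gt0 t_gt0; rewrite lee_fin mulr_ge0 ?sqr_ge0// mhat_density_ge0.
  move: h1; rewrite integral_cst//= lebesgue_measure_itv/= lte_fin ltrDl e0.
  rewrite -EFinD addrAC subrr add0r -EFinM -(fineK (integrable_fin_num mRpos ipsi)) lee_fin => h1.
  rewrite -ler_pdivrMr// (le_trans _ h1)//.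
  have en : e != 0 by rewrite gt_eqF.
  by rewrite le_eqVlt; apply/orP; left; apply/eqP; rewrite -/c; field.
pose K := `|e_| + 1.
pose a := (`|u 0 t0| / 2) ^+ 2 * rho.
have a0 : 0 < a by rewrite mulr_gt0// exprn_gt0.
have K0 : 0 < K by rewrite ltr_wpDl.
pose e := Num.min (Num.min (d / 2) 2^-1) (a / (2 * K)).
have e0 : 0 < e.
  rewrite !lt_min; apply/andP; split; last by rewrite divr_gt0// mulr_gt0.
  by apply/andP; split; lra.
have ed : e < d by rewrite !gt_min; apply/orP; left; apply/orP; left; lra.
have e1 : e < 1 by rewrite !gt_min; apply/orP; left; apply/orP; right; lra.
have ea : e <= a / (2 * K) by rewrite ge_min lexx orbT.
have := bnd e e0 ed e1; rewrite -/a leNgt => /negP; apply.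
apply: (@le_lt_trans _ _ (K * e)).
  by rewrite ler_wpM2r ?(ltW e0)// (le_trans (ler_norm _))// lerDl.
have : K * e <= K * (a / (2 * K)) by rewrite ler_wpM2l// ltW.
have -> : K * (a / (2 * K)) = a / 2 by field; rewrite gt_eqF.
by lra.
Qed.

(** [G] is [e^-t] times the quotient of [H g] by [l - e^-t]. The denominator vanishes on the
    half-line at most at [t0 = - ln l], and only if [0 < l <= 1]; then both sides are first divided
    by [t - t0]. Otherwise the denominator is bounded away from 0. *)
Lemma eigen_smooth : exists (G G1 G2 : R -> R) (C : R),
  {ae mu, forall t, Rpos t -> psi t = expR t * G t} /\
  (forall t : R, 0 <= t -> is_derive t (1 : R) G (G1 t)) /\
  (forall t : R, 0 <= t -> is_derive t (1 : R) G1 (G2 t)) /\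
  (forall t : R, 0 <= t -> {for t, continuous G2}) /\
  (forall t : R, 0 <= t -> [/\ `|G t| <= C * expR (- (2^-1 * t)),
    `|G1 t| <= C * expR (- (2^-1 * t)) & `|G2 t| <= C * expR (- (2^-1 * t))]).
Proof.
have lt4 (t : R) : 0 <= t -> - 4^-1 < t by move=> t0; rewrite (lt_le_trans _ t0)// oppr_lt0.
(* The common end of both cases: [U1 / V1] is any representation of the quotient, valid off a null
   set [N]. *)
have conclude (U1 V1 : R -> R) (N : set R) (G : R -> R) : mu N = 0%E ->
    measurable (N : set (measurableTypeR R)) ->
    (forall t, 0 < t -> V1 t != 0) ->
    (forall t, 0 < t -> ~ N t -> (l - expR (- t)) * U1 t = V1 t * hankel g t) ->
    (forall t, 0 < t -> ~ N t -> l - expR (- t) != 0) ->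
    (forall t, 0 <= t -> G t = expR (- t) * (U1 t / V1 t)) ->
    {ae mu, forall t, Rpos t -> psi t = expR t * G t}.
  move=> N0 mN V0 UV v0 GE.
  have aN : {ae mu, forall t, ~ N t} by exists N; split => // t /contrapT.
  apply: ae_imp2 aN eqn => t tN ht tR; have t0 := Rpos_gt0 tR.
  have vt := v0 _ t0 tN; apply: (mulfI vt).
  have e1 : expR t * expR (- t) = 1 by rewrite -expRD subrr expR0.
  rewrite ht// GE ?(ltW t0)// [expR t * _]mulrA e1 mul1r mulrA UV//.
  by rewrite mulrAC divff ?mul1r// V0.
have [/andP[l_gt0 l_le1]|lN] := boolP (0 < l <= 1).
  pose t0 := - ln l.
  have lE : l = expR (- t0) by rewrite opprK lnK.
  have t0_ge0 : 0 <= t0 by rewrite oppr_ge0 ln_le0.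
  have u0 := u_zero t0_ge0 lE.
  have v0 : v 0 t0 = 0 by rewrite /= -lE subrr.
  have e4 : 0 < 4^-1 :> R by rewrite invr_gt0.
  have du' k (t : R) : - 4^-1 < t -> is_derive t (1 : R) (u k) (u k.+1 t) by exact: du.
  have dv' k (t : R) : - 4^-1 < t -> is_derive t (1 : R) (v k) (v k.+1 t) by move=> _; exact: dv.
  have dU k := @isd_hadamard R u 4^-1 t0 e4 t0_ge0 du' k.
  have dV k := @isd_hadamard R v 4^-1 t0 e4 t0_ge0 dv' k.
  have fU := @hadamard_factor R u 4^-1 t0 e4 t0_ge0 du'.
  have fV := @hadamard_factor R v 4^-1 t0 e4 t0_ge0 dv'.
  (* Since [v 0 t = l (1 - e^(-(t - t0)))], the divided denominator is at least [l / (1 + t)]; so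
     its inverse grows at most linearly, as [smooth_quotient] requires. *)
  have V_ge (t : R) : 0 <= t -> l / (1 + t) <= hadamard v t0 0 t.
    move=> t_ge0; have h := fV t v0 t_ge0.
    have hE : v 0 t = l * (1 - expR (- (t - t0))).
      by rewrite /= mulrBr mulr1 {3}lE -expRD; congr (_ - expR _); ring.
    rewrite hE in h.
    have t1 : 0 < 1 + t by rewrite ltr_pwDl.
    have [tt0|tt0|tt0] := ltgtP t t0.
    - have x0 : t - t0 < 0 by rewrite subr_lt0.
      apply: (@le_trans _ _ l); first by rewrite ler_pdivrMr// ler_peMr ?lerDl// ltW.
      rewrite -(ler_nM2l x0) -h [leRHS]mulrC ler_pM2l//.
      by have := expR_ge1Dx (- (t - t0)); lra.
    - have x0 : 0 < t - t0 by rewrite subr_gt0.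
      rewrite -(ler_pM2l x0) -h mulrCA ler_pM2l// ler_pdivrMr//.
      have e1 : expR (- (t - t0)) * (1 + (t - t0)) <= 1.
        by rewrite expRN mulrC ler_pdivrMr ?expR_gt0// mul1r expR_ge1Dx.
      have e2 : 0 <= t0 * (1 - expR (- (t - t0))).
        by rewrite mulr_ge0// subr_ge0 expR_le1 oppr_le0 ltW.
      by lra.
    (* At [t = t0] the factorization says nothing, but the integrand is the constant
       [v 1 t0 = l]. *)
    - rewrite /hadamard tt0; under eq_Rintegral do rewrite subrr mulr0 addr0 expr0 mul1r /= mul1r -lE.
      rewrite Rintegral_cst//= lebesgue_measure_itv/= lte_fin ltr01 oppr0 adde0 mulr1.
      by rewrite ler_pdivrMr -?tt0// ler_peMr ?lerDl// ltW.
  have V_gt0 (t : R) : 0 <= t -> 0 < hadamard v t0 0 t.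
    move=> t_ge0; apply: lt_le_trans (V_ge t t_ge0).
    by rewrite divr_gt0// ltr_pwDl.
  have bU k : poly_bounded (hadamard u t0 k).
    have [M hM] := ub k; apply: (@poly_bounded_cst _ _ M) => t.
    exact: (norm_hadamard_le e4 t0_ge0 du' hM).
  have bV k : poly_bounded (hadamard v t0 k).
    apply: (@poly_bounded_cst _ _ 1) => t.
    exact: (norm_hadamard_le e4 t0_ge0 dv' (vb k)).
  have bW : poly_bounded (fun t => (hadamard v t0 0 t)^-1).
    exists l^-1, 1%N => t t_ge0; rewrite expr1 ger0_norm ?invr_ge0 ?(ltW (V_gt0 t t_ge0))//.
    have t1 : 0 < 1 + t by rewrite ltr_pwDl.
    rewrite -[leRHS]invrK invfM invrK lef_pV2 ?posrE ?V_gt0 ?divr_gt0//.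
    exact: V_ge.
  have [G [G1 [G2 [C [GE [h1 [h2 [h3 h4]]]]]]]] := smooth_quotient (dU 0%N) (dU 1%N) (dU 2%N)
    (dV 0%N) (dV 1%N) (dV 2%N) (fun t t_ge0 => lt0r_neq0 (V_gt0 t t_ge0)) (bU 0%N) (bU 1%N) (bU 2%N)
    (bV 1%N) (bV 2%N) bW.
  exists G, G1, G2, C; split => //.
  apply: (conclude _ _ [set t0] _ _ _ _ _ _ GE) => //.
  - exact: lebesgue_measure_set1.
  - by move=> t /ltW/V_gt0/lt0r_neq0.
  - move=> t /ltW t_ge0 _; rewrite -[l - _]/(v 0 t) -[hankel g t]/(u 0 t).
    by rewrite fU// fV//; ring.
  - move=> t t_gt0 tN; rewrite subr_eq0 lE; apply/eqP => /expR_inj/oppr_inj h.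
    by apply: tN; rewrite /= h.
(* Here [l] lies outside [(0, 1]], the range of [e^-t] on the half-line, and [d] is its distance
   from that interval. *)
have [d d0 hd] : exists2 d, 0 < d & forall t, 0 <= t -> d <= `|v 0 t|.
  have eb (t : R) : 0 <= t -> 0 < expR (- t) <= 1.
    by move=> t0; rewrite expR_gt0 expR_le1 oppr_le0.
  have [l_le0|l_gt0] := leP l 0.
    exists (- l); first by rewrite oppr_gt0 lt_neqAle l0.
    move=> t /eb /andP[e1 e2]; rewrite /= ler0_norm; lra.
  have l1 : 1 < l by move: lN; rewrite l_gt0 /= -ltNge.
  exists (l - 1); first by rewrite subr_gt0.
  by move=> t /eb /andP[e1 e2]; rewrite /= ger0_norm; lra.
have v_neq0 (t : R) : 0 <= t -> v 0 t != 0.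
  by move=> t_ge0; rewrite -normr_gt0 (lt_le_trans d0)// hd.
have bu k : poly_bounded (u k).
  case: k => [|k]; last by have [M hM] := ub k; exact: poly_bounded_cst hM.
  exists (\int[mu]_(s in Rpos) `|g s|), 1%N => t t_ge0.
  have ig0 : intR g by apply: eq_intR (intR_moment mg ig 0) => s _; rewrite mul1r.
  rewrite (le_trans (norm_hankel_le (measurable_funTS mg) ig0 t_ge0))// expr1 mulrC.
  by rewrite ler_wpM2l ?lerDr// Rintegral_ge0.
have bv k : poly_bounded (v k.+1) by exact: poly_bounded_cst (vb k).
have bW : poly_bounded (fun t => (v 0 t)^-1).
  apply: (@poly_bounded_cst _ _ d^-1) => t t_ge0; rewrite normfV lef_pV2 ?posrE ?hd//.
  by rewrite (lt_le_trans d0)// hd.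
have [G [G1 [G2 [C [GE [h1 [h2 [h3 h4]]]]]]]] := smooth_quotient
  (fun t t_ge0 => du 0 (lt4 t t_ge0)) (fun t t_ge0 => du 1 (lt4 t t_ge0))
  (fun t t_ge0 => du 2 (lt4 t t_ge0)) (fun t _ => dv 0 t) (fun t _ => dv 1 t)
  (fun t _ => dv 2 t) v_neq0 (bu 0%N) (bu 1%N) (bu 2%N) (bv 0%N) (bv 1%N) bW.
exists G, G1, G2, C; split => //.
apply: (conclude _ _ set0 _ _ _ _ _ _ GE) => //.
- by move=> t /ltW/v_neq0.
- by move=> t /ltW t_ge0 _; exact: v_neq0.
Qed.

End EigenRegularity.

(** * Decay of the Hankel kernel *)

Section Omega.
Context {R : realType}.
Local Notation mu := (@lebesgue_measure R).

(* The decay rate [(1 + s) `^ (- 3 / 4)] of [bclif 1 s]. *)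
Definition omega (s : R) : R := Num.sqrt ((1 + s) * Num.sqrt (1 + s))^-1.

Lemma omega_ge0 s : 0 <= omega s. Proof. exact: sqrtr_ge0. Qed.

Lemma sqr_omega s : 0 <= s -> omega s ^+ 2 = ((1 + s) * Num.sqrt (1 + s))^-1.
Proof. by move=> s0; rewrite sqr_sqrtr// invr_ge0 mulr_ge0 ?addr_ge0. Qed.

Lemma omega_le1 s : 0 <= s -> omega s <= 1.
Proof.
move=> s0; rewrite -[leRHS]sqrtr1 ler_wsqrtr// invf_le1.
  by rewrite mulr_ege1 ?lerDl// -[leLHS]sqrtr1 ler_wsqrtr// lerDl.
by rewrite mulr_gt0 ?sqrtr_gt0 ?ltr_wpDr.
Qed.

Let sqrt1D_cvgy : Num.sqrt (1 + s) @[s --> +oo] --> (+oo : set_system R).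
Proof.
apply/cvgryPge => A; near=> s.
rewrite (le_trans (ler_norm A))// -sqrtr_sqr ler_wsqrtr//.
by rewrite -lerBlDl; near: s; apply: nbhs_pinfty_ge; exact: num_real.
Unshelve. all: by end_near. Qed.

Let isd_omega2 (s : R) : 0 <= s ->
  is_derive s (1 : R) (fun s => - (2 * (Num.sqrt (1 + s))^-1)) (omega s ^+ 2).
Proof.
move=> s0; have s1 : 0 < 1 + s by rewrite ltr_wpDr.
have q0 : 0 < Num.sqrt (1 + s) by rewrite sqrtr_gt0.
have h := isd_sqrt s1; isderive; first by rewrite gt_eqF.
have := sqr_sqrtr (ltW s1); rewrite sqr_omega//.
by set q := Num.sqrt _ in q0 *; move=> <-; field; rewrite gt_eqF.
Qed.

Lemma intR_omega2 : intR (fun s => omega s ^+ 2).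
Proof.
have co (s : R) : 0 <= s -> {for s, continuous (fun s => omega s ^+ 2)}.
  move=> s0; apply: (@continuous_comp _ _ _ omega (fun x => x ^+ 2)); last exact: exprn_continuous.
  apply: continuous_comp; last exact: sqrt_continuous.
  have s1 : 0 < 1 + s by rewrite ltr_wpDr.
  apply: cvgV; first by rewrite mulf_neq0 ?gt_eqF ?sqrtr_gt0.
  have c1 : {for s, continuous (fun s : R => 1 + s)}.
    by apply: cvgD; [exact: cvg_cst|exact: cvg_id].
  apply: cvgM; first exact: c1.
  apply: (@continuous_comp _ _ _ (fun s : R => 1 + s) Num.sqrt); first exact: c1.
  exact: sqrt_continuous.
have mo : measurable_fun Rpos (fun s => omega s ^+ 2).
  by apply: cont_measurable => s /ltW; exact: co.
apply/integrableP; split; first exact/measurable_EFinP.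
under eq_integral => s _ do rewrite /= ger0_norm ?sqr_ge0//.
rewrite /Rpos integral_itv_obnd_cbnd//; last exact/measurable_EFinP.
rewrite (@ge0_continuous_FTC2y _ _ (fun s => - (2 * (Num.sqrt (1 + s))^-1)) 0 0).
- by rewrite -EFinB ltey.
- by move=> s _; exact: sqr_ge0.
- apply: continuous_in_subspaceT => s /[!inE]/= /[!in_itv]/= /andP[s0 _].
  exact: co.
- rewrite -oppr0; apply: cvgN; rewrite -(mulr0 2); apply: cvgMr.
  apply/gtr0_cvgV0; last exact: sqrt1D_cvgy.
  by near=> s; rewrite sqrtr_gt0 ltr_wpDr//; near: s; apply: nbhs_pinfty_ge; exact: num_real.
- by move=> s /ltW s0; exact: (@ex_derive _ _ _ _ _ _ _ (isd_omega2 s0)).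
- by apply: cvg_at_right_filter; exact: isd_continuous (isd_omega2 (lexx 0)).
- move=> s /[!in_itv]/= /andP[/ltW s0 _].
  by rewrite derive1E (@derive_val _ _ _ _ _ _ _ (isd_omega2 s0)).
Unshelve. all: by end_near. Qed.

Lemma measurable_omega : measurable_fun Rpos omega.
Proof.
apply: cont_measurable => s s0; apply: continuous_comp; last exact: sqrt_continuous.
have s1 : 0 < 1 + s by rewrite addr_gt0.
apply: cvgV; first by rewrite mulf_neq0 ?gt_eqF ?sqrtr_gt0.
have c1 : {for s, continuous (fun s : R => 1 + s)}.
  by apply: cvgD; [exact: cvg_cst|exact: cvg_id].
apply: cvgM; first exact: c1.
apply: (@continuous_comp _ _ _ (fun s : R => 1 + s) Num.sqrt); first exact: c1.
exact: sqrt_continuous.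
Qed.

(** Squaring and [1 + s/2 <= e^(s/2)] reduce this to [(1 + s) * sqrt (1 + s) <= (2 + s)^2]. *)
Lemma expN_le_omega (s : R) : 0 <= s -> expR (- (2^-1 * s)) <= 2 * omega s.
Proof.
move=> s0; have s1 : 1 <= 1 + s by rewrite lerDl.
have s1' : 0 < 1 + s by rewrite (lt_le_trans _ s1).
have q1 : 1 <= Num.sqrt (1 + s) by rewrite -[leLHS]sqrtr1 ler_wsqrtr.
rewrite -(@ler_pXn2r _ 2) ?nnegrE ?expR_ge0 ?mulr_ge0 ?omega_ge0//.
rewrite exprMn sqr_omega// expRN exprVn ler_pdivlMr ?mulr_gt0 ?sqrtr_gt0//.
rewrite mulrC ler_pdivrMr ?exprn_gt0 ?expR_gt0//.
have h : (1 + 2^-1 * s) ^+ 2 <= expR (2^-1 * s) ^+ 2.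
  by rewrite lerXn2r ?nnegrE ?expR_ge0 ?expR_ge1Dx// addr_ge0// mulr_ge0.
apply: le_trans (ler_wpM2l _ h); last by rewrite exprn_ge0.
have q2 : Num.sqrt (1 + s) <= 1 + s.
  rewrite -[leRHS](@ger0_norm _ (1 + s)) ?(ltW s1')// -sqrtr_sqr ler_wsqrtr// expr2.
  by rewrite ler_peMl// ltW.
apply: (@le_trans _ _ ((1 + s) * (1 + s))); first by rewrite ler_wpM2l// ltW.
nra.
Qed.

Lemma norm_bclif1_omega : exists2 K : R, 0 < K & forall z, 0 <= z -> `|bclif 1 z| <= K * omega z.
Proof.
have [C C0 hC] := @bclif01_decay R.
(* The 3 is [2 * (3/2)]: for [z > 1], [1 + z <= 2 z] and [sqrt (1 + z) <= 3/2 * sqrt z]; for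
   [z <= 1] the same numbers bound [1 + z] and [sqrt (1 + z)]. *)
pose K := Num.sqrt (3 * (1 + C)).
have K0 : 0 < K by rewrite sqrtr_gt0 mulr_gt0// addr_gt0.
have K2 : K ^+ 2 = 3 * (1 + C) by rewrite sqr_sqrtr// mulr_ge0// addr_ge0// ltW.
exists K => // z z0.
rewrite -(@ler_pXn2r _ 2) ?nnegrE ?mulr_ge0 ?omega_ge0 ?(ltW K0)//.
rewrite real_normK ?num_real// exprMn K2 sqr_omega//.
have z1 : 0 < 1 + z by rewrite ltr_wpDr.
have q0 : 0 < Num.sqrt (1 + z) by rewrite sqrtr_gt0.
rewrite ler_pdivlMr ?mulr_gt0//.
have E1 : bclif 1 z ^+ 2 <= 1.
  by rewrite -real_normK ?num_real// exprn_ile1// norm_bclif_le1.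
have [zle|zgt] := leP z 1.
  have q : Num.sqrt (1 + z) <= 3 / 2.
    rewrite -[leRHS](@ger0_norm _ (3 / 2))// -sqrtr_sqr ler_wsqrtr//; lra.
  apply: (@le_trans _ _ (1 * (2 * (3 / 2)))); last by lra.
  by rewrite ler_pM ?sqr_ge0 ?mulr_ge0 ?(ltW z1) ?(ltW q0)// ler_pM ?(ltW z1) ?(ltW q0)//; lra.
have z_gt0 : 0 < z by rewrite (lt_trans _ zgt).
have sz : 0 < Num.sqrt z by rewrite sqrtr_gt0.
have q : Num.sqrt (1 + z) <= 3 / 2 * Num.sqrt z.
  rewrite -{1}(@ger0_norm _ (3 / 2))// -sqrtr_sqr -sqrtrM ?sqr_ge0// ler_wsqrtr//; lra.
have := (hC z z_gt0).2; rewrite ler_pdivlMr ?mulr_gt0// => h.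
apply: (@le_trans _ _ (bclif 1 z ^+ 2 * ((2 * z) * (3 / 2 * Num.sqrt z)))).
  by rewrite ler_wpM2l ?sqr_ge0// ler_pM ?(ltW z1) ?(ltW q0)//; lra.
have -> : bclif 1 z ^+ 2 * ((2 * z) * (3 / 2 * Num.sqrt z)) =
  3 * (bclif 1 z ^+ 2 * (z * Num.sqrt z)) by field.
by lra.
Qed.

(** Separates the variables, so that kernel bounds take the product form required by Fubini. With
    [k = (1 + t) / t >= 1] one has [1 + s <= k (1 + s t)], and [k^(3/4) <= k]. *)
Lemma omegaM (s t : R) : 0 <= s -> 0 < t -> omega (s * t) <= omega s * ((1 + t) / t).
Proof.
move=> s0 t0; have st0 : 0 <= s * t by rewrite mulr_ge0// ltW.
have t1 : 0 < 1 + t by rewrite addr_gt0.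
have s1 : 0 < 1 + s by rewrite ltr_wpDr.
have st1 : 0 < 1 + s * t by rewrite ltr_wpDr.
have k0 : 0 < (1 + t) / t by rewrite divr_gt0.
have k1 : 1 <= (1 + t) / t by rewrite ler_pdivlMr// mul1r lerDr.
set k := (1 + t) / t in k0 k1 *.
have ks : 1 + s <= k * (1 + s * t).
  rewrite /k mulrAC ler_pdivlMr//; nra.
rewrite -(@ler_pXn2r _ 2) ?nnegrE ?omega_ge0//; last first.
  by rewrite mulr_ge0 ?omega_ge0// ltW.
rewrite exprMn !sqr_omega// [leRHS]mulrC ler_pdivlMr ?mulr_gt0 ?sqrtr_gt0//.
rewrite mulrC ler_pdivrMr ?mulr_gt0 ?sqrtr_gt0//.
have -> : k ^+ 2 * ((1 + s * t) * Num.sqrt (1 + s * t)) =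
  (k * (1 + s * t)) * (k * Num.sqrt (1 + s * t)) by ring.
apply: ler_pM => //; first exact: ltW.
apply: (@le_trans _ _ (Num.sqrt (k * (1 + s * t)))); first by rewrite ler_wsqrtr.
rewrite sqrtrM ?(ltW k0)// ler_wpM2r// -[leRHS](@ger0_norm _ k) ?(ltW k0)//.
by rewrite -sqrtr_sqr ler_wsqrtr// expr2 ler_peMl// ltW.
Qed.

Lemma bclif0_cvg0 (t : R) : 0 < t -> bclif 0 (A * t) @[A --> +oo] --> 0.
Proof.
move=> t0; have [C C0 hC] := @bclif01_decay R.
have e0 (e : R) : 0 < e -> exists M : R, forall z : R, M < z -> 0 < z -> `|bclif 0 z| <= e.
  move=> e0; exists ((C / e ^+ 2) ^+ 2) => z Mz z0.
  have sz : 0 < Num.sqrt z by rewrite sqrtr_gt0.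
  have e2 : 0 < e ^+ 2 by rewrite exprn_gt0.
  rewrite -(@ler_pXn2r _ 2) ?nnegrE ?(ltW e0)// real_normK ?num_real//.
  rewrite (le_trans (hC z z0).1)// ler_pdivrMr// mulrC -ler_pdivrMr//.
  rewrite -[leLHS](@ger0_norm _ (C / e ^+ 2)) ?divr_ge0 ?(ltW C0) ?(ltW e2)//.
  by rewrite -sqrtr_sqr ler_wsqrtr// ltW.
apply/cvgrPdist_le => e /e0 [M hM]; near=> A.
have A0 : 0 < A by near: A; apply: nbhs_pinfty_gt; exact: num_real.
rewrite sub0r normrN; apply: hM; last exact: mulr_gt0.
by rewrite -ltr_pdivrMr//; near: A; apply: nbhs_pinfty_gt; exact: num_real.
Unshelve. all: by end_near. Qed.

End Omega.

(** * Integrals with respect to a density *)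

Section DensityIntegral.
Context {R : realType}.
Local Notation mu := (@lebesgue_measure R).
Variables (nu : {measure set (measurableTypeR R) -> \bar R}) (w : R -> R).
Hypothesis w_ge0 : forall t, 0 < t -> 0 <= w t.
Hypothesis mw : measurable_fun Rpos w.
Hypothesis nuE : forall A, nu A = density_measure w A.
Import HBNNSimple.

(** [nuE] settles indicators; sums settle simple functions, and monotone convergence the rest. *)
Lemma ge0_integral_density (f : R -> R) : measurable_fun Rpos f ->
  (forall t, 0 < t -> 0 <= f t) ->
  (\int[nu]_(t in Rpos) (f t)%:E = \int[mu]_(t in Rpos) (f t * w t)%:E)%E.
Proof.
move=> mf f0; have mF : measurable_fun Rpos (EFin \o f) by exact/measurable_EFinP.
have F0 t : Rpos t -> (0 <= (EFin \o f) t)%E by move=> /Rpos_gt0 t0; rewrite /= lee_fin f0.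
pose h := nnsfun_approx mRpos mF.
have mh n : measurable_fun (Rpos : set (measurableTypeR R)) (h n).
  by apply: measurable_funTS; exact/measurable_funP.
have mind (A : set R) : measurable (A : set (measurableTypeR R)) ->
    measurable_fun Rpos (\1_A : R -> R).
  by move=> mA; apply: measurable_funTS; exact: measurable_indic.
have step n : (\int[nu]_(t in Rpos) (h n t)%:E = \int[mu]_(t in Rpos) (h n t * w t)%:E)%E.
  have hE t : h n t = \sum_(y \in range (h n)) (y * \1_(h n @^-1` [set y]) t).
    exact: fimfunE.
  have mhy y : measurable (h n @^-1` [set y] : set (measurableTypeR R)).
    by apply: measurable_sfunP; exact: measurable_set1.
  have h0 y t : 0 <= y * \1_(h n @^-1` [set y]) t by exact: nnfun_muleindic_ge0.
  transitivity (\sum_(y \in range (h n))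
      \int[nu]_(t in Rpos) (y * \1_(h n @^-1` [set y]) t)%:E)%E.
    rewrite -ge0_integral_fsum//.
    - by apply: eq_integral => t _; rewrite fsumEFin// -hE.
    - by move=> y; apply/measurable_EFinP; apply: measurable_funM => //; exact: (mind _ (mhy y)).
    - by move=> y t _; rewrite lee_fin.
  transitivity (\sum_(y \in range (h n))
      \int[mu]_(t in Rpos) (y * \1_(h n @^-1` [set y]) t * w t)%:E)%E; last first.
    rewrite -ge0_integral_fsum//.
    - by apply: eq_integral => t _; rewrite fsumEFin// -mulr_fsuml// -hE.
    - move=> y; apply/measurable_EFinP; apply: measurable_funM => //.
      by apply: measurable_funM => //; exact: (mind _ (mhy y)).
    - by move=> y t /Rpos_gt0 t0; rewrite lee_fin mulr_ge0// w_ge0.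
  apply: eq_fsbigr => y /set_mem [t0 _ <-]; set y0 := h n t0; set A := _ @^-1` _.
  have mA : measurable (A : set (measurableTypeR R)) by exact: mhy.
  have y0_ge0 : (0 <= y0%:E)%E by rewrite lee_fin.
  under eq_integral do rewrite EFinM.
  under [RHS]eq_integral do rewrite -mulrA EFinM.
  rewrite !ge0_integralZl//.
  - congr (_ * _)%E; rewrite integral_indic//.
    apply: etrans (nuE _) _; rewrite /density_measure.
    rewrite -setIA setIid setIC integral_mkcondr; apply: eq_integral => t tR.
    rewrite patchE; case: ifPn => tA; first by rewrite indicE tA mul1r.
    by rewrite indicE (negbTE tA) mul0r.
  - by apply/measurable_EFinP; apply: measurable_funM => //; exact: (mind _ mA).
  - by move=> t /Rpos_gt0 t_gt0; rewrite lee_fin mulr_ge0// ?w_ge0// indicE.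
  - by apply/measurable_EFinP; exact: (mind _ mA).
have hcvg t : Rpos t -> (h n t)%:E @[n --> \oo] --> (f t)%:E.
  by move=> tR; exact: (cvg_nnsfun_approx mRpos mF F0 tR).
have nd t : nondecreasing_seq (h ^~ t).
  by move=> a b ab; exact/lefP/nd_nnsfun_approx.
have c1 : (\int[nu]_(t in Rpos) (h n t)%:E @[n --> \oo] --> \int[nu]_(t in Rpos) (f t)%:E)%E.
  have -> : (\int[nu]_(t in Rpos) (f t)%:E = \int[nu]_(t in Rpos) limn (fun n => (h n t)%:E))%E.
    by apply: eq_integral => t /set_mem tR; apply/esym/cvg_lim => //; exact: hcvg.
  apply: cvg_monotone_convergence => //.
  - by move=> n; exact/measurable_EFinP.
  - by move=> n t _; rewrite lee_fin.
  - by move=> t _ a b ab; rewrite lee_fin nd.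
have c2 : (\int[mu]_(t in Rpos) (h n t * w t)%:E @[n --> \oo] -->
    \int[mu]_(t in Rpos) (f t * w t)%:E)%E.
  have -> : (\int[mu]_(t in Rpos) (f t * w t)%:E =
      \int[mu]_(t in Rpos) limn (fun n => (h n t * w t)%:E))%E.
    apply: eq_integral => t /set_mem tR; apply/esym/cvg_lim => //.
    by under eq_fun do rewrite EFinM; rewrite EFinM; apply: cvgeZr => //; exact: hcvg.
  apply: cvg_monotone_convergence => //.
  - by move=> n; apply/measurable_EFinP; exact: measurable_funM.
  - by move=> n t /Rpos_gt0 t0; rewrite lee_fin mulr_ge0// w_ge0.
  - by move=> t /Rpos_gt0 t0 a b ab; rewrite lee_fin ler_wpM2r ?w_ge0// nd.
apply: (cvg_unique _ c1) => //; apply: cvg_trans c2; apply: near_eq_cvg.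
by apply: nearW => n; rewrite step.
Qed.

Lemma Rintegral_density (f : R -> R) : measurable_fun Rpos f ->
  \int[nu]_(t in Rpos) f t = \int[mu]_(t in Rpos) (f t * w t).
Proof.
move=> mf; rewrite /Rintegral; congr fine.
rewrite integralE [RHS]integralE; congr (_ - _)%E.
  transitivity (\int[nu]_(t in Rpos) (Num.max (f t) 0)%:E)%E.
    by apply: eq_integral => t _; rewrite funeposE /= -EFin_max.
  rewrite ge0_integral_density//; last 2 first.
  - exact: measurable_maxr.
  - by move=> t _; rewrite le_max lexx orbT.
  apply: eq_integral => t /set_mem /Rpos_gt0 t0.
  by rewrite funeposE /= -EFin_max maxr_pMl ?w_ge0// mul0r.
transitivity (\int[nu]_(t in Rpos) (Num.max (- f t) 0)%:E)%E.
  by apply: eq_integral => t _; rewrite funenegE /= -EFin_max.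
rewrite ge0_integral_density//; last 2 first.
- by apply: measurable_maxr => //; exact: measurable_funN.
- by move=> t _; rewrite le_max lexx orbT.
apply: eq_integral => t /set_mem /Rpos_gt0 t0.
by rewrite funenegE /= -EFin_max maxr_pMl ?w_ge0// mul0r mulNr.
Qed.

End DensityIntegral.

(** * The complex Laplace transform *)

Section ComplexLaplace.
Context {R : realType}.
Local Notation mu := (@lebesgue_measure R).

Lemma complex_ext (x y : R[i]) : complex.Re x = complex.Re y ->
  complex.Im x = complex.Im y -> x = y.
Proof. by case: x => a b; case: y => c d /= -> ->. Qed.

Lemma ReM (x y : R[i]) : complex.Re (x * y) =
  complex.Re x * complex.Re y - complex.Im x * complex.Im y.
Proof. by case: x => a b; case: y => c d. Qed.

Lemma ImM (x y : R[i]) : complex.Im (x * y) =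
  complex.Re x * complex.Im y + complex.Im x * complex.Re y.
Proof. by case: x => a b; case: y => c d. Qed.

Lemma ReV (x : R[i]) : complex.Re x^-1 =
  complex.Re x / (complex.Re x ^+ 2 + complex.Im x ^+ 2).
Proof. by case: x. Qed.

Lemma ImV (x : R[i]) : complex.Im x^-1 =
  - (complex.Im x / (complex.Re x ^+ 2 + complex.Im x ^+ 2)).
Proof. by case: x. Qed.

Definition ecos (p q t : R) := expR (- (p * t)) * cos (q * t).
Definition esin (p q t : R) := expR (- (p * t)) * sin (q * t).

Lemma cexp_ecos (t : R) (w : R[i]) : cexp (- (t%:C * w)) =
  ecos (complex.Re w) (complex.Im w) t +i* - esin (complex.Re w) (complex.Im w) t.
Proof.
case: w => p q; have -> : - (t%:C * (p +i* q)) = - (p * t) +i* - (q * t).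
  by apply: complex_ext => /=; ring.
by rewrite /cexp /ecos /esin /= cosN sinN; apply: complex_ext => /=; ring.
Qed.

Lemma measurable_ecos p q : measurable_fun [set: R] (ecos p q).
Proof.
apply: measurable_funM.
  by apply: measurableT_comp => //; apply: measurable_funN; exact: measurable_funM.
apply: measurableT_comp; last exact: measurable_funM.
by apply: continuous_measurable_fun; exact: continuous_cos.
Qed.

Lemma measurable_esin p q : measurable_fun [set: R] (esin p q).
Proof.
apply: measurable_funM.
  by apply: measurableT_comp => //; apply: measurable_funN; exact: measurable_funM.
apply: measurableT_comp; last exact: measurable_funM.
by apply: continuous_measurable_fun; exact: continuous_sin.
Qed.

Lemma norm_ecos_le p q t : `|ecos p q t| <= expR (- (p * t)).
Proof. by rewrite normrM ger0_norm ?expR_ge0// ler_piMr ?expR_ge0// cos_max. Qed.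

Lemma norm_esin_le p q t : `|esin p q t| <= expR (- (p * t)).
Proof. by rewrite normrM ger0_norm ?expR_ge0// ler_piMr ?expR_ge0// sin_max. Qed.

Section Kernels.
Variables (g : R -> R) (p q : R).
Hypothesis mg : measurable_fun Rpos g.
Hypothesis ig : intR (fun t => expR (- (p * t)) * g t).

Let intR_kernel (X : R -> R) : measurable_fun [set: R] X ->
  (forall t, `|X t| <= expR (- (p * t))) -> intR (fun t => X t * g t).
Proof.
move=> mX hX; apply: le_intR (intR_norm ig).
  by apply: measurable_funM => //; exact: measurable_funTS.
by move=> t _; rewrite !normrM ler_wpM2r// (ger0_norm (expR_ge0 _)).
Qed.

Lemma intR_ecos : intR (fun t => ecos p q t * g t).
Proof. by apply: intR_kernel; [exact: measurable_ecos|exact: norm_ecos_le]. Qed.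

Lemma intR_esin : intR (fun t => esin p q t * g t).
Proof. by apply: intR_kernel; [exact: measurable_esin|exact: norm_esin_le]. Qed.

End Kernels.

(** For real functions only: once the eigenvalue is real, the real and imaginary parts of [psi]
    satisfy the same equation and are treated separately. *)
Definition laplaceC (g : R -> R) (w : R[i]) : R[i] :=
  cintegral mu Rpos (fun t => cexp (- (t%:C * w)) * (g t)%:C).

Lemma laplaceCE (g : R -> R) (w : R[i]) : measurable_fun Rpos g ->
  intR (fun t => expR (- (complex.Re w * t)) * g t) ->
  laplaceC g w = (\int[mu]_(t in Rpos) (ecos (complex.Re w) (complex.Im w) t * g t)) +i*
    (- \int[mu]_(t in Rpos) (esin (complex.Re w) (complex.Im w) t * g t)).
Proof.
move=> mg ig; have is_ := intR_esin (complex.Im w) mg ig.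
rewrite /laplaceC /cintegral; congr (_ +i* _).
  by apply: eq_Rintegral => t _; rewrite cexp_ecos /= mulr0 subr0.
rewrite -RintN//; apply: eq_Rintegral => t _.
by rewrite cexp_ecos /= mulr0 add0r mulNr.
Qed.

Lemma laplaceC_real (g : R -> R) (p : R) : measurable_fun Rpos g ->
  intR (fun t => expR (- (p * t)) * g t) ->
  laplaceC g p%:C = (\int[mu]_(t in Rpos) (expR (- (p * t)) * g t))%:C.
Proof.
move=> mg ig; rewrite laplaceCE//; apply: complex_ext => /=.
  by apply: eq_Rintegral => t _; rewrite /ecos mul0r cos0 mulr1.
suff -> : \int[mu]_(t in Rpos) (esin p 0 t * g t) = 0 by rewrite oppr0.
rewrite (_ : \int[mu]_(t in Rpos) _ = \int[mu]_(t in Rpos) (0 : R)).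
  by rewrite Rintegral_cst// mul0r.
by apply: eq_Rintegral => t _; rewrite /esin mul0r sin0 mulr0 mul0r.
Qed.

Lemma ae_eq_laplaceC (g h : R -> R) (w : R[i]) : measurable_fun Rpos g ->
  measurable_fun Rpos h -> {ae mu, forall t, Rpos t -> g t = h t} ->
  laplaceC g w = laplaceC h w.
Proof.
move=> mg mh gh.
have key (X : R -> R) : measurable_fun [set: R] X ->
    \int[mu]_(t in Rpos) (X t * g t) = \int[mu]_(t in Rpos) (X t * h t).
  move=> mX; rewrite /Rintegral; congr fine; apply: ae_eq_integral => //.
  - by apply/measurable_EFinP; apply: measurable_funM => //; exact: measurable_funTS.
  - by apply/measurable_EFinP; apply: measurable_funM => //; exact: measurable_funTS.
  - by apply: ae_imp gh => t ht tR; rewrite ht.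
rewrite /laplaceC /cintegral; congr (_ +i* _).
  transitivity (\int[mu]_(t in Rpos) (ecos (complex.Re w) (complex.Im w) t * g t)).
    by apply: eq_Rintegral => t _; rewrite cexp_ecos /= mulr0 subr0.
  rewrite key; last exact: measurable_ecos.
  by apply: eq_Rintegral => t _; rewrite cexp_ecos /= mulr0 subr0.
transitivity (\int[mu]_(t in Rpos) ((- esin (complex.Re w) (complex.Im w) t) * g t)).
  by apply: eq_Rintegral => t _; rewrite cexp_ecos /= mulr0 add0r.
rewrite key; last by apply: measurable_funN; exact: measurable_esin.
by apply: eq_Rintegral => t _; rewrite cexp_ecos /= mulr0 add0r.
Qed.

Lemma laplaceC_lin (g h : R -> R) (a b : R) (w : R[i]) :
  measurable_fun Rpos g -> measurable_fun Rpos h ->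
  intR (fun t => expR (- (complex.Re w * t)) * g t) ->
  intR (fun t => expR (- (complex.Re w * t)) * h t) ->
  laplaceC (fun t => a * g t + b * h t) w = a%:C * laplaceC g w + b%:C * laplaceC h w.
Proof.
move=> mg mh ig ih.
have igh : intR (fun t => expR (- (complex.Re w * t)) * (a * g t + b * h t)).
  apply: eq_intR (intRD (intRZ a ig) (intRZ b ih)) => t _; ring.
rewrite !laplaceCE//; last by apply: measurable_funD; exact: measurable_funM.
have c1 := intR_ecos (complex.Im w) mg ig; have c2 := intR_ecos (complex.Im w) mh ih.
have s1 := intR_esin (complex.Im w) mg ig; have s2 := intR_esin (complex.Im w) mh ih.
have eR : \int[mu]_(t in Rpos) (ecos (complex.Re w) (complex.Im w) t * (a * g t + b * h t)) =
    a * (\int[mu]_(t in Rpos) (ecos (complex.Re w) (complex.Im w) t * g t)) +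
    b * \int[mu]_(t in Rpos) (ecos (complex.Re w) (complex.Im w) t * h t).
  rewrite -!RintZ// -RintD; [|exact: intRZ|exact: intRZ].
  by apply: eq_Rintegral => t _; ring.
have eI : \int[mu]_(t in Rpos) (esin (complex.Re w) (complex.Im w) t * (a * g t + b * h t)) =
    a * (\int[mu]_(t in Rpos) (esin (complex.Re w) (complex.Im w) t * g t)) +
    b * \int[mu]_(t in Rpos) (esin (complex.Re w) (complex.Im w) t * h t).
  rewrite -!RintZ// -RintD; [|exact: intRZ|exact: intRZ].
  by apply: eq_Rintegral => t _; ring.
by rewrite eR eI; apply: complex_ext => /=; ring.
Qed.

Lemma is_laplaceC (a b : R -> R) (w : R[i]) :
  measurable_fun Rpos a -> measurable_fun Rpos b ->
  intR (fun t => expR (- (complex.Re w * t)) * a t) ->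
  intR (fun t => expR (- (complex.Re w * t)) * b t) ->
  is_laplace (fun t => a t +i* b t) w (laplaceC a w + 'i%C * laplaceC b w).
Proof.
move=> ma mb ia ib.
have c1 := intR_ecos (complex.Im w) ma ia; have c2 := intR_ecos (complex.Im w) mb ib.
have s1 := intR_esin (complex.Im w) ma ia; have s2 := intR_esin (complex.Im w) mb ib.
have hR t : complex.Re (cexp (- (t%:C * w)) * (a t +i* b t)) =
    ecos (complex.Re w) (complex.Im w) t * a t + esin (complex.Re w) (complex.Im w) t * b t.
  by rewrite cexp_ecos /=; ring.
have hI t : complex.Im (cexp (- (t%:C * w)) * (a t +i* b t)) =
    ecos (complex.Re w) (complex.Im w) t * b t - esin (complex.Re w) (complex.Im w) t * a t.
  by rewrite cexp_ecos /=; ring.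
split.
  split; first by apply: eq_intR (intRD c1 s2) => t _; rewrite hR.
  by apply: eq_intR (intRB c2 s1) => t _; rewrite hI.
rewrite !laplaceCE// /cintegral.
have -> : \int[mu]_(t in Rpos) complex.Re (cexp (- (t%:C * w)) * (a t +i* b t)) =
    \int[mu]_(t in Rpos) (ecos (complex.Re w) (complex.Im w) t * a t) +
    \int[mu]_(t in Rpos) (esin (complex.Re w) (complex.Im w) t * b t).
  by rewrite -RintD//; apply: eq_Rintegral => t _; rewrite hR.
have -> : \int[mu]_(t in Rpos) complex.Im (cexp (- (t%:C * w)) * (a t +i* b t)) =
    \int[mu]_(t in Rpos) (ecos (complex.Re w) (complex.Im w) t * b t) -
    \int[mu]_(t in Rpos) (esin (complex.Re w) (complex.Im w) t * a t).
  by rewrite -RintB//; apply: eq_Rintegral => t _; rewrite hI.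
by apply: complex_ext => /=; ring.
Qed.

Lemma intR_exp_hankel (g : R -> R) (p : R) : measurable_fun [set: R] g -> intR g ->
  measurable_fun Rpos (hankel g) -> 0 < p -> intR (fun t => expR (- (p * t)) * hankel g t).
Proof.
move=> mg ig mH p0; have mgR : measurable_fun Rpos g by exact: measurable_funTS.
apply: le_intR (intRZ (\int[mu]_(s in Rpos) `|g s|) (intR_polyexpN 1 p0)).
  apply: measurable_funM => //; apply: measurable_funTS; apply: measurableT_comp => //.
  by apply: measurable_funN; exact: measurable_funM.
move=> t t0; rewrite normrM (ger0_norm (expR_ge0 _)) expr1 mulrA mulrC.
by rewrite ler_wpM2r ?expR_ge0// [leRHS]mulrC norm_hankel_le// ltW.
Qed.

Lemma laplaceC_hankel (g : R -> R) (w : R[i]) : measurable_fun [set: R] g -> intR g ->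
  measurable_fun Rpos (hankel g) -> 0 < complex.Re w ->
  laplaceC (hankel g) w = (w ^+ 2)^-1 * laplaceC g w^-1.
Proof.
case: w => p q mg ig mH /= p0; have mgR : measurable_fun Rpos g by exact: measurable_funTS.
have N0 : 0 < p ^+ 2 + q ^+ 2 by rewrite ltr_pwDl ?exprn_gt0// sqr_ge0.
rewrite laplaceCE//; last exact: intR_exp_hankel.
have [h1 h2] := laplace_hankel q mg ig p0; rewrite /= in h1 h2.
rewrite [X in X +i* _]h1 [X in _ +i* - X]h2.
set P := p / _; set Q := q / _.
have P0 : 0 < P by rewrite divr_gt0.
have VE : (p +i* q)^-1 = P +i* - Q by apply: complex_ext; rewrite ?ReV ?ImV.
have iP : intR (fun t => expR (- (P * t)) * g t).
  apply: le_intR (intR_norm ig).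
    apply: measurable_funM => //; apply: measurable_funTS; apply: measurableT_comp => //.
    by apply: measurable_funN; exact: measurable_funM.
  move=> t t0; rewrite normrM ler_piMl// ger0_norm ?expR_ge0// expR_le1 oppr_le0.
  by rewrite mulr_ge0// ltW.
rewrite -exprVn VE laplaceCE//=.
have ic := intR_ecos Q mgR iP; have is_ := intR_esin Q mgR iP.
have e1 : \int[mu]_(t in Rpos) (ecos P (- Q) t * g t) = \int[mu]_(t in Rpos) (ecos P Q t * g t).
  by apply: eq_Rintegral => t _; rewrite /ecos mulNr cosN.
have e2 : \int[mu]_(t in Rpos) (esin P (- Q) t * g t) = - \int[mu]_(t in Rpos) (esin P Q t * g t).
  rewrite -RintN//; apply: eq_Rintegral => t _.
  by rewrite /esin mulNr sinN mulrN mulNr.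
rewrite e1 e2 opprK expr2; apply: complex_ext => /=.
  transitivity (\int[mu]_(t in Rpos) ((P ^+ 2 - Q ^+ 2) * (ecos P Q t * g t) +
      2 * P * Q * (esin P Q t * g t))).
    by apply: eq_Rintegral => t _; rewrite /ecos /esin; ring.
  by rewrite RintD ?RintZ//; [ring|exact: intRZ|exact: intRZ].
transitivity (- \int[mu]_(t in Rpos) (2 * P * Q * (ecos P Q t * g t) -
    (P ^+ 2 - Q ^+ 2) * (esin P Q t * g t))).
  by congr (- _); apply: eq_Rintegral => t _; rewrite /ecos /esin; ring.
by rewrite RintB ?RintZ//; [ring|exact: intRZ|exact: intRZ].
Qed.

(** Two uses of the mean value theorem: [f 1 - f 0 = f1 c] and [f1 c - f1 0 = f2 d * c] with
    [0 <= c <= 1]. *)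
Let taylor2 (f f1 f2 : R -> R) (M : R) :
  (forall x : R, is_derive x (1 : R) f (f1 x)) ->
  (forall x : R, is_derive x (1 : R) f1 (f2 x)) ->
  (forall x, 0 <= x <= 1 -> `|f2 x| <= M) -> `|f 1 - f 0 - f1 0| <= M.
Proof.
move=> d1 d2 hM.
have cont (h dh : R -> R) (b : R) : (forall x : R, is_derive x (1 : R) h (dh x)) ->
    {within `[0, b], continuous h}.
  by move=> dh'; apply: continuous_subspaceT => x; exact: isd_continuous (dh' x).
have [c c01 ->] := MVT_segment ler01 (fun x _ => d1 x) (cont f f1 1 d1).
move: c01; rewrite in_itv/= subr0 mulr1 => /andP[c0 c1].
have [d d0c ->] := MVT_segment c0 (fun x _ => d2 x) (cont f1 f2 c d2).
move: d0c; rewrite in_itv/= subr0 => /andP[d0 dc].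
rewrite normrM (ger0_norm c0) (le_trans (ler_piMr _ c1))// hM//.
by rewrite d0 (le_trans dc).
Qed.

(** Second-order Taylor expansion of [e^(- (w + x h) t)] in [x], for [w = p + i q] and
    [h = a + i b]. The second derivative carries the factor [t^2 h^2], and [|a| <= p/2] keeps the
    decay at [e^(- p t / 2)] along the whole segment. *)
Let ecos_taylor (p q a b t : R) : 0 < p -> `|a| <= p / 2 -> 0 < t ->
  `|ecos (p + a) (q + b) t - ecos p q t - (- (a * (t * ecos p q t)) - b * (t * esin p q t))| <=
     (`|a| + `|b|) ^+ 2 * (t ^+ 2 * expR (- (p / 2 * t))) /\
  `|esin (p + a) (q + b) t - esin p q t - (- (a * (t * esin p q t)) + b * (t * ecos p q t))| <=
     (`|a| + `|b|) ^+ 2 * (t ^+ 2 * expR (- (p / 2 * t))).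
Proof.
move=> p0 ap t0.
pose f x := ecos (p + x * a) (q + x * b) t; pose h x := esin (p + x * a) (q + x * b) t.
have df (x : R) : is_derive x (1 : R) f (- a * t * f x - b * t * h x).
  by rewrite /f /h /ecos /esin; isderive; ring.
have dh (x : R) : is_derive x (1 : R) h (- a * t * h x + b * t * f x).
  by rewrite /f /h /ecos /esin; isderive; ring.
pose f2 x := t ^+ 2 * ((a ^+ 2 - b ^+ 2) * f x + 2 * a * b * h x).
pose h2 x := t ^+ 2 * ((a ^+ 2 - b ^+ 2) * h x - 2 * a * b * f x).
have df1 (x : R) : is_derive x (1 : R) (fun x => - a * t * f x - b * t * h x) (f2 x).
  by have h1 := df x; have h3 := dh x; rewrite /f2; isderive; ring.
have dh1 (x : R) : is_derive x (1 : R) (fun x => - a * t * h x + b * t * f x) (h2 x).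
  by have h1 := df x; have h3 := dh x; rewrite /h2; isderive; ring.
have ex x : 0 <= x <= 1 -> expR (- ((p + x * a) * t)) <= expR (- (p / 2 * t)).
  move=> /andP[x0 x1]; rewrite ler_expR lerN2 ler_wpM2r ?(ltW t0)//.
  have : `|x * a| <= p / 2 by rewrite normrM (ger0_norm x0) (le_trans (ler_piMl _ x1)).
  by rewrite ler_norml => /andP[]; lra.
have bf x : 0 <= x <= 1 -> `|f x| <= expR (- (p / 2 * t)).
  by move=> x01; rewrite (le_trans (norm_ecos_le _ _ _))// ex.
have bh x : 0 <= x <= 1 -> `|h x| <= expR (- (p / 2 * t)).
  by move=> x01; rewrite (le_trans (norm_esin_le _ _ _))// ex.
have key (y z E : R) : `|y| <= E -> `|z| <= E ->
    `|t ^+ 2 * ((a ^+ 2 - b ^+ 2) * y + 2 * a * b * z)| <= (`|a| + `|b|) ^+ 2 * (t ^+ 2 * E).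
  move=> yE zE; rewrite normrM (ger0_norm (sqr_ge0 t)) mulrCA ler_wpM2l ?sqr_ge0//.
  have -> : (`|a| + `|b|) ^+ 2 * E = (`|a| ^+ 2 + `|b| ^+ 2) * E + 2 * `|a| * `|b| * E by ring.
  rewrite (le_trans (ler_normD _ _))// lerD//.
    by rewrite normrM ler_pM// (le_trans (ler_normB _ _))// !normrX.
  by rewrite !normrM (ger0_norm (ler0n _ 2)) ler_wpM2l// !mulr_ge0.
split.
  have := taylor2 df df1 (fun x x01 => key _ _ _ (bf x x01) (bh x x01)).
  by rewrite /f /h !mul1r !mul0r !addr0; congr (`|_ - _| <= _); ring.
have bh2 x : 0 <= x <= 1 -> `|h2 x| <= (`|a| + `|b|) ^+ 2 * (t ^+ 2 * expR (- (p / 2 * t))).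
  move=> x01; have := key (h x) (- f x) _ (bh x x01); rewrite normrN => /(_ (bf x x01)).
  by congr (`|_| <= _); rewrite /h2; ring.
have := taylor2 dh dh1 bh2.
by rewrite /f /h !mul1r !mul0r !addr0; congr (`|_ - _| <= _); ring.
Qed.

(** The derivative is [DR + i DI = - L[t g](w)]. Integrating [ecos_taylor] against [g] bounds the
    remainder by a constant times [|h|^2], which proves complex differentiability straight from the
    difference quotient. *)
Lemma holomorphic_laplaceC (g : R -> R) : measurable_fun Rpos g ->
  (forall p, 0 < p -> intR (fun t => expR (- (p * t)) * g t)) ->
  holomorphic_on right_half_plane (laplaceC g).
Proof.
move=> mg ig [p q] /= p0.
have p4 : 0 < p / 4 by rewrite divr_gt0.
have igk k (r : R) : 0 < r -> intR (fun t => t ^+ k * (expR (- (r * t)) * g t)).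
  move=> r0; have r2 : 0 < r / 2 by rewrite divr_gt0.
  apply: le_intR (intRZ (k`!%:R * (r / 2) ^- k) (intR_norm (ig _ r2))).
    apply: measurable_funM; first exact: measurable_funX.
    apply: measurable_funM => //; apply: measurable_funTS; apply: measurableT_comp => //.
    by apply: measurable_funN; exact: measurable_funM.
  move=> t t0; rewrite !normrM !mulrA ler_wpM2r// (ger0_norm (exprn_ge0 _ (ltW t0))).
  rewrite !(ger0_norm (expR_ge0 _)).
  have -> : expR (- (r * t)) = expR (- (r / 2 * t)) * expR (- (r / 2 * t)).
    by rewrite -expRD; congr expR; field.
  by rewrite mulrA ler_wpM2r ?expR_ge0// polyexpN_le// ltW.
have ick k (r s : R) : 0 < r -> intR (fun t => t ^+ k * (ecos r s t * g t)).
  move=> r0; apply: le_intR (intR_norm (igk k r r0)).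
    apply: measurable_funM; first exact: measurable_funX.
    by apply: measurable_funM => //; apply: measurable_funTS; exact: measurable_ecos.
  move=> t t0; rewrite normrM [leRHS]normrM ler_wpM2l// normrM [leRHS]normrM ler_wpM2r//.
  rewrite (ger0_norm (expR_ge0 _)).
  exact: norm_ecos_le.
have isk k (r s : R) : 0 < r -> intR (fun t => t ^+ k * (esin r s t * g t)).
  move=> r0; apply: le_intR (intR_norm (igk k r r0)).
    apply: measurable_funM; first exact: measurable_funX.
    by apply: measurable_funM => //; apply: measurable_funTS; exact: measurable_esin.
  move=> t t0; rewrite normrM [leRHS]normrM ler_wpM2l// normrM [leRHS]normrM ler_wpM2r//.
  rewrite (ger0_norm (expR_ge0 _)).
  exact: norm_esin_le.
pose DR := - \int[mu]_(t in Rpos) (t ^+ 1 * (ecos p q t * g t)).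
pose DI := \int[mu]_(t in Rpos) (t ^+ 1 * (esin p q t * g t)).
pose M := \int[mu]_(t in Rpos) `|t ^+ 2 * (expR (- (p / 2 * t)) * g t)|.
have p2 : 0 < p / 2 by rewrite divr_gt0.
have M0 : 0 <= M by rewrite Rintegral_ge0.
have bound (a b : R) : `|a| <= p / 2 ->
    `|complex.Re (laplaceC g ((p + a) +i* (q + b)) - laplaceC g (p +i* q)) - (a * DR - b * DI)|
       <= (`|a| + `|b|) ^+ 2 * M /\
    `|complex.Im (laplaceC g ((p + a) +i* (q + b)) - laplaceC g (p +i* q)) - (a * DI + b * DR)|
       <= (`|a| + `|b|) ^+ 2 * M.
  move=> ap; have pa : 0 < p + a by move: ap; rewrite ler_norml => /andP[]; lra.
  have mono (X Y : R -> R) : intR X ->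
      (forall t, 0 < t -> `|Y t| <= (`|a| + `|b|) ^+ 2 * (t ^+ 2 * expR (- (p / 2 * t)))) ->
      (forall t, X t = Y t * g t) -> `|\int[mu]_(t in Rpos) X t| <= (`|a| + `|b|) ^+ 2 * M.
    move=> iX hY XY; have ik := intR_norm (igk 2 _ p2).
    rewrite (le_trans (le_normr_Rintegral _ iX))// -RintZ//.
    apply: le_Rintegral => //; [exact: intR_norm|exact: intRZ|].
    move=> t /Rpos_gt0 t0; rewrite XY normrM.
    rewrite (le_trans (ler_wpM2r _ (hY t t0)))// le_eqVlt; apply/orP; left; apply/eqP.
    rewrite [`|t ^+ 2 * _|]normrM [`|expR _ * _|]normrM (ger0_norm (sqr_ge0 t)).
    by rewrite (ger0_norm (expR_ge0 _)) !mulrA.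
  have i1 := ick 0%N (p + a) (q + b) pa; have i2 := ick 0%N p q p0.
  have j1 := isk 0%N (p + a) (q + b) pa; have j2 := isk 0%N p q p0.
  have i3 := ick 1%N p q p0; have j3 := isk 1%N p q p0.
  have toE (X : R -> R) : \int[mu]_(t in Rpos) (X t * g t) =
      \int[mu]_(t in Rpos) (t ^+ 0 * (X t * g t)).
    by apply: eq_Rintegral => t _; rewrite mul1r.
  rewrite !laplaceCE ?ig//= !toE; split.
    pose X t := t ^+ 0 * (ecos (p + a) (q + b) t * g t) - t ^+ 0 * (ecos p q t * g t)
      + (a * (t ^+ 1 * (ecos p q t * g t)) + b * (t ^+ 1 * (esin p q t * g t))).
    have iX : intR X by apply: intRD; [exact: intRB|apply: intRD; exact: intRZ].
    rewrite (_ : _ - (a * DR - b * DI) = \int[mu]_(t in Rpos) X t).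
      apply: (mono X _ iX (fun t t0 => (ecos_taylor q b p0 ap t0).1)) => t.
      by rewrite /X expr0 expr1; ring.
    rewrite /X RintD; [|exact: intRB|apply: intRD; exact: intRZ].
    rewrite RintB// RintD; [|exact: intRZ|exact: intRZ].
    by rewrite (RintZ a i3) (RintZ b j3) /DR /DI; ring.
  pose X t := t ^+ 0 * (esin (p + a) (q + b) t * g t) - t ^+ 0 * (esin p q t * g t)
    + (a * (t ^+ 1 * (esin p q t * g t)) - b * (t ^+ 1 * (ecos p q t * g t))).
  have iX : intR X by apply: intRD; [exact: intRB|apply: intRB; exact: intRZ].
  rewrite (_ : _ - (a * DI + b * DR) = - \int[mu]_(t in Rpos) X t).
    rewrite normrN; apply: (mono X _ iX (fun t t0 => (ecos_taylor q b p0 ap t0).2)) => t.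
    by rewrite /X expr0 expr1; ring.
  rewrite /X RintD; [|exact: intRB|apply: intRB; exact: intRZ].
  rewrite RintB// RintB; [|exact: intRZ|exact: intRZ].
  by rewrite (RintZ a j3) (RintZ b i3) /DR /DI; ring.
pose N (z : R[i]) := Num.sqrt (complex.Re z ^+ 2 + complex.Im z ^+ 2).
have NE (z : R[i]) : `|z| = (N z)%:C by exact: normc_def.
have N0 z : 0 <= N z by exact: sqrtr_ge0.
have N_le z : N z <= `|complex.Re z| + `|complex.Im z|.
  rewrite -[leRHS]ger0_norm ?addr_ge0// -sqrtr_sqr ler_wsqrtr//.
  by rewrite sqrrD !real_normK ?num_real// lerD2r lerDl mulrn_wge0// mulr_ge0.
have Re_le z : `|complex.Re z| <= N z by rewrite -sqrtr_sqr ler_wsqrtr// lerDl sqr_ge0.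
have Im_le z : `|complex.Im z| <= N z by rewrite -sqrtr_sqr ler_wsqrtr// lerDr sqr_ge0.
apply/cvg_ex; exists (DR +i* DI); apply/cvgrPdist_le => e e_gt0.
have [e0 re0] : complex.Im e = 0 /\ 0 < complex.Re e.
  by move: e_gt0; rewrite ltcE /= => /andP[/eqP -> ->].
have eE : e = (complex.Re e)%:C by apply: complex_ext.
(* Each part of the remainder is at most [4 |h|^2 M], so together [8 M |h|^2]; the 1 added to
   [8 * M] guards against [M = 0]. *)
pose r : R := Num.min (p / 2) (complex.Re e / (8 * M + 1)).
have M1 : 0 < 8 * M + 1 by rewrite ltr_wpDl ?mulr_ge0.
have r0 : 0 < r%:C :> R[i] by rewrite ltcR lt_min p2 divr_gt0.
near=> h.
have h0 : h != 0 by near: h; exact: nbhs_dnbhs_neq.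
have hr : `|h| < r%:C by near: h; exact: dnbhs0_lt.
rewrite NE ltcR lt_min in hr; move/andP: hr => [hp hM].
have ap : `|complex.Re h| <= p / 2 by rewrite (le_trans (Re_le h))// ltW.
have [b1 b2] := bound _ (complex.Im h) ap.
pose X := laplaceC g ((p + complex.Re h) +i* (q + complex.Im h)) - laplaceC g (p +i* q).
have hE : h *: (1 : R[i]^o) + (p +i* q) = (p + complex.Re h) +i* (q + complex.Im h).
  by rewrite [h *: _]mulr1; case: (h) => c d; apply: complex_ext => /=; rewrite addrC.
have -> : (laplaceC g \o shift (p +i* q)) (h *: (1 : R[i]^o)) =
    laplaceC g ((p + complex.Re h) +i* (q + complex.Im h)) by rewrite -hE.
rewrite -/X.
have -> : DR +i* DI - h^-1 *: X = h^-1 * (h * (DR +i* DI) - X).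
  by rewrite mulrBr mulrA mulVf// mul1r.
have h0' : 0 < `|h| by rewrite normr_gt0.
rewrite normrM normfV ler_pdivrMl// eE !NE -rmorphM lecR.
rewrite (le_trans (N_le _))//.
have n4 : (`|complex.Re h| + `|complex.Im h|) ^+ 2 <= 4 * N h ^+ 2.
  have -> : 4 * N h ^+ 2 = (N h + N h) ^+ 2 by ring.
  by rewrite lerXn2r ?nnegrE ?addr_ge0// lerD.
have b3 : (`|complex.Re h| + `|complex.Im h|) ^+ 2 * M <= 4 * N h ^+ 2 * M by rewrite ler_wpM2r.
apply: (@le_trans _ _ (N h * (8 * M * N h))).
  have -> : N h * (8 * M * N h) = 4 * N h ^+ 2 * M + 4 * N h ^+ 2 * M by ring.
  apply: lerD; [apply: le_trans b3; apply: le_trans b1|apply: le_trans b3; apply: le_trans b2];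
    rewrite -/X -[leLHS]normrN; case: (h) (X) => c d [x y] /=;
    by rewrite le_eqVlt; apply/orP; left; apply/eqP; congr (`|_|); ring.
rewrite ler_wpM2l//; move: hM; rewrite ltr_pdivlMr// => /ltW; apply: le_trans.
by rewrite mulrC ler_wpM2l// lerDl.
Unshelve. all: by end_near. Qed.

End ComplexLaplace.

(** * Self-reciprocity *)

Section HankelInversion.
Context {R : realType}.
Local Notation mu := (@lebesgue_measure R).

Lemma Rint_expN (p : R) : 0 < p -> \int[mu]_(t in Rpos) expR (- (p * t)) = p^-1.
Proof.
move=> p0; have dE (x : R) : is_derive x (1 : R) (fun t => - (expR (- (p * t)) / p)) (expR (- (p * x))).
  by isderive; field; rewrite gt_eqF.
have dE' (x : R) : is_derive x (1 : R) (fun t => expR (- (p * t))) (expR (- (p * x)) * - p).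
  by isderive.
rewrite (FTC_decay (fun t _ => dE t)).
- by rewrite mulr0 oppr0 expR0 mul1r opprK.
- by move=> t _; exact: isd_continuous (dE' t).
- exact: intR_expN.
- apply: (@cvg0_polyexpN _ _ p^-1 0 p) => // t _.
  by rewrite normrN ger0_norm ?divr_ge0 ?expR_ge0 ?(ltW p0)// mul1r mulrC.
Qed.

Section Decay.
Variables (G G1 G2 : R -> R) (C : R).
Hypothesis dG : forall t : R, 0 <= t -> is_derive t (1 : R) G (G1 t).
Hypothesis dG1 : forall t : R, 0 <= t -> is_derive t (1 : R) G1 (G2 t).
Hypothesis cG2 : forall t : R, 0 <= t -> {for t, continuous G2}.
Hypothesis bG : forall t : R, 0 <= t -> [/\ `|G t| <= C * expR (- (2^-1 * t)),
    `|G1 t| <= C * expR (- (2^-1 * t)) & `|G2 t| <= C * expR (- (2^-1 * t))].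

Let C0 : 0 <= C.
Proof.
have [h _ _] := bG (lexx 0); move: h; rewrite mulr0 oppr0 expR0 mulr1.
exact: le_trans.
Qed.

Let half : 0 < 2^-1 :> R. Proof. by rewrite invr_gt0. Qed.

Let cbm n (t s : R) : {for s, continuous (fun y : R => bclif n (y * t))}.
Proof.
have h := is_derive_bclif n (s * t).
have : exists d, is_derive s (1 : R) (fun s => bclif n (s * t)) d by eexists; isd.
by move=> [d]; exact: isd_continuous.
Qed.

Let int_bound (X : R -> R) k : (forall s : R, 0 < s -> {for s, continuous X}) ->
  (forall s, 0 < s -> exists2 a, a <= C * expR (- (2^-1 * s)) & `|X s| <= s ^+ k * a) -> intR X.
Proof.
move=> cX bX; apply: le_intR (intRZ C (intR_polyexpN k half)); first exact: cont_measurable.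
move=> s s0; have [a ha hX] := bX s s0; rewrite (le_trans hX)// mulrCA ler_wpM2l//.
by rewrite exprn_ge0// ltW.
Qed.

(** The primitives in [s] are explicit: [(C_0(s t))' = - t C_1(s t)] and [(s C_1(s t))' = C_0(s t)].
    Two integrations by parts leave the boundary value [G 0] and the integral of
    [- s C_1(s t) G2 s], where the Bessel factor supplies [omega t]. *)
Lemma hankel_decay : exists2 D : R, 0 <= D &
  forall t, 0 < t -> `|hankel (G \_ Rpos) t - G 0| <= D * omega t.
Proof.
have [K K0 hK] := @norm_bclif1_omega R.
pose J := \int[mu]_(s in Rpos) (C * (s ^+ 0 * expR (- (2^-1 * s)) + s ^+ 1 * expR (- (2^-1 * s)))).
have iJ : intR (fun s => C * (s ^+ 0 * expR (- (2^-1 * s)) + s ^+ 1 * expR (- (2^-1 * s)))).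
  by apply: intRZ; apply: intRD; exact: intR_polyexpN.
have J0 : 0 <= J.
  apply: Rintegral_ge0 => s /Rpos_gt0 s0.
  by rewrite mulr_ge0// addr_ge0// mulr_ge0 ?expR_ge0// exprn_ge0// ltW.
exists (K * J) => [|t t0]; first by rewrite mulr_ge0// ltW.
have st s : 0 < s -> 0 <= s * t by move=> s0; rewrite mulr_ge0// ltW.
have cG (s : R) : 0 < s -> {for s, continuous G} by move=> /ltW s0; exact: isd_continuous (dG s0).
have cG1 (s : R) : 0 < s -> {for s, continuous G1} by move=> /ltW s0; exact: isd_continuous (dG1 s0).
have iA : intR (fun s => t * bclif 1 (s * t) * G s).
  have : intR (fun s => bclif 1 (s * t) * G s).
    apply: (@int_bound _ 0); first by move=> s s0; apply: cvgM; [exact: cbm|exact: cG].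
    move=> s s0; have [h _ _] := bG (ltW s0); eexists; first exact: h.
    by rewrite expr0 mul1r normrM ler_piMl// norm_bclif_le1// st.
  by move=> /(intRZ t); apply: eq_intR => s _; rewrite mulrA.
have iB : intR (fun s => bclif 0 (s * t) * G1 s).
  apply: (@int_bound _ 0); first by move=> s s0; apply: cvgM; [exact: cbm|exact: cG1].
  move=> s s0; have [_ h _] := bG (ltW s0); eexists; first exact: h.
  by rewrite expr0 mul1r normrM ler_piMl// norm_bclif_le1// st.
have iC : intR (fun s => s * bclif 1 (s * t) * G2 s).
  apply: (@int_bound _ 1).
    move=> s s0; apply: cvgM; last exact: cG2 (ltW s0).
    by apply: cvgM; [exact: cvg_id|exact: cbm].
  move=> s s0; have [_ _ h] := bG (ltW s0); eexists; first exact: h.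
  by rewrite expr1 !normrM (gtr0_norm s0) ler_wpM2r// ler_piMr ?(ltW s0)// norm_bclif_le1// st.
have e1 : \int[mu]_(s in Rpos) (t * bclif 1 (s * t) * G s - bclif 0 (s * t) * G1 s) = G 0.
  transitivity (- - (bclif 0 (0 * t) * G 0)); last first.
    by rewrite mul0r bclif0 fact0 invr1 mul1r opprK.
  apply: (@FTC_decay _ (fun s => - (bclif 0 (s * t) * G s))).
  - by move=> s s0; have h1 := is_derive_bclif 0 (s * t); have h2 := dG s0; isderive; ring.
  - move=> s s0; apply: cvgB; last by apply: cvgM; [exact: cbm|exact: cG1].
    by apply: cvgM; [apply: cvgMr; exact: cbm|exact: cG].
  - exact: intRB.
  - apply: (@cvg0_polyexpN _ _ C 0 2^-1) => // s s0; have [h _ _] := bG (ltW s0).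
    rewrite normrN mul1r (le_trans _ h)// normrM ler_piMl// norm_bclif_le1// st//.
have e2 : \int[mu]_(s in Rpos) (bclif 0 (s * t) * G1 s + s * bclif 1 (s * t) * G2 s) = 0.
  transitivity (- (0 * bclif 1 (0 * t) * G1 0)); last by rewrite !mul0r oppr0.
  apply: (@FTC_decay _ (fun s => s * bclif 1 (s * t) * G1 s)).
  - move=> s s0; have h1 := is_derive_bclif 1 (s * t); have h2 := dG1 s0; isderive.
    have hr := bclif_rec 0 (s * t); rewrite mul1r in hr.
    have -> : bclif 0 (s * t) = bclif 1 (s * t) - s * t * bclif 2 (s * t) by rewrite hr; ring.
    by ring.
  - move=> s s0; apply: cvgD; first by apply: cvgM; [exact: cbm|exact: cG1].
    apply: cvgM; last exact: cG2 (ltW s0).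
    by apply: cvgM; [exact: cvg_id|exact: cbm].
  - exact: intRD.
  - apply: (@cvg0_polyexpN _ _ C 1 2^-1) => // s s0; have [_ h _] := bG (ltW s0).
    rewrite !normrM (gtr0_norm s0) mulrCA expr1 -mulrA ler_wpM2l ?(ltW s0)//.
    by rewrite (le_trans _ h)// ler_piMl// norm_bclif_le1// st.
rewrite RintB// in e1; rewrite RintD// in e2.
have -> : hankel (G \_ Rpos) t = \int[mu]_(s in Rpos) (t * bclif 1 (s * t) * G s).
  rewrite /hankel /bclif_int -RintZ.
    by apply: eq_Rintegral => s sR; rewrite patchE sR expr0; ring.
  apply: eq_intR (intRZ t^-1 iA) => s s0; rewrite patchE mem_set; last exact: gt0_Rpos.
  by rewrite expr0; field; rewrite gt_eqF.
set IA := \int[mu]_(s in Rpos) (t * _ * _) in e1 *.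
set IB := \int[mu]_(s in Rpos) (bclif 0 _ * _) in e1 e2.
have -> : IA - G 0 = - \int[mu]_(s in Rpos) (s * bclif 1 (s * t) * G2 s).
  by rewrite -e1 opprB addrCA subrr addr0; apply/eqP; rewrite -addr_eq0 e2.
rewrite normrN.
rewrite (le_trans (le_normr_Rintegral _ iC))// -mulrA [J * _]mulrC mulrA -RintZ//.
apply: le_Rintegral => //; [exact: intR_norm|exact: intRZ|].
move=> s /Rpos_gt0 s0; have [_ _ h2] := bG (ltW s0).
rewrite !normrM (gtr0_norm s0).
(* [omegaM] with the roles of [s] and [t] exchanged; the factor [s] cancels the denominator of
   [(1 + s) / s]. *)
have hE : s * `|bclif 1 (s * t)| <= K * omega t * (1 + s).
  rewrite (le_trans (ler_wpM2l (ltW s0) (hK _ (st s s0))))//.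
  rewrite mulrCA -mulrA ler_wpM2l ?(ltW K0)// mulrC.
  rewrite (le_trans (ler_wpM2r (ltW s0) (_ : _ <= omega t * ((1 + s) / s))))//.
    by rewrite mulrC; apply: omegaM => //; exact: ltW.
  by rewrite -mulrA divfK// gt_eqF.
rewrite (le_trans (ler_pM _ _ hE h2)) ?mulr_ge0 ?(ltW s0)//.
by rewrite le_eqVlt; apply/orP; left; apply/eqP; rewrite expr0 expr1; ring.
Qed.

End Decay.

Lemma eq_ae_hankel (g h : R -> R) (t : R) : measurable_fun Rpos g -> measurable_fun Rpos h ->
  {ae mu, forall s, Rpos s -> g s = h s} -> hankel g t = hankel h t.
Proof.
move=> mg mh gh; rewrite /hankel /bclif_int /Rintegral; congr (_ * fine _).
have mX (k : R -> R) : measurable_fun Rpos k ->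
    measurable_fun Rpos (fun s => (s ^+ 0 * bclif 1 (s * t) * k s)%:E).
  move=> mk; apply/measurable_EFinP; apply: measurable_funM => //.
  apply: measurable_funM; first exact: measurable_funX.
  by apply: measurable_funTS; exact: measurable_bclif_mulr.
apply: ae_eq_integral; [exact: mRpos|exact: mX|exact: mX|].
by apply: ae_imp gh => s h_s sR; rewrite h_s.
Qed.

(** A function of size [omega], like [s^(-3/4)], may fail to be integrable, so [laplace_hankel] does
    not cover it. The kernel contributes a second factor [omega s], and [omega^2] is integrable;
    this gives the product bound for Fubini. *)
Lemma laplace_hankel_decaying (chi : R -> R) (B p : R) : measurable_fun [set: R] chi ->
  (forall s, 0 < s -> `|chi s| <= B * omega s) -> 0 < p ->
  intR (fun t => expR (- (p * t)) * hankel chi t) /\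
  \int[mu]_(t in Rpos) (expR (- (p * t)) * hankel chi t) =
    p ^- 2 * \int[mu]_(s in Rpos) (expR (- (p^-1 * s)) * chi s).
Proof.
move=> mchi bchi p0; have [K K0 hK] := @norm_bclif1_omega R.
have mchiR : measurable_fun Rpos chi by exact: measurable_funTS.
(* The factor [cos (0 * t)], equal to 1, puts the kernel in the shape of [laplace_bclif1] with
   [q = 0]. *)
pose X t s := expR (- (p * t)) * cos (0 * t) * (t * bclif 1 (s * t)) * chi s.
have st (s t : R) : 0 < s -> 0 < t -> 0 <= s * t by move=> s0 t0; rewrite mulr_ge0// ltW.
have hE (s t : R) : 0 < s -> 0 < t -> `|bclif 1 (s * t)| <= K * (omega s * ((1 + t) / t)).
  move=> s0 t0; rewrite (le_trans (hK _ (st s t s0 t0)))// ler_wpM2l ?(ltW K0)//.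
  by rewrite omegaM// ltW.
have hB (s t : R) : 0 < s -> 0 < t -> `|bclif 1 (s * t) * chi s| <= (K * B * ((1 + t) / t)) * omega s ^+ 2.
  move=> s0 t0; rewrite normrM (le_trans (ler_pM _ _ (hE s t s0 t0) (bchi s s0)))//.
  by rewrite le_eqVlt; apply/orP; left; apply/eqP; ring.
have ia : intR (fun t => t ^+ 0 * expR (- (p * t)) + t ^+ 1 * expR (- (p * t))).
  by apply: intRD; exact: intR_polyexpN.
have ib : intR (fun s => K * B * omega s ^+ 2) by apply: intRZ; exact: intR_omega2.
have Xb (t s : R) : 0 < t -> 0 < s ->
    `|X t s| <= (t ^+ 0 * expR (- (p * t)) + t ^+ 1 * expR (- (p * t))) * (K * B * omega s ^+ 2).
  move=> t0 s0; rewrite /X mul0r cos0 mulr1 -!mulrA 2!normrM (ger0_norm (expR_ge0 _)) (gtr0_norm t0).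
  rewrite (le_trans (ler_wpM2l (expR_ge0 _) (ler_wpM2l (ltW t0) (hB s t s0 t0))))//.
  by rewrite le_eqVlt; apply/orP; left; apply/eqP; rewrite expr0 expr1; field; rewrite gt_eqF.
have me : measurable_fun [set: R] (fun t : R => expR (- (p * t)) * cos (0 * t)).
  exact: measurable_ecos.
have mX : measurable_fun [set: measurableTypeR R * measurableTypeR R] (fun z => X z.1 z.2).
  apply: measurable_funM; last exact: (measurableT_comp mchi measurable_snd).
  apply: measurable_funM; first exact: (measurableT_comp me measurable_fst).
  apply: measurable_funM; first exact: measurable_fst.
  apply: measurableT_comp; first by apply: continuous_measurable_fun; exact: continuous_bclif.
  by apply: measurable_funM; [exact: measurable_snd|exact: measurable_fst].
have [h1 h2] := fubini_Rpos mX ia ib Xb.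
have eH (t : R) : 0 < t -> \int[mu]_(s in Rpos) X t s = expR (- (p * t)) * hankel chi t.
  move=> t0; rewrite /hankel /bclif_int mulrA -RintZ.
    by apply: eq_Rintegral => s _; rewrite /X mul0r cos0 expr0; ring.
  apply: le_intR (intRZ (K * B * ((1 + t) / t)) intR_omega2).
    apply: measurable_funM => //; apply: measurable_funM; first exact: measurable_funX.
    by apply: measurable_funTS; exact: measurable_bclif_mulr.
  by move=> s s0; rewrite expr0 mul1r; exact: hB.
split; first exact: eq_intR eH h2.
apply: etrans (esym (eq_RintR eH)) _; apply: etrans h1 _.
have eX (s : R) : 0 < s -> \int[mu]_(t in Rpos) X t s = p ^- 2 * (expR (- (p^-1 * s)) * chi s).
  move=> s0; have [h3 _] := laplace_bclif1 0 p0 (ltW s0).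
  transitivity (chi s * \int[mu]_(t in Rpos) (expR (- (p * t)) * cos (0 * t) * (t * bclif 1 (s * t)))).
    rewrite -RintZ; first by apply: eq_Rintegral => t _; rewrite /X; ring.
    apply: le_intR (intR_polyexpN 1 p0).
      apply: measurable_funM; first by apply: measurable_funTS.
      apply: measurable_funM; first exact: measurable_id.
      by apply: cont_measurable => t _; exact: isd_continuous (is_derive_bclifM 1 s t).
    move=> t t0; rewrite mul0r cos0 mulr1 !normrM (ger0_norm (expR_ge0 _)) (gtr0_norm t0).
    rewrite mulrCA expr1 ler_wpM2l ?(ltW t0)// ler_piMr ?expR_ge0//.
    by rewrite norm_bclif_le1// st.
  rewrite h3 mul0r (_ : p / (p ^+ 2 + 0 ^+ 2) = p^-1); last first.
    by rewrite expr0n /= addr0; field; rewrite gt_eqF.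
  by rewrite !mulr0 cos0 sin0 !mulr0 expr0n /= subr0 mulr1 addr0 exprVn mulrC [s * _]mulrC; ring.
apply: etrans (eq_RintR eX) _; rewrite RintZ//.
have p1 : 0 < p^-1 by rewrite invr_gt0.
apply: le_intR (intRZ `|B| (intR_expN p1)).
  apply: measurable_funM => //; apply: measurable_funTS; apply: measurableT_comp => //.
  by apply: measurable_funN; exact: measurable_funM.
move=> s s0; rewrite normrM (ger0_norm (expR_ge0 _)) mulrC ler_wpM2r ?expR_ge0//.
rewrite (le_trans (bchi s s0))// (le_trans (ler_wpM2r (omega_ge0 _) (ler_norm B)))//.
by rewrite ler_piMr// omega_le1// ltW.
Qed.

(* [1] is its own Hankel transform, but only as an improper integral: so the limit
   [c / l] of [psi] at infinity is split off, and the remainder, of size [omega],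
   has absolutely convergent Hankel integrals. *)
Lemma eigen_hankel (l : R) (psi : R -> R) : l != 0 -> measurable_fun [set: R] psi ->
  intR (fun t => psi t ^+ 2 * mhat_density t) ->
  {ae mu, forall t, Rpos t ->
    (l - expR (- t)) * psi t = hankel (fun s => expR (- s) * psi s) t} ->
  exists h : R -> R, [/\ measurable_fun Rpos h,
    {ae mu, forall t, Rpos t -> psi t = h t},
    (forall p, 0 < p -> intR (fun t => expR (- (p * t)) * h t)),
    (forall w : R[i], 0 < complex.Re w -> laplaceC h w = (w ^+ 2)^-1 * laplaceC h w^-1) &
    forall t, 0 < t ->
      (forall A, mu.-integrable `]0%R, A] (EFin \o (fun s => t * bclif 1 (s * t) * h s))) /\
      \int[mu]_(s in `]0%R, A]) (t * bclif 1 (s * t) * h s) @[A --> +oo] --> h t].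
Proof.
move=> l0 mpsi ipsi eqn.
have [G [G1 [G2 [C [psiE [dG [dG1 [cG2 bG]]]]]]]] := eigen_smooth l0 mpsi ipsi eqn.
(* By [hankel_decay], [c] is the limit of [hankel g] at infinity; thus [psi] tends to [c / l]. *)
pose g := G \_ Rpos; pose c := G 0.
have C0 : 0 <= C.
  have [h _ _] := bG 0 (lexx 0); move: h; rewrite mulr0 oppr0 expR0 mulr1.
  exact: le_trans.
have mG : measurable_fun Rpos G by apply: isd_measurable => t /ltW; exact: dG.
have mg : measurable_fun [set: R] g by exact: (measurable_restrictT _ mRpos).1 mG.
have mgR : measurable_fun Rpos g by exact: measurable_funTS.
have gE t : 0 < t -> g t = G t by move=> t0; rewrite /g patchE mem_set//; exact: gt0_Rpos.
have bg t : 0 < t -> `|g t| <= C * expR (- (2^-1 * t)).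
  by move=> t0; rewrite gE//; have [] := bG t (ltW t0).
have half : 0 < 2^-1 :> R by rewrite invr_gt0.
have ig : intR g by apply: le_intR (intRZ C (intR_expN half)).
have igk k : intR (fun s => s ^+ k * (expR (4^-1 * s) * g s)).
  have four : 0 < 4^-1 :> R by rewrite invr_gt0.
  apply: le_intR (intRZ C (intR_polyexpN k four)).
    apply: measurable_funM; first exact: measurable_funX.
    apply: measurable_funM => //; apply: measurable_funTS.
    by apply: measurableT_comp => //; exact: measurable_funM.
  move=> t t0; rewrite !normrM (ger0_norm (exprn_ge0 _ (ltW t0))) (ger0_norm (expR_ge0 _)).
  rewrite [leRHS]mulrCA ler_wpM2l ?exprn_ge0 ?(ltW t0)//.
  rewrite (le_trans (ler_wpM2l (expR_ge0 _) (bg t t0)))// mulrCA ler_wpM2l//.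
  by rewrite -expRD ler_expR; lra.
have mH : measurable_fun Rpos (hankel g).
  apply: isd_measurable => t t0; apply: (isd_hankel mg igk).
  by rewrite (lt_trans _ t0)// oppr_lt0.
pose ph t := l^-1 * (g t + hankel g t).
have mph : measurable_fun Rpos ph by apply: measurable_funM => //; exact: measurable_funD.
have psi_ph : {ae mu, forall t, Rpos t -> psi t = ph t}.
  apply: (ae_imp2 _ psiE eqn) => t h1 h2 tR; have t0 := Rpos_gt0 tR.
  have e1 : expR (- t) * psi t = g t.
    by rewrite h1// gE// mulrA -expRD addNr expR0 mul1r.
  have e2 : hankel (fun s => expR (- s) * psi s) t = hankel g t.
    apply: eq_ae_hankel => //.
      apply: measurable_funM; apply: measurable_funTS => //.
      by apply: measurableT_comp => //; exact: measurable_funN.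
    apply: (ae_imp _ psiE) => s h3 sR; have s0 := Rpos_gt0 sR.
    by rewrite h3// gE// mulrA -expRD addNr expR0 mul1r.
  have := h2 tR; rewrite e2 mulrBl e1 => h4.
  by rewrite /ph -h4 addrC subrK mulKf.
have [D D0 hD] := hankel_decay dG dG1 cG2 bG.
pose chi := (fun t => ph t - c / l) \_ Rpos.
have chiE t : 0 < t -> chi t = ph t - c / l.
  by move=> t0; rewrite /chi patchE mem_set//; exact: gt0_Rpos.
have mchi : measurable_fun [set: R] chi.
  by apply: (measurable_restrictT _ mRpos).1; exact: measurable_funB.
(* [2 * C] accounts for [g], through [expN_le_omega], and [D] for [hankel g - c]. *)
pose B := `|l|^-1 * (2 * C + D).
have bchi t : 0 < t -> `|chi t| <= B * omega t.
  move=> t0; rewrite chiE//.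
  have -> : ph t - c / l = l^-1 * (g t + (hankel g t - c)) by rewrite /ph; ring.
  rewrite normrM normfV /B -mulrA ler_wpM2l ?invr_ge0// mulrDl.
  rewrite (le_trans (ler_normD _ _))// lerD ?hD//.
  have -> : 2 * C * omega t = C * (2 * omega t) by ring.
  by rewrite (le_trans (bg t t0))// ler_wpM2l// expN_le_omega// ltW.
(* This is what the improper Hankel transform of [ph = c / l + chi] must be, given that constants
   reproduce themselves. Unlike [ph] it will satisfy the reciprocity at every point and not just
   almost everywhere. *)
pose h t := c / l + hankel chi t.
have lap p : 0 < p -> intR (fun t => expR (- (p * t)) * ph t).
  move=> p0; apply: eq_intR (intRZ l^-1 (intRD (_ : intR (fun t => expR (- (p * t)) * g t))
      (intR_exp_hankel mg ig mH p0))) => [t _|]; first by rewrite /ph; ring.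
  apply: le_intR (intR_norm ig).
    apply: measurable_funM => //; apply: measurable_funTS; apply: measurableT_comp => //.
    by apply: measurable_funN; exact: measurable_funM.
  move=> t t0; rewrite normrM ler_piMl// ger0_norm ?expR_ge0// expR_le1 oppr_le0.
  by rewrite mulr_ge0// ltW.
have ih p : 0 < p -> intR (fun t => expR (- (p * t)) * h t).
  move=> p0; have [i1 _] := laplace_hankel_decaying mchi bchi p0.
  by apply: eq_intR (intRD (intRZ (c / l) (intR_expN p0)) i1) => t _; rewrite /h; ring.
(* Fubini has already made [e^-t * h] integrable, hence measurable; multiplying by [e^t] recovers
   [h]. *)
have mh : measurable_fun Rpos h.
  have := intR_measurable (ih 1 ltr01) => m1.
  have m2 : measurable_fun Rpos (fun t : R => expR t) by apply: measurable_funTS.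
  have := measurable_funM m2 m1; apply: eq_measurable_fun => t _ /=.
  by rewrite mul1r mulrA -expRD subrr expR0 mul1r.
have lapg p : 0 < p -> intR (fun t => expR (- (p * t)) * g t).
  move=> p0; apply: le_intR (intR_norm ig).
    apply: measurable_funM => //; apply: measurable_funTS; apply: measurableT_comp => //.
    by apply: measurable_funN; exact: measurable_funM.
  move=> t t0; rewrite normrM ler_piMl// ger0_norm ?expR_ge0// expR_le1 oppr_le0.
  by rewrite mulr_ge0// ltW.
have LphE (w : R[i]) : 0 < complex.Re w ->
    laplaceC ph w = (l^-1)%:C * laplaceC g w + (l^-1)%:C * ((w ^+ 2)^-1 * laplaceC g w^-1).
  move=> w0; rewrite -laplaceC_hankel// -laplaceC_lin//; [|exact: lapg|exact: intR_exp_hankel].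
  by congr (laplaceC _ w); apply/funext => t; rewrite /ph mulrDr.
have symph (w : R[i]) : 0 < complex.Re w -> laplaceC ph w = (w ^+ 2)^-1 * laplaceC ph w^-1.
  move=> w0; have wn0 : w != 0 by apply: contraTneq w0 => ->; rewrite /= ltxx.
  have w1 : 0 < complex.Re w^-1.
    by rewrite ReV divr_gt0// ltr_pwDl ?exprn_gt0// sqr_ge0.
  by rewrite (LphE w w0) (LphE w^-1 w1) !invrK; move: (l^-1)%:C => k; field.
(* The contribution [c / (l p)] of the constant in [h] cancels against that of the constant removed
   from [ph]. What remains is [p^-2 L[ph](1 / p)], which [symph] identifies with [L[ph](p)]. *)
have Lh p : 0 < p -> \int[mu]_(t in Rpos) (expR (- (p * t)) * h t) =
    \int[mu]_(t in Rpos) (expR (- (p * t)) * ph t).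
  move=> p0; have p1 : 0 < p^-1 by rewrite invr_gt0.
  have [i1 e1] := laplace_hankel_decaying mchi bchi p0.
  have := symph p%:C p0; rewrite -fmorphV laplaceC_real ?lap// laplaceC_real ?lap//.
  rewrite -rmorphXn -fmorphV -rmorphM => /complexI ->.
  transitivity (c / l * \int[mu]_(t in Rpos) expR (- (p * t)) +
      \int[mu]_(t in Rpos) (expR (- (p * t)) * hankel chi t)).
    rewrite -RintZ; last exact: intR_expN.
    rewrite -RintD//; last by apply: intRZ; exact: intR_expN.
    by apply: eq_Rintegral => t _; rewrite /h; ring.
  rewrite e1 Rint_expN//.
  have -> : \int[mu]_(s in Rpos) (expR (- (p^-1 * s)) * chi s) =
      \int[mu]_(s in Rpos) (expR (- (p^-1 * s)) * ph s) - c / l * p.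
    rewrite -[X in c / l * X]invrK -(Rint_expN p1) -RintZ; last exact: intR_expN.
    rewrite -RintB; [|exact: lap|by apply: intRZ; exact: intR_expN].
    by apply: eq_RintR => s s0; rewrite chiE//; ring.
  by field; rewrite l0 gt_eqF.
have hph : {ae mu, forall t, Rpos t -> h t - ph t = 0}.
  apply: (@laplace_unique _ _ 1).
    by apply: eq_intR (intRB (ih 1 ltr01) (lap 1 ltr01)) => t _; ring.
  move=> p p1; have p0 := lt_le_trans ltr01 p1.
  transitivity (\int[mu]_(t in Rpos) (expR (- (p * t)) * h t - expR (- (p * t)) * ph t)).
    by apply: eq_Rintegral => t _; ring.
  by rewrite RintB ?Lh ?subrr//; [exact: ih|exact: lap].
have hph' : {ae mu, forall t, Rpos t -> h t = ph t}.
  by apply: (ae_imp _ hph) => t e tR; apply/eqP; rewrite -subr_eq0; apply/eqP; exact: e.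
exists h; split => //.
- by apply: (ae_imp2 _ psi_ph hph') => t e1 e2 tR; rewrite e1// e2.
- by move=> w w0; rewrite (ae_eq_laplaceC w mh mph hph') (ae_eq_laplaceC w^-1 mh mph hph') symph.
move=> t t0; have mE : measurable_fun Rpos (fun s => t * bclif 1 (s * t)).
  by apply: measurable_funM => //; apply: measurable_funTS; exact: measurable_bclif_mulr.
have sA (A : R) : `]0%R, A] `<=` @Rpos R.
  by move=> s; rewrite /= in_itv/= => /andP[s0 _]; exact: gt0_Rpos.
(* On [(0, A]] the factor [e^(A - s)] is at least 1, so integrability there is read off from the
   Laplace integral of [h] at 1. *)
have ihA (A : R) : mu.-integrable `]0%R, A] (EFin \o (fun s => t * bclif 1 (s * t) * h s)).
  have iA : mu.-integrable `]0%R, A] (EFin \o (fun s => (t * expR A) * (expR (- (1 * s)) * h s))).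
    by apply: integrableS (intRZ _ (ih 1 ltr01)).
  apply: (le_integrable _ _ _ iA) => //.
    by apply/measurable_EFinP; exact: (measurable_funS mRpos (sA A) (measurable_funM mE mh)).
  move=> s; rewrite /= in_itv/= => /andP[s0 As].
  rewrite lee_fin mul1r mulrA !normrM ler_wpM2r// (gtr0_norm t0) !(ger0_norm (expR_ge0 _)).
  rewrite -mulrA ler_wpM2l ?(ltW t0)// -expRD (@le_trans _ _ 1)//.
    by rewrite norm_bclif_le1// mulr_ge0// ltW.
  by rewrite -[leLHS]expR0 ler_expR subr_ge0.
split => //.
have ichi : intR (fun s => t * bclif 1 (s * t) * chi s).
  have [K K0 hK] := @norm_bclif1_omega R.
  apply: le_intR (intRZ (K * B * (1 + t)) intR_omega2).
    by apply: measurable_funM => //; exact: measurable_funTS.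
  move=> s s0; rewrite !normrM (gtr0_norm t0) -mulrA.
  have st0 : 0 <= s * t by rewrite mulr_ge0// ltW.
  have hE : `|bclif 1 (s * t)| <= K * (omega s * ((1 + t) / t)).
    by rewrite (le_trans (hK _ st0))// ler_wpM2l ?(ltW K0)// omegaM// ltW.
  rewrite (le_trans (ler_wpM2l (ltW t0) (ler_pM _ _ hE (bchi s s0))))//.
  by rewrite le_eqVlt; apply/orP; left; apply/eqP; field; rewrite gt_eqF.
have iE (A : R) : mu.-integrable `]0%R, A] (EFin \o (fun s => t * bclif 1 (s * t))).
  have iA : mu.-integrable `]0%R, A] (EFin \o (fun s => (t * expR A) * expR (- (1 * s)))).
    by apply: integrableS (intRZ _ (intR_expN ltr01)).
  apply: (le_integrable _ _ _ iA) => //.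
    by apply/measurable_EFinP; exact: (measurable_funS mRpos (sA A) mE).
  move=> s; rewrite /= in_itv/= => /andP[s0 As].
  rewrite lee_fin mul1r !normrM (gtr0_norm t0) !(ger0_norm (expR_ge0 _)).
  rewrite -mulrA ler_wpM2l ?(ltW t0)// -expRD (@le_trans _ _ 1)//.
    by rewrite norm_bclif_le1// mulr_ge0// ltW.
  by rewrite -[leLHS]expR0 ler_expR subr_ge0.
(* The truncated transform of the constant 1 is [1 - C_0(A t)], with [C_0(A t)] tending to 0 as [A]
   grows. This is the only place where the convergence is conditional. *)
have eA (A : R) : 0 < A -> \int[mu]_(s in `]0%R, A]) (t * bclif 1 (s * t) * h s) =
    c / l * (1 - bclif 0 (A * t)) + \int[mu]_(s in `]0%R, A]) (t * bclif 1 (s * t) * chi s).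
  move=> A0.
  have -> : 1 - bclif 0 (A * t) = \int[mu]_(s in `]0%R, A]) (t * bclif 1 (s * t)).
    rewrite Rintegral_itv_obnd_cbnd//.
    have -> : 1 - bclif 0 (A * t) = - bclif 0 (A * t) - - bclif 0 (0 * t).
      by rewrite mul0r bclif0 fact0 invr1 opprK addrC.
    apply/esym; apply: (@FTC_cc _ (fun s => - bclif 0 (s * t))) => // s _.
      by have hd := is_derive_bclif 0 (s * t); isderive; ring.
    have hd := is_derive_bclif 1 (s * t).
    have : exists d, is_derive s (1 : R) (fun s => t * bclif 1 (s * t)) d by eexists; isd.
    by move=> [d]; exact: isd_continuous.
  rewrite -RintegralZl// -RintegralD//; first last.
  - exact: integrableS ichi.
  - have mI : measurable (`]0%R, A]%classic : set (measurableTypeR R)) by exact: measurable_itv.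
    exact: (integrableZl mI (c / l) (iE A)).
  have eAE : {ae mu, forall s, `]0%R, A]%classic s ->
      (t * bclif 1 (s * t) * h s)%:E = (c / l * (t * bclif 1 (s * t)) + t * bclif 1 (s * t) * chi s)%:E}.
    apply: (ae_imp _ hph') => s es; rewrite /= in_itv/= => /andP[s0 _].
    by rewrite es ?chiE//; [congr (_%:E); ring|exact: gt0_Rpos].
  rewrite /Rintegral; congr fine; apply: ae_eq_integral => //.
  - exact: measurable_int (ihA A).
  - have mc : measurable_fun Rpos (fun s => c / l * (t * bclif 1 (s * t))) by exact: measurable_funM.
    apply/measurable_EFinP.
    exact: (measurable_funS mRpos (sA A) (measurable_funD mc (intR_measurable ichi))).
have hE : h t = c / l * (1 - 0) + \int[mu]_(s in Rpos) (t * bclif 1 (s * t) * chi s).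
  rewrite subr0 mulr1 /h /hankel /bclif_int -RintZ.
    by congr (_ + _); apply: eq_Rintegral => s _; rewrite expr0; ring.
  apply: eq_intR (intRZ t^-1 ichi) => s s0; rewrite expr0; field; rewrite gt_eqF//.
rewrite hE.
have cv : c / l * (1 - bclif 0 (A * t)) + \int[mu]_(s in `]0%R, A]) (t * bclif 1 (s * t) * chi s)
    @[A --> +oo] --> c / l * (1 - 0) + \int[mu]_(s in Rpos) (t * bclif 1 (s * t) * chi s).
  apply: cvgD; last exact: int_trunc_cvg.
  by apply: cvgMr; apply: cvgB; [exact: cvg_cst|exact: bclif0_cvg0].
apply: cvg_trans cv; apply: near_eq_cvg; near=> A.
by rewrite eA//; near: A; apply: nbhs_pinfty_gt; exact: num_real.
Unshelve. all: by end_near. Qed.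

End HankelInversion.

(** * The Farey transfer operator *)

Section BesselKernel.
Context {R : realType}.

Lemma besselJ1_bclif (z : R) : 0 <= z ->
  besselJ1 (2 * Num.sqrt z) = Num.sqrt z * bclif 1 z.
Proof.
move=> z0; have h : series (fun k => (-1) ^+ k / (k`!%:R * k.+1`!%:R) *
    (2 * Num.sqrt z / 2) ^+ (2 * k + 1)%N) = Num.sqrt z *: pseries (bclif_coef 1) z.
  apply/funext => n; rewrite /pseries /series /= fctE scaler_sumr; apply: eq_bigr => k _.
  have -> : 2 * Num.sqrt z / 2 = Num.sqrt z by field.
  rewrite exprD exprM sqr_sqrtr// expr1 /bclif_coef natrM addn1.
  by rewrite /GRing.scale /=; ring.
rewrite /besselJ1 h; apply/cvg_lim => //.
by apply: cvgM; [exact: cvg_cst|exact: is_cvg_bclif].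
Qed.

Lemma besselJ1_kernel (s t : R) : 0 < s -> 0 < t ->
  besselJ1 (2 * Num.sqrt (s * t)) * Num.sqrt (t / s) = t * bclif 1 (s * t).
Proof.
move=> s0 t0; have st : 0 < s * t by rewrite mulr_gt0.
rewrite besselJ1_bclif ?(ltW st)// mulrAC -sqrtrM ?(ltW st)//.
by rewrite (_ : s * t * (t / s) = t ^+ 2) ?sqrtr_sqr ?gtr0_norm//; field; rewrite gt_eqF.
Qed.

Lemma cvg_complex (T : Type) (F : set_system T) {FF : Filter F} (X Y : T -> R) (x y : R) :
  X @ F --> x -> Y @ F --> y ->
  (X t +i* Y t : R[i]^o) @[t --> F] --> (x +i* y : R[i]^o).
Proof.
move=> /cvgrPdist_le cX /cvgrPdist_le cY; apply/cvgrPdist_le => e e_gt0.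
have [e0 re0] : complex.Im e = 0 /\ 0 < complex.Re e.
  by move: e_gt0; rewrite ltcE /= => /andP[/eqP -> ->].
have eE : e = (complex.Re e)%:C by apply: complex_ext.
have e2 : 0 < complex.Re e / 2 by rewrite divr_gt0.
near=> t.
have hX : `|x - X t| <= complex.Re e / 2 by near: t; exact: cX.
have hY : `|y - Y t| <= complex.Re e / 2 by near: t; exact: cY.
have -> : (x +i* y) - (X t +i* Y t) = (x - X t)%:C + 'i%C * (y - Y t)%:C.
  by apply: complex_ext => /=; ring.
rewrite (le_trans (ler_normD _ _))// normrM (_ : `|'i%C| = 1 :> R[i]) ?mul1r; last first.
  by rewrite normc_def /= expr0n expr1n add0r sqrtr1.
rewrite !normc_def /= !expr0n !addr0 !sqrtr_sqr eE -rmorphD lecR.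
by rewrite (le_trans (lerD hX hY))//; lra.
Unshelve. all: by end_near. Qed.

End BesselKernel.

(** * Nonreal eigenvalues *)

Section RealEigenvalue.
Context {R : realType}.
Local Notation mu := (@lebesgue_measure R).
Variables (a b : R) (pR pI : R -> R).
Hypothesis b0 : b != 0.
Hypothesis mR : measurable_fun [set: R] pR.
Hypothesis mI : measurable_fun [set: R] pI.
Let gR t := expR (- t) * pR t.
Let gI t := expR (- t) * pI t.
Hypothesis iR : intR gR.
Hypothesis iI : intR gI.
Hypothesis eqR : {ae mu, forall t, Rpos t ->
  (a - expR (- t)) * pR t - b * pI t = hankel gR t}.
Hypothesis eqI : {ae mu, forall t, Rpos t ->
  (a - expR (- t)) * pI t + b * pR t = hankel gI t}.

(* The Hankel kernel divided by [t] is symmetric: an eigenfunction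
   [psi] with eigenvalue [a + i b] satisfies [b \int e^-t |psi t|^2 / t dt = 0]. *)
Lemma real_eigenvalue : {ae mu, forall t, Rpos t -> pR t = 0 /\ pI t = 0}.
Proof.
have mexp : measurable_fun [set: R] (fun t : R => expR (- t)).
  by apply: measurableT_comp => //; exact: measurable_funN.
have mgR : measurable_fun [set: R] gR by exact: measurable_funM.
have mgI : measurable_fun [set: R] gI by exact: measurable_funM.
have fub (u v : R -> R) : measurable_fun [set: R] u -> measurable_fun [set: R] v ->
    intR u -> intR v ->
    \int[mu]_(s in Rpos) (u s * bclif_int 1 0 v s) =
    \int[mu]_(s in Rpos) (v s * bclif_int 1 0 u s) /\
    intR (fun s => u s * bclif_int 1 0 v s).
  move=> mu_ mv iu iv.
  have [||||e i] := @fubini_Rpos _ (fun s t => u s * (t ^+ 0 * bclif 1 (t * s) * v t))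
      (fun s => `|u s|) (fun t => `|v t|).
  - apply: measurable_funM; first exact: measurableT_comp.
    apply: measurable_funM; last exact: measurableT_comp.
    apply: measurable_funM; first by apply: measurable_funX.
    apply: measurableT_comp; last exact: measurable_funM.
    by apply: continuous_measurable_fun; exact: continuous_bclif.
  - exact: intR_norm.
  - exact: intR_norm.
  - move=> s t s0 t0; rewrite normrM ler_wpM2l// expr0 mul1r normrM ler_piMl//.
    by apply: norm_bclif_le1; rewrite mulr_ge0// ltW.
  have pull (w z : R -> R) (s : R) : measurable_fun [set: R] z -> intR z -> 0 < s ->
      \int[mu]_(t in Rpos) (w s * (t ^+ 0 * bclif 1 (t * s) * z t)) = w s * bclif_int 1 0 z s.
    move=> mz iz s0; rewrite RintZ//; apply: intR_bclif => //; [exact: measurable_funTS|exact: ltW|].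
    by apply: eq_intR iz => t _; rewrite mul1r.
  split; last by apply: eq_intR i => s s0; exact: pull.
  transitivity (\int[mu]_(s in Rpos) \int[mu]_(t in Rpos) (u s * (t ^+ 0 * bclif 1 (t * s) * v t))).
    by apply: eq_RintR => s s0; rewrite pull.
  rewrite e; apply: eq_RintR => t t0.
  rewrite -(pull v u)//; apply: eq_RintR => s _.
  by rewrite (mulrC t s); ring.
have [eRI iRI] := fub gR gI mgR mgI iR iI.
have [_ iIR] := fub gI gR mgI mgR iI iR.
pose E t := expR (- t) * (pR t ^+ 2 + pI t ^+ 2) / t.
(* Divide both equations by [t], multiply the second by [gR] and the first by [gI], and subtract:
   the terms with [a - e^-t] cancel and [b * E] remains. By the symmetry [fub] the integral of [D]
   is 0. *)
pose D t := b^-1 * (gR t * bclif_int 1 0 gI t - gI t * bclif_int 1 0 gR t).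
have iD : intR D by apply: intRZ; exact: intRB.
have D0 : \int[mu]_(t in Rpos) D t = 0.
  by rewrite /D RintZ ?RintB ?eRI ?subrr ?mulr0//; exact: intRB.
have ED : {ae mu, forall t, Rpos t -> E t = D t}.
  apply: ae_imp2 eqR eqI => t hR hI tR; have t0 := Rpos_gt0 tR.
  have {}hR := hR tR; have {}hI := hI tR; rewrite /hankel in hR hI.
  have xR : bclif_int 1 0 gR t = ((a - expR (- t)) * pR t - b * pI t) / t.
    by rewrite hR mulrC mulKf// gt_eqF.
  have xI : bclif_int 1 0 gI t = ((a - expR (- t)) * pI t + b * pR t) / t.
    by rewrite hI mulrC mulKf// gt_eqF.
  by rewrite /E /D xR xI /gR /gI; field; rewrite gt_eqF.
have mE : measurable_fun Rpos E.
  apply: measurable_funM.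
    apply: measurable_funTS; apply: measurable_funM => //.
    by apply: measurable_funD; exact: measurable_funX.
  apply: cont_measurable => t t0; apply: cvgV; last exact: cvg_id.
  by rewrite gt_eqF.
have E_ge0 t : Rpos t -> 0 <= E t.
  by move=> /Rpos_gt0 t0; rewrite divr_ge0 ?(ltW t0)// mulr_ge0 ?expR_ge0// addr_ge0 ?sqr_ge0.
have intE : (\int[mu]_(t in Rpos) `|(E t)%:E| = 0)%E.
  transitivity (\int[mu]_(t in Rpos) (D t)%:E)%E; last first.
    rewrite -[LHS]fineK; last by apply: integrable_fin_num.
    by rewrite -[fine _]/(\int[mu]_(t in Rpos) D t) D0.
  transitivity (\int[mu]_(t in Rpos) (E t)%:E)%E.
    by apply: eq_integral => t /set_mem tR; rewrite gee0_abs// lee_fin E_ge0.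
  apply: ae_eq_integral => //.
  - exact/measurable_EFinP.
  - exact: (measurable_int _ iD).
  - by apply: ae_imp ED => t h tR; rewrite h.
have mE' : measurable_fun Rpos (fun t => (E t)%:E) by exact/measurable_EFinP.
have := (ae_eq_integral_abs lebesgue_measure mRpos mE').1 intE; apply: ae_imp => t h tR.
have t0 := Rpos_gt0 tR.
have /eqP : E t = 0 by have [] := h tR.
rewrite /E !mulf_eq0 invr_eq0 (gt_eqF t0) orbF (gt_eqF (expR_gt0 _)) /=.
by rewrite paddr_eq0 ?sqr_ge0// !sqrf_eq0 => /andP[/eqP -> /eqP ->].
Qed.

End RealEigenvalue.

(** * From the transfer operator to the Hankel equation *)

Section FareyEigenfunction.
Context {R : realType}.
Local Notation mu := (@lebesgue_measure R).

Lemma farey_disk_gt0 (w : R[i]) : farey_disk w -> 0 < complex.Re w.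
Proof.
case: w => p q; rewrite /farey_disk /= => h; rewrite ltNge; apply/negP => p0.
have : p / (p ^+ 2 + q ^+ 2) <= 0 by rewrite mulr_le0_ge0// invr_ge0 addr_ge0 ?sqr_ge0.
by lra.
Qed.

(* [phi |-> expR * m_density * phi] is an isometry from [L_2(m)] to
   [L_2(mhat)], up to the factor [ln 2]. *)
Lemma borel_laplace (phi : R -> R[i]) : L2 m_measure phi ->
  exists pR pI : R -> R, [/\ measurable_fun [set: R] pR /\ measurable_fun [set: R] pI,
    intR (fun t => pR t ^+ 2 * mhat_density t),
    intR (fun t => pI t ^+ 2 * mhat_density t) &
    forall w, farey_disk w ->
      borel_transform phi w = (w ^+ 2)^-1 * (laplaceC pR w^-1 + 'i%C * laplaceC pI w^-1)].
Proof.
move=> [mR mI fin].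
have mE (c : R -> R) : measurable_fun [set: R] c -> measurable_fun Rpos c.
  exact: measurable_funTS.
have mm : measurable_fun Rpos (@m_density R) by exact: measurable_density m_density_continuous.
have fin' : (\int[mu]_(t in Rpos)
    ((complex.Re (phi t) ^+ 2 + complex.Im (phi t) ^+ 2) * m_density t)%:E < +oo)%E.
  rewrite -(@ge0_integral_density _ m_measure _ m_density_ge0)//.
  - by apply: measurable_funD; exact: measurable_funX.
  - by move=> t _; rewrite addr_ge0 ?sqr_ge0.
have l2 : 0 < ln 2 :> R by rewrite ln_gt0// ltr1n.
have iphi : intR (fun t => (complex.Re (phi t) ^+ 2 + complex.Im (phi t) ^+ 2) * m_density t).
  apply/integrableP; split.
    apply/measurable_EFinP; apply: measurable_funM => //.
    by apply: measurable_funD; exact: measurable_funX.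
  rewrite (_ : integral _ _ _ = \int[mu]_(t in Rpos)
    ((complex.Re (phi t) ^+ 2 + complex.Im (phi t) ^+ 2) * m_density t)%:E)%E//.
  apply: eq_integral => t /set_mem /Rpos_gt0 t0.
  by rewrite gee0_abs// lee_fin mulr_ge0 ?m_density_ge0// addr_ge0 ?sqr_ge0.
(* Extended by zero, since the Fubini arguments ask for measurability on the whole line. *)
pose P (x : R -> R) := (fun t => expR t * m_density t * x t) \_ Rpos.
have PE x t : 0 < t -> P x t = expR t * m_density t * x t.
  by move=> t0; rewrite /P patchE mem_set//; exact: gt0_Rpos.
have mP x : measurable_fun Rpos x -> measurable_fun [set: R] (P x).
  move=> mx; apply/(measurable_restrictT _ mRpos); apply: measurable_funM => //.
  by apply: measurable_funM => //; exact: measurable_funTS.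
have isoP (x : R -> R) : measurable_fun Rpos x -> (forall t, 0 < t ->
    x t ^+ 2 <= complex.Re (phi t) ^+ 2 + complex.Im (phi t) ^+ 2) ->
    intR (fun t => P x t ^+ 2 * mhat_density t).
  move=> mx xle; apply: le_intR (intRZ (ln 2)^-1 iphi).
    apply: measurable_funM; last exact: measurable_density mhat_density_continuous.
    by apply: measurable_funX; apply: mE; exact: mP.
  move=> t t0; have et : expR t != 0 by rewrite gt_eqF// expR_gt0.
  have et1 : 0 < expR t - 1 by rewrite subr_gt0 -expR0 ltr_expR.
  have -> : P x t ^+ 2 * mhat_density t = (ln 2)^-1 * (x t ^+ 2 * m_density t).
    rewrite PE// /mhat_density /m_density expRN; field.
    by rewrite et !gt_eqF.
  rewrite ger0_norm; last first.
    by rewrite mulr_ge0 ?invr_ge0 ?(ltW l2)// mulr_ge0 ?sqr_ge0// m_density_ge0.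
  by rewrite ler_wpM2l ?invr_ge0 ?(ltW l2)// ler_wpM2r ?m_density_ge0 ?xle.
pose xR t := complex.Re (phi t); pose xI t := complex.Im (phi t).
have iR : intR (fun t => P xR t ^+ 2 * mhat_density t).
  by apply: isoP => // t _; rewrite lerDl sqr_ge0.
have iI : intR (fun t => P xI t ^+ 2 * mhat_density t).
  by apply: isoP => // t _; rewrite lerDr sqr_ge0.
exists (P xR), (P xI); split=> // [|w wD]; first by split; exact: mP.
rewrite /borel_transform; congr (_ * _).
have mPR := mE _ (mP _ mR); have mPI := mE _ (mP _ mI).
pose p := complex.Re w^-1; pose q := complex.Im w^-1.
(* Membership in the disk is literally the condition [2^-1 < p] of [intR_L2mhat], with [p] the real
   part of [1 / w]. *)
have lR := intR_L2mhat wD mPR iR; have lI := intR_L2mhat wD mPI iI.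
have cR := intR_ecos q mPR lR; have cI := intR_ecos q mPI lI.
have sR := intR_esin q mPR lR; have sI := intR_esin q mPI lI.
rewrite !laplaceCE// -/p -/q /cintegral.
have kE t : cexp (- (t%:C / w)) * (expR t)%:C * phi t =
    (ecos p q t * (expR t * xR t) + esin p q t * (expR t * xI t)) +i*
    (ecos p q t * (expR t * xI t) - esin p q t * (expR t * xR t)).
  rewrite cexp_ecos -/p -/q /xR /xI; case: (phi t) => c d.
  by apply: complex_ext => /=; ring.
have mec : measurable_fun Rpos (ecos p q) by apply: mE; exact: measurable_ecos.
have mes : measurable_fun Rpos (esin p q) by apply: mE; exact: measurable_esin.
have mex x : measurable_fun Rpos x -> measurable_fun Rpos (fun t : R => expR t * x t).
  by apply: measurable_funM; exact: mE.
have eRe : \int[m_measure]_(t in Rpos) complex.Re (cexp (- (t%:C / w)) * (expR t)%:C * phi t) =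
    \int[mu]_(t in Rpos) (ecos p q t * P xR t) + \int[mu]_(t in Rpos) (esin p q t * P xI t).
  rewrite -RintD//; under eq_Rintegral do rewrite kE /=.
  rewrite (@Rintegral_density _ m_measure _ m_density_ge0)//.
    by apply: eq_RintR => t t0; rewrite !PE//; ring.
  by apply: measurable_funD; apply: measurable_funM => //; exact: mex.
have eIm : \int[m_measure]_(t in Rpos) complex.Im (cexp (- (t%:C / w)) * (expR t)%:C * phi t) =
    \int[mu]_(t in Rpos) (ecos p q t * P xI t) - \int[mu]_(t in Rpos) (esin p q t * P xR t).
  rewrite -RintB//; under eq_Rintegral do rewrite kE /=.
  rewrite (@Rintegral_density _ m_measure _ m_density_ge0)//.
    by apply: eq_RintR => t t0; rewrite !PE//; ring.
  by apply: measurable_funB; apply: measurable_funM => //; exact: mex.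
by rewrite eRe eIm; apply: complex_ext => /=; ring.
Qed.

Section Eigenfunction.
Variables (a b : R) (f : R[i] -> R[i]) (pR pI : R -> R).
Hypothesis mR : measurable_fun [set: R] pR.
Hypothesis mI : measurable_fun [set: R] pI.
Hypothesis iR : intR (fun t => pR t ^+ 2 * mhat_density t).
Hypothesis iI : intR (fun t => pI t ^+ 2 * mhat_density t).
Hypothesis fE : forall w, farey_disk w ->
  f w = (w ^+ 2)^-1 * (laplaceC pR w^-1 + 'i%C * laplaceC pI w^-1).
Hypothesis f_eigen : forall w, farey_disk w -> farey_transfer f w = (a +i* b) * f w.
Let gR t := expR (- t) * pR t.
Let gI t := expR (- t) * pI t.

Let mexp : measurable_fun [set: R] (fun t : R => expR (- t)).
Proof. by apply: measurableT_comp => //; exact: measurable_funN. Qed.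

Lemma intR_mul_expN (p : R -> R) : measurable_fun [set: R] p ->
  intR (fun t => p t ^+ 2 * mhat_density t) -> intR (fun t => expR (- t) * p t).
Proof.
move=> mp ip; have : 2^-1 < 1 :> R by lra.
move=> /intR_L2mhat/(_ (measurable_funTS mp) ip).
by apply: eq_intR => t _; rewrite mul1r.
Qed.

Lemma measurable_hankel (p : R -> R) : measurable_fun [set: R] p ->
  intR (fun t => p t ^+ 2 * mhat_density t) ->
  measurable_fun Rpos (hankel (fun t => expR (- t) * p t)).
Proof.
move=> mp ip; have mg : measurable_fun [set: R] (fun t => expR (- t) * p t).
  exact: measurable_funM.
apply: (@isd_measurable _ _ (bclif_int 0 0 (fun t => expR (- t) * p t))) => t t0.
apply: isd_hankel => //; last by lra.
by move=> k; exact: intR_exp_moment.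
Qed.

Let L (x : R -> R) (p : R) := \int[mu]_(t in Rpos) (expR (- (p * t)) * x t).

Let f_real (p : R) : 2^-1 < p -> f (p^-1)%:C = (p ^+ 2)%:C * (L pR p +i* L pI p).
Proof.
move=> hp; have p0 : p != 0 by rewrite gt_eqF//; lra.
have wV : ((p^-1)%:C)^-1 = p%:C :> R[i] by rewrite -fmorphV invrK.
have wD : farey_disk (p^-1)%:C by rewrite /farey_disk /mkset wV.
rewrite fE// wV !laplaceC_real//; try by apply: intR_L2mhat => //; exact: measurable_funTS.
- by rewrite -exprVn wV -rmorphXn; congr (_ * _); rewrite /L; apply: complex_ext => /=; ring.
- exact: measurable_funTS.
- exact: measurable_funTS.
Qed.

Let L_shift (x : R -> R) (p : R) : L x (p + 1) = L (fun t => expR (- t) * x t) p.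
Proof.
by apply: eq_RintR => t _; rewrite mulrDl mul1r opprD expRD; ring.
Qed.

Let L_hankel (x : R -> R) (p : R) : 0 < p -> measurable_fun [set: R] x ->
  intR (fun t => x t ^+ 2 * mhat_density t) ->
  L (hankel (fun t => expR (- t) * x t)) p =
  (p ^+ 2)^-1 * L (fun t => expR (- t) * x t) p^-1.
Proof.
move=> p0 mx ix; have ig := intR_mul_expN mx ix; have mH := measurable_hankel mx ix.
have mg : measurable_fun [set: R] (fun t => expR (- t) * x t) by exact: measurable_funM.
have := laplaceC_hankel mg ig mH (p0 : 0 < complex.Re p%:C).
rewrite -fmorphV !laplaceC_real//.
- by rewrite -rmorphXn -fmorphV -rmorphM => /complexI.
- exact: measurable_funTS.
- apply: le_intR (intR_norm ig).
    apply: measurable_funM; last exact: measurable_funTS.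
    apply: measurable_funTS; apply: measurableT_comp => //.
    by apply: measurable_funN; exact: measurable_funM.
  move=> t t0; rewrite normrM ler_piMl// ger0_norm ?expR_ge0// expR_le1 oppr_le0.
  by rewrite mulr_ge0 ?invr_ge0// ltW.
- exact: intR_exp_hankel.
Qed.

(** At [w = 1 / p] the points [w / (w + 1)] and [1 / (w + 1)] have the reciprocals [p + 1] and
    [1 / p + 1]. [L_shift] turns the two values of [f] into transforms of [e^-t] times the
    functions, at [p] and at [1 / p]; [L_hankel] moves the second one back to [p]. The squares from
    [f_real] combine with the prefactor [(1 / (w + 1))^2] to [p^2] and 1. *)
Let L_eigen (p : R) : 1 <= p ->
  a * L pR p - b * L pI p = L gR p + L (hankel gR) p /\
  a * L pI p + b * L pR p = L gI p + L (hankel gI) p.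
Proof.
move=> p1; have p0 : 0 < p by lra.
have pV : 0 < p^-1 by rewrite invr_gt0.
have wD : farey_disk (p^-1)%:C by rewrite /farey_disk /mkset -fmorphV invrK /=; lra.
have := f_eigen wD; rewrite /farey_transfer.
have -> : (p^-1)%:C / ((p^-1)%:C + 1) = ((p + 1)^-1)%:C :> R[i].
  rewrite -[1 in LHS](rmorph1 (real_complex R)) -rmorphD -fmorphV -rmorphM; congr (_%:C).
  by field; rewrite !gt_eqF//; lra.
have -> : 1 / ((p^-1)%:C + 1) = ((p^-1 + 1)^-1)%:C :> R[i].
  by rewrite -[in X in _ / (_ + X)](rmorph1 (real_complex R)) -rmorphD -fmorphV mul1r.
rewrite !f_real; [|by lra..].
rewrite !L_shift -rmorphXn (L_hankel p0 mR iR) (L_hankel p0 mI iI) -/gR -/gI.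
set GR := L gR p; set GI := L gI p; set GR' := L gR p^-1; set GI' := L gI p^-1.
set LR := L pR p; set LI := L pI p => h.
have hR := congr1 (@complex.Re R) h; have hI := congr1 (@complex.Im R) h.
have p10 : p + 1 != 0 by rewrite gt_eqF//; lra.
have pn0 : p != 0 by rewrite gt_eqF.
rewrite /= in hR hI.
split; apply: (mulfI (expf_neq0 2 pn0)).
  rewrite (_ : p ^+ 2 * (a * LR - b * LI) =
    a * (p ^+ 2 * LR - 0 * LI) - b * (p ^+ 2 * LI + 0 * LR)); last by ring.
  by rewrite -hR; field; rewrite pn0 addrC.
rewrite (_ : p ^+ 2 * (a * LI + b * LR) =
  a * (p ^+ 2 * LI + 0 * LR) + b * (p ^+ 2 * LR - 0 * LI)); last by ring.
by rewrite -hI; field; rewrite pn0 addrC.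
Qed.

Lemma farey_eigen_hankel :
  {ae mu, forall t, Rpos t -> (a - expR (- t)) * pR t - b * pI t = hankel gR t} /\
  {ae mu, forall t, Rpos t -> (a - expR (- t)) * pI t + b * pR t = hankel gI t}.
Proof.
have one : 2^-1 < 1 :> R by lra.
have i1 (p : R) (x : R -> R) : 1 <= p -> measurable_fun [set: R] x ->
    intR (fun t => x t ^+ 2 * mhat_density t) -> intR (fun t => expR (- (p * t)) * x t).
  by move=> p1 mx ix; apply: intR_L2mhat => //; [lra|exact: measurable_funTS].
have i2 (p : R) (x : R -> R) : 1 <= p -> measurable_fun [set: R] x ->
    intR (fun t => x t ^+ 2 * mhat_density t) ->
    intR (fun t => expR (- (p * t)) * (expR (- t) * x t)).
  move=> p1 mx ix; have : 1 <= p + 1 by lra.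
  move=> /i1/(_ mx ix); apply: eq_intR => t _.
  by rewrite mulrDl mul1r opprD expRD mulrA.
have i3 (p : R) (x : R -> R) : 1 <= p -> measurable_fun [set: R] x ->
    intR (fun t => x t ^+ 2 * mhat_density t) ->
    intR (fun t => expR (- (p * t)) * hankel (fun t => expR (- t) * x t) t).
  move=> p1 mx ix; apply: intR_exp_hankel; [|exact: intR_mul_expN|exact: measurable_hankel|lra].
  exact: measurable_funM.
(* Serves both equations: the real one with [c = - b], the imaginary one with the two functions
   exchanged and [c = b]. *)
have key (x y : R -> R) (c : R) : measurable_fun [set: R] x ->
    intR (fun t => x t ^+ 2 * mhat_density t) -> measurable_fun [set: R] y ->
    intR (fun t => y t ^+ 2 * mhat_density t) ->
    (forall p, 1 <= p -> a * L x p + c * L y p =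
      L (fun t => expR (- t) * x t) p + L (hankel (fun t => expR (- t) * x t)) p) ->
    {ae mu, forall t, Rpos t ->
      (a - expR (- t)) * x t + c * y t = hankel (fun t => expR (- t) * x t) t}.
  move=> mx ix my iy hL.
  pose X t := (a * x t + c * y t) - (expR (- t) * x t + hankel (fun t => expR (- t) * x t) t).
  have XE p t : expR (- (p * t)) * X t =
      (a * (expR (- (p * t)) * x t) + c * (expR (- (p * t)) * y t)) -
      (expR (- (p * t)) * (expR (- t) * x t) +
       expR (- (p * t)) * hankel (fun t => expR (- t) * x t) t) by rewrite /X; ring.
  have iX p : 1 <= p ->
      intR (fun t => a * (expR (- (p * t)) * x t) + c * (expR (- (p * t)) * y t)) /\
      intR (fun t => expR (- (p * t)) * (expR (- t) * x t) +
       expR (- (p * t)) * hankel (fun t => expR (- t) * x t) t).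
    move=> p1; split; last by apply: intRD; [exact: i2|exact: i3].
    by apply: intRD; apply: intRZ; exact: i1.
  have : {ae mu, forall t, Rpos t -> X t = 0}.
    apply: (@laplace_unique _ _ 1).
      have [j1 j2] := iX _ (lexx 1).
      by apply: eq_intR (intRB j1 j2) => t _; rewrite XE.
    move=> p p1; have [j1 j2] := iX _ p1.
    under eq_Rintegral do rewrite XE.
    rewrite RintB// RintD ?RintZ ?RintD//; try (exact: i1 || exact: i2 || exact: i3);
      try (by apply: intRZ; exact: i1).
    by apply/eqP; rewrite subr_eq0; apply/eqP; exact: hL.
  apply: ae_imp => t h /h /eqP; rewrite subr_eq0 => /eqP e.
  by rewrite mulrBl addrAC e addrAC subrr add0r.
split.
  have : {ae mu, forall t, Rpos t -> (a - expR (- t)) * pR t + - b * pI t = hankel gR t}.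
    by apply: key => // p p1; rewrite mulNr; exact: (L_eigen p1).1.
  by apply: ae_imp => t h tR; rewrite -h// mulNr.
exact: key pI pR b mI iI mR iR (fun p p1 => (L_eigen p1).2).
Qed.

End Eigenfunction.
End FareyEigenfunction.

Theorem theorem4 (R : realType) (f : R[i] -> R[i]) (lambda : R[i])
    (f_H0 : in_H0 f) (lambda_neq0 : lambda <> 0)
    (f_eigen : forall w : R[i],
      farey_disk w -> farey_transfer f w = lambda * f w) :
  exists (F : R[i] -> R[i]) (psi : R -> R[i]),
    holomorphic_on right_half_plane F /\
    (forall w : R[i], farey_disk w -> F w = f w) /\
    L2 mhat_measure psi /\
    (forall w : R[i], right_half_plane w -> is_laplace psi w (F w)) /\
    (forall t : R, 0 < t -> is_hankel1 psi t (psi t)).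
Proof.
case: lambda lambda_neq0 f_eigen => a b ab0 f_eigen.
have [phi phi2 f_phi] := f_H0.
have [pR [pI [[mR mI] iR iI phiE]]] := borel_laplace phi2.
have fE w : farey_disk w -> f w = (w ^+ 2)^-1 * (laplaceC pR w^-1 + 'i%C * laplaceC pI w^-1).
  by move=> wD; rewrite f_phi// phiE.
have [eR eI] := farey_eigen_hankel mR mI iR iI fE f_eigen.
have [l l0 [elR elI]] : exists2 l : R, l != 0 &
    {ae lebesgue_measure, forall t, Rpos t ->
      (l - expR (- t)) * pR t = hankel (fun s => expR (- s) * pR s) t} /\
    {ae lebesgue_measure, forall t, Rpos t ->
      (l - expR (- t)) * pI t = hankel (fun s => expR (- s) * pI s) t}.
  have [b0|b0] := eqVneq b 0.
    exists a; first by apply/eqP => a0; apply: ab0; rewrite a0 b0.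
    by split; [apply: ae_imp eR|apply: ae_imp eI] => t h tR;
      rewrite -h// b0 mul0r ?subr0 ?addr0.
  have z := real_eigenvalue b0 mR mI (intR_mul_expN mR iR) (intR_mul_expN mI iI) eR eI.
  have hankel0 (p : R -> R) (t : R) : measurable_fun [set: R] p ->
      {ae lebesgue_measure, forall t, Rpos t -> p t = 0} ->
      hankel (fun s => expR (- s) * p s) t = 0.
    move=> mp p0; rewrite (@eq_ae_hankel _ _ (fun=> 0))//.
    - rewrite /hankel /bclif_int (@eq_RintR _ _ (fun=> 0)); last by move=> s _; rewrite mulr0.
      by rewrite Rintegral_cst// mul0r mulr0.
    - apply: measurable_funTS; apply: measurable_funM => //.
      by apply: measurable_funTS; apply: measurableT_comp => //; exact: measurable_funN.
    - by apply: ae_imp p0 => s h sR; rewrite h// mulr0.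
  have zR : {ae lebesgue_measure, forall t, Rpos t -> pR t = 0}.
    by apply: ae_imp z => t h /h [].
  have zI : {ae lebesgue_measure, forall t, Rpos t -> pI t = 0}.
    by apply: ae_imp z => t h /h [].
  (* Any nonzero value would do: both functions vanish almost everywhere, and so do both sides of
     the equation. *)
  exists 1; first exact: oner_neq0.
  by split; [apply: (ae_imp _ zR)|apply: (ae_imp _ zI)] => t h tR;
    rewrite h// mulr0 hankel0.
have [hR [mhR pRh lR sR cR]] := eigen_hankel l0 mR iR elR.
have [hI [mhI pIh lI sI cI]] := eigen_hankel l0 mI iI elI.
exists (fun w => laplaceC hR w + 'i%C * laplaceC hI w), (fun t => hR t +i* hI t).
split; [|split; [|split; [|split]]].
- move=> w w0; have dR := holomorphic_laplaceC mhR lR w0.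
  have dI := holomorphic_laplaceC mhI lI w0.
  have c : derivable (fun=> 'i%C : R[i]^o) (w : R[i]^o) 1 by exact: derivable_cst.
  exact: (@derivableD _ _ _ _ _ _ _ dR (@derivableM _ _ _ _ _ _ c dI)).
(* The symmetry of the transform of [h] converts [w^-2 L[p](1 / w)], the form of [f] on the disk,
   into the ordinary transform at [w]. *)
- move=> w wD; rewrite fE// (sR w (farey_disk_gt0 wD)) (sI w (farey_disk_gt0 wD)).
  rewrite (ae_eq_laplaceC _ (measurable_funTS mR) mhR pRh).
  by rewrite (ae_eq_laplaceC _ (measurable_funTS mI) mhI pIh); ring.
- split=> //=; rewrite (@ge0_integral_density _ mhat_measure _ mhat_density_ge0)//.
  (* Square integrability passes from [pR] and [pI], to which [hR] and [hI] are equal almost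
     everywhere. *)
  + have : intR (fun t => pR t ^+ 2 * mhat_density t + pI t ^+ 2 * mhat_density t).
      exact: intRD.
    have mm := measurable_density (@mhat_density_continuous R).
    move=> /integrableP[_]; apply: le_lt_trans; rewrite le_eqVlt; apply/orP; left; apply/eqP.
    apply: ae_eq_integral => //.
    * apply/measurable_EFinP; apply: measurable_funM; last exact: mm.
      by apply: measurable_funD; exact: measurable_funX.
    * apply: measurableT_comp => //; apply/measurable_EFinP.
      apply: measurable_funD; apply: measurable_funM => //; apply: measurable_funX;
        exact: measurable_funTS.
    * apply: ae_imp2 pRh pIh => t h1 h2 tR; have t0 := Rpos_gt0 tR.
      rewrite /= h1// h2// -mulrDl ger0_norm// mulr_ge0 ?mhat_density_ge0//.
      by rewrite addr_ge0 ?sqr_ge0.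
  + exact: measurable_density mhat_density_continuous.
  + by apply: measurable_funD; exact: measurable_funX.
  + by move=> t _; rewrite addr_ge0 ?sqr_ge0.
- by move=> w w0; apply: is_laplaceC => //; [exact: lR|exact: lI].
- move=> t t0; have [iR1 cR1] := cR t t0; have [iI1 cI1] := cI t t0.
  (* The identification with the Bessel kernel divides by [s], so it is restricted to the points of
     [(0, A]]. *)
  have kR (A s : R) : s \in `]0, A]%classic ->
      complex.Re ((besselJ1 (2 * Num.sqrt (s * t)) * Num.sqrt (t / s))%:C * (hR s +i* hI s)) =
      t * bclif 1 (s * t) * hR s.
    by move=> /set_mem /=; rewrite in_itv/= => /andP[s0 _]; rewrite besselJ1_kernel// mul0r subr0.
  have kI (A s : R) : s \in `]0, A]%classic ->
      complex.Im ((besselJ1 (2 * Num.sqrt (s * t)) * Num.sqrt (t / s))%:C * (hR s +i* hI s)) =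
      t * bclif 1 (s * t) * hI s.
    by move=> /set_mem /=; rewrite in_itv/= => /andP[s0 _]; rewrite besselJ1_kernel// mul0r addr0.
  split=> [A A0|].
    split; [apply: eq_integrable (iR1 A) => // s sA|apply: eq_integrable (iI1 A) => // s sA].
      by rewrite (kR A).
    by rewrite (kI A).
  apply: cvg_trans (cvg_complex cR1 cI1); apply: near_eq_cvg; apply: nearW => A.
  rewrite /cintegral; congr (_ +i* _); apply: eq_Rintegral => s sA.
    by rewrite (kR A).
  by rewrite (kI A).
Qed.
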